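(* Let $U\subset\mathbb{R}^n$ be open, $m\in\mathbb{R}$, and $a\in C^\infty(U\times\mathbb{R}^d)$. Equip $\mathbb{R}^d$ and $\mathbb{R}^d\times\mathbb{R}$ with the graded dilations $\delta_s(\xi)=(s^{\rho_1}\xi_1,\dots,s^{\rho_d}\xi_d)$ and $\tilde\delta_s(\xi,t)=(\delta_s\xi,st)$ respectively, where $\rho_1,\dots,\rho_d$ are positive integers and $s>0$. Then the following are equivalent: (1) $a\in S^m_{phg,G}(U\times\mathbb{R}^d)$. (2) There exists $u\in\mathcal{HS}^m_G(U\times\mathbb{R}^d\times\mathbb{R})$ such that $u(x,\xi,1)=a(x,\xi)$ for all $(x,\xi)\in U\times\mathbb{R}^d$.
   Context: A homogeneous quasi-norm on a space with dilations $\delta_s$ is a function $|\cdot|\ge0$ with $|-x|=|x|$, $|\delta_sx|=s|x|$ for $s>0$, $|x|=0\Leftrightarrow x=0$, and $|x+y|\le C(|x|+|y|)$ for some $C>0$; one such is fixed on each space, e.g. $|\xi|=\sum_k|\xi_k|^{1/\rho_k}$ on $\mathbb{R}^d$ and $|(\xi,t)|=|\xi|+|t|$ on $\mathbb{R}^{d+1}$. For a multi-index $\beta$, $|\beta|=\rho_1\beta_1+\dots+\rho_d\beta_d$. $\mathcal{H}^m_G(U\times\mathbb{R}^d)$: smooth functions $f$ on $U\times(\mathbb{R}^d\setminus\{0\})$ with $f(x,\delta_s\xi)=s^mf(x,\xi)$ for all $s>0$. $S^m_G(U\times\mathbb{R}^d)$: functions $a\in C^\infty(U\times\mathbb{R}^d)$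 such that for every compact $K\subset U$ and all multi-indices $\alpha,\beta$ there is $C>0$ with $|\partial_x^\alpha\partial_\xi^\beta a(x,\xi)|\le C(1+|\xi|)^{m-|\beta|}$ for $(x,\xi)\in K\times\mathbb{R}^d$. $S^m_{phg,G}(U\times\mathbb{R}^d)$: functions $a\in S^m_G(U\times\mathbb{R}^d)$ for which there exist $a_j\in\mathcal{H}^{m-j}_G(U\times\mathbb{R}^d)$, $j\in\mathbb{N}$, such that for every integer $N\ge0$ and every smooth $\chi$ on $\mathbb{R}^d$ vanishing on a compact neighbourhood of $0$ and equal to $1$ near infinity, $a-\sum_{j=0}^N\chi(\xi)a_j\in S^{m-N-1}_G(U\times\mathbb{R}^d)$. $\mathcal{S}_G(U\times\mathbb{R}^{d+1})$: functions $f\in C^\infty(U\times\mathbb{R}^{d+1})$ such that for every compact $K\subset U$, $k\in\mathbb{N}$ and multi-indices $\alpha,\beta$ there is $C>0$ with $|\partial_x^\alpha\partial_{(\xi,t)}^\beta f(x,\xi,t)|\le C(1+|(\xi,t)|)^{-k}$ for $x\in K$, $(\xi,t)\in\mathbb{R}^{d+1}$. $\mathcal{HS}^m_G(U\times\mathbb{R}^d\times\mathbb{R})$: functions $u\in C^\infty(U\times\mathbb{R}^{d+1})$ such that for all $s>0$ the function $(x,\xi,t)\mapsto u(x,\tilde\delta_s(\xi,t))-s^mu(x,\xi,t)$ lies in $\mathcal{S}_G(U\times\mathbb{R}^{d+1})$. *)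

(* Defs.v *)
(* All function spaces consist of complex-valued
   functions; R : realType is the field of real numbers, R^N is 'rV[R]_N. *)
From mathcomp Require Import all_boot all_order all_algebra.
From mathcomp Require Import all_classical all_reals all_analysis.
From mathcomp.real_closed Require Import complex.

Set Implicit Arguments.
Unset Strict Implicit.
Unset Printing Implicit Defensive.

Import Order.TTheory GRing.Theory Num.Theory.
Import numFieldNormedType.Exports.

Local Open Scope classical_set_scope.
Local Open Scope ring_scope.

(* The product R^n x R^d is 'rV[R]_(n + d): the pair (x, xi) is [row_mx x xi].
   A function on a subset A of R^N is a total function on 'rV[R]_N whose values
   outside A are irrelevant: below A is always open, so the derivatives at a
   point of A depend only on the values on A. *)
Definition prod_set (R : realType) n d (U : set 'rV[R]_n) (V : set 'rV[R]_d) :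
    set 'rV[R]_(n + d) :=
  [set z | U (lsubmx z) /\ V (rsubmx z)].

Definition pderivs (R : realType) N (s : seq 'I_N) (f : 'rV[R]_N -> R) :
    'rV[R]_N -> R :=
  foldr (fun i g z => 'D_(delta_mx 0 i) g z) f s.

(* C^oo: the partial derivatives of all orders, in any order of the variables,
   exist and are continuous on A. *)
Definition rsmooth_on (R : realType) N (A : set 'rV[R]_N) (f : 'rV[R]_N -> R) :=
  forall (s : seq 'I_N) z, A z ->
    {for z, continuous (pderivs s f)} /\
    forall i : 'I_N, derivable (pderivs s f) z (delta_mx 0 i).

(* For complex-valued functions of real variables, smoothness and partial
   derivatives are taken componentwise. *)
Definition smooth_on (R : realType) N (A : set 'rV[R]_N)
    (f : 'rV[R]_N -> R[i]) :=
  rsmooth_on A (fun z => complex.Re (f z)) /\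
  rsmooth_on A (fun z => complex.Im (f z)).

Definition cpderivs (R : realType) N (s : seq 'I_N) (f : 'rV[R]_N -> R[i])
    (z : 'rV[R]_N) : R[i] :=
  Complex (pderivs s (fun w => complex.Re (f w)) z)
          (pderivs s (fun w => complex.Im (f w)) z).

Definition mi_seq N (g : 'I_N -> nat) : seq 'I_N :=
  flatten [seq nseq (g i) i | i <- enum 'I_N].

(* The mixed derivative d_x^al d_xi^be on R^n x R^d. *)
Definition mderiv (R : realType) n d (al : 'I_n -> nat) (be : 'I_d -> nat)
    (f : 'rV[R]_(n + d) -> R[i]) : 'rV[R]_(n + d) -> R[i] :=
  cpderivs (map (@lshift n d) (mi_seq al) ++ map (@rshift n d) (mi_seq be)) f.

Definition dil (R : realType) d (rho : 'I_d -> nat) (s : R) (xi : 'rV[R]_d) :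
    'rV[R]_d :=
  \row_i (s ^+ rho i * xi 0 i).

Definition dilt (R : realType) d (rho : 'I_d -> nat) (s : R)
    (xit : 'rV[R]_(d + 1)) : 'rV[R]_(d + 1) :=
  row_mx (dil rho s (lsubmx xit)) (s *: rsubmx xit).

Definition wt d (rho be : 'I_d -> nat) : nat := (\sum_(i < d) rho i * be i)%N.

Definition homogeneous_quasinorm (R : realType) N
    (delta : R -> 'rV[R]_N -> 'rV[R]_N) (q : 'rV[R]_N -> R) :=
  [/\ forall x, 0 <= q x,
      forall x, q (- x) = q x,
      forall s x, 0 < s -> q (delta s x) = s * q x,
      forall x, q x = 0 <-> x = 0 &
      exists2 C : R, 0 < C & forall x y, q (x + y) <= C * (q x + q y)].

Definition homog_class (R : realType) n d (rho : 'I_d -> nat)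
    (U : set 'rV[R]_n) (m : R) (f : 'rV[R]_(n + d) -> R[i]) :=
  smooth_on (prod_set U [set xi | xi != 0]) f /\
  forall (s : R) x xi, 0 < s -> U x -> xi != 0 ->
    f (row_mx x (dil rho s xi)) = (s `^ m)%:C%C * f (row_mx x xi).

Definition symbol_class (R : realType) n d (rho : 'I_d -> nat)
    (q : 'rV[R]_d -> R) (U : set 'rV[R]_n) (m : R)
    (a : 'rV[R]_(n + d) -> R[i]) :=
  smooth_on (prod_set U setT) a /\
  forall (K : set 'rV[R]_n), compact K -> K `<=` U ->
  forall (al : 'I_n -> nat) (be : 'I_d -> nat),
  exists2 C : R, 0 < C & forall x xi, K x ->
    Normc.normc (mderiv al be a (row_mx x xi))
      <= C * (1 + q xi) `^ (m - (wt rho be)%:R).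

Definition cutoff (R : realType) d (chi : 'rV[R]_d -> R[i]) :=
  [/\ smooth_on setT chi,
      exists K : set 'rV[R]_d,
        [/\ compact K, nbhs (0 : 'rV[R]_d) K & forall xi, K xi -> chi xi = 0] &
      exists2 L : set 'rV[R]_d, compact L & forall xi, ~ L xi -> chi xi = 1].

(* The value of [aj j] at xi = 0 is meaningless, but there chi vanishes. *)
Definition phg_symbol_class (R : realType) n d (rho : 'I_d -> nat)
    (q : 'rV[R]_d -> R) (U : set 'rV[R]_n) (m : R)
    (a : 'rV[R]_(n + d) -> R[i]) :=
  symbol_class rho q U m a /\
  exists2 aj : nat -> 'rV[R]_(n + d) -> R[i],
    forall j, homog_class rho U (m - j%:R) (aj j) &
    forall (N : nat) (chi : 'rV[R]_d -> R[i]), cutoff chi ->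
      symbol_class rho q U (m - N%:R - 1)
        (fun z => a z - \sum_(0 <= j < N.+1) chi (rsubmx z) * aj j z).

Definition schwartz_class (R : realType) n d (q : 'rV[R]_(d + 1) -> R)
    (U : set 'rV[R]_n) (f : 'rV[R]_(n + (d + 1)) -> R[i]) :=
  smooth_on (prod_set U setT) f /\
  forall (K : set 'rV[R]_n), compact K -> K `<=` U ->
  forall (k : nat) (al : 'I_n -> nat) (be : 'I_(d + 1) -> nat),
  exists2 C : R, 0 < C & forall x xit, K x ->
    Normc.normc (mderiv al be f (row_mx x xit)) <= C * (1 + q xit) ^- k.

(* Functions on U x R^(d+1) that are homogeneous of degree m modulo the
   Schwartz class. *)
Definition hs_class (R : realType) n d (rho : 'I_d -> nat)
    (q : 'rV[R]_(d + 1) -> R) (U : set 'rV[R]_n) (m : R)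
    (u : 'rV[R]_(n + (d + 1)) -> R[i]) :=
  smooth_on (prod_set U setT) u /\
  forall s : R, 0 < s ->
    schwartz_class q U
      (fun z => u (row_mx (lsubmx z) (dilt rho s (rsubmx z)))
                - (s `^ m)%:C%C * u z).

(* Main.v *)
(* (2) => (1).  If u is homogeneous of degree m modulo the Schwartz class, then
   v = lim_k 2^(-km) u(x, 2^k . (xi, t)) exists with all derivatives away from the
   origin, because consecutive terms differ by rescalings of a Schwartz function;
   v is exactly homogeneous and u - v is rapidly decaying.  The coefficients are
   a_j = d_t^j v(., 0) / j!: the derivatives of the Taylor remainder at t = 1 are
   bounded by d_t^N v(x, xi, t) for t in [0, 1], hence, by homogeneity, by
   |xi|^(m - N).

   (1) => (2).  By Borel's lemma, b = sum_j t^j a_j(x, xi) phi(mu_j t / |xi|) with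
   mu_j growing fast is homogeneous of degree m and smooth off the origin, with
   Taylor coefficients a_j at t = 0.  By the Taylor argument above b(., 1) and a
   have the same expansion, so that they differ by a symbol r of order -oo; cutting
   b off near the origin and adding r(x, xi) eta(t), where eta is a bump function
   with eta(1) = 1, gives u.

   Everything is done on real and imaginary parts.  A quasi-norm is comparable to
   the 2M-th root of the polynomial sum_i xi_i^(2M / rho_i), M being a common
   multiple of the weights. *)
Require Import Defs.
From mathcomp Require Import all_boot all_order all_algebra.
From mathcomp Require Import all_classical all_reals all_analysis.
From mathcomp Require Import ring lra.
From mathcomp.real_closed Require Import complex.
Import Order.TTheory GRing.Theory Num.Theory.
Import numFieldNormedType.Exports.
Local Open Scope classical_set_scope.
Local Open Scope ring_scope.
Set Implicit Arguments.
Unset Strict Implicit.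
Unset Printing Implicit Defensive.

(** * Iterated partial derivatives *)

(** The obstacle in both directions is a singular set. A homogeneous function is singular at the
    origin, so expansions are compared by [symb_out], for large xi only, and compactness restores
    the full estimate whenever the function is smooth across xi = 0. The Borel sum meets a larger
    singular set: each a_j(x, xi) is meaningless on the whole t-axis, whereas b must be smooth at
    (0, t) for t <> 0. Cutting off in t / |xi| settles this together with homogeneity: the quotient
    is invariant under dilations, and near such a point every summand vanishes because mu_j >= 1.

    Both limits, of dilates and of partial sums, rest on one criterion: the derivatives of each
    order of consecutive terms differ by O(2^-k), locally uniformly. For the dilates the rate comes
    from remainders of order e <= m - 1, since rescaling by 2^k and dividing by 2^(km) leaves 2^(k(e
    - m)). For the Borel sum the rate is imposed, and it dictates mu_k. *)

Definition pd (R : realType) N (i : 'I_N) (f : 'rV[R]_N -> R) : 'rV[R]_N -> R :=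
  fun z => 'D_(delta_mx 0 i) f z.

Lemma pderivs_cons (R : realType) N i s (f : 'rV[R]_N -> R) :
  pderivs (i :: s) f = pd i (pderivs s f).
Proof. by []. Qed.

Lemma pderivs_cat (R : realType) N s1 s2 (f : 'rV[R]_N -> R) :
  pderivs (s1 ++ s2) f = pderivs s1 (pderivs s2 f).
Proof. by rewrite /pderivs foldr_cat. Qed.

Lemma pderivs_rcons (R : realType) N i s (f : 'rV[R]_N -> R) :
  pderivs (rcons s i) f = pderivs s (pd i f).
Proof. by rewrite /pderivs foldr_rcons. Qed.

(** Smoothness graded by order. The rules for products, inverses and compositions express a
    derivative through functions of the same kind, so they need induction on a finite order, which
    [rsmooth_on] does not offer; [smoothP] passes between the two. *)
Fixpoint Ck (R : realType) N (A : set 'rV[R]_N) k (f : 'rV[R]_N -> R) : Prop :=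
  (forall z, A z -> {for z, continuous f}) /\
  match k with
  | 0%N => True
  | k'.+1 => (forall i z, A z -> derivable f z (delta_mx 0 i)) /\
             (forall i, Ck A k' (pd i f))
  end.

Lemma Ck_cont (R : realType) N (A : set 'rV[R]_N) k f :
  Ck A k f -> forall z, A z -> {for z, continuous f}.
Proof. by case: k => [|k] []. Qed.

Lemma CkS (R : realType) N (A : set 'rV[R]_N) k f : Ck A k.+1 f -> Ck A k f.
Proof.
elim: k f => [|k IH] f; first by move=> [cf _]; split.
move=> [cf [df Cf]]; split=> //; split=> // i; exact/IH/Cf.
Qed.

Lemma Ck_pd (R : realType) N (A : set 'rV[R]_N) k f i :
  Ck A k.+1 f -> Ck A k (pd i f).
Proof. by move=> [_ [_]]; exact. Qed.

Lemma Ck_pderivs (R : realType) N (A : set 'rV[R]_N) s k f :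
  Ck A (size s + k) f -> Ck A k (pderivs s f).
Proof.
elim: s k => [|i s IH] k //= Cf.
have /IH [_ [_]] : Ck A (size s + k.+1) f by rewrite addnS.
exact.
Qed.

Lemma smooth_pd (R : realType) N (A : set 'rV[R]_N) i f :
  rsmooth_on A f -> rsmooth_on A (pd i f).
Proof. by move=> sf s z Az; rewrite -pderivs_rcons; exact: sf. Qed.

Lemma smooth_pderivs (R : realType) N (A : set 'rV[R]_N) s f :
  rsmooth_on A f -> rsmooth_on A (pderivs s f).
Proof. by move=> sf s' z Az; rewrite -pderivs_cat; exact: sf. Qed.

Lemma smooth_cont (R : realType) N (A : set 'rV[R]_N) f z :
  rsmooth_on A f -> A z -> {for z, continuous f}.
Proof. by move=> /(_ [::] z) /[apply] -[]. Qed.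

Lemma smooth_derivable (R : realType) N (A : set 'rV[R]_N) f z i :
  rsmooth_on A f -> A z -> derivable f z (delta_mx 0 i).
Proof. by move=> /(_ [::] z) /[apply] -[_]; exact. Qed.

Lemma smooth_is_derive (R : realType) N (A : set 'rV[R]_N) f z i :
  rsmooth_on A f -> A z -> is_derive z (delta_mx 0 i) f (pd i f z).
Proof. move=> sf Az; exact/derivableP/smooth_derivable/Az/sf. Qed.

Lemma smoothP (R : realType) N (A : set 'rV[R]_N) f :
  rsmooth_on A f <-> forall k, Ck A k f.
Proof.
split=> [+ k|Cf s z Az].
  elim: k f => [|k IH] f sf /=; split => //.
  - by move=> z Az; exact: smooth_cont sf Az.
  - by move=> z Az; exact: smooth_cont sf Az.
  - by split=> [i z Az|i]; [exact: smooth_derivable sf Az|exact/IH/smooth_pd].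
have [c [d _]] : Ck A 1 (pderivs s f) by exact/Ck_pderivs/Cf.
by split=> [|i]; [exact: c|exact: d].
Qed.

Lemma near_set (R : realType) N (A : set 'rV[R]_N) (P : 'rV[R]_N -> Prop) z :
  open A -> A z -> (forall x, A x -> P x) -> \forall x \near z, P x.
Proof.
move=> oA Az AP; apply: (filterS AP).
by move: (open_nbhs_nbhs (conj oA Az)).
Qed.

Lemma eq_pd (R : realType) N (A : set 'rV[R]_N) i f g z : open A ->
  (forall x, A x -> f x = g x) -> A z -> pd i f z = pd i g z.
Proof.
move=> oA fg Az; apply: near_eq_derive; exact: near_set oA Az fg.
Qed.

Lemma near_continuous (T : topologicalType) (R : realType) (f g : T -> R) z :
  {near z, f =1 g} -> {for z, continuous f} -> {for z, continuous g}.
Proof.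
move=> fg; rewrite /prop_for /continuous_at -(nbhs_singleton fg) => cf.
by apply: cvg_trans cf; exact: near_eq_cvg.
Qed.

Lemma eq_Ck (R : realType) N (A : set 'rV[R]_N) k f g : open A ->
  (forall x, A x -> f x = g x) -> Ck A k f -> Ck A k g.
Proof.
move=> oA; elim: k f g => [|k IH] f g fg [cf].
  by split=> // z Az; exact: near_continuous (near_set oA Az fg) (cf _ Az).
have cg z : A z -> {for z, continuous g}.
  by move=> Az; exact: near_continuous (near_set oA Az fg) (cf _ Az).
move=> [df Cf]; split=> //; split=> [i z Az|i]; last first.
  apply: (IH (pd i f)); last exact: Cf.
  by move=> x; exact: eq_pd oA fg.
apply: near_eq_derivable (df _ _ Az); exact: near_set oA Az fg.
Qed.

Lemma eq_smooth (R : realType) N (A : set 'rV[R]_N) f g : open A ->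
  (forall x, A x -> f x = g x) -> rsmooth_on A f -> rsmooth_on A g.
Proof. by move=> oA fg /smoothP Cf; apply/smoothP => k; exact: eq_Ck (Cf k). Qed.

Lemma eq_pderivs (R : realType) N (A : set 'rV[R]_N) s f g z : open A ->
  (forall x, A x -> f x = g x) -> A z -> pderivs s f z = pderivs s g z.
Proof.
move=> oA fg; elim: s z => [|i s IH] z Az; first exact: fg.
by rewrite !pderivs_cons; apply: eq_pd oA _ Az.
Qed.

Lemma sub_smooth (R : realType) N (A B : set 'rV[R]_N) f :
  B `<=` A -> rsmooth_on A f -> rsmooth_on B f.
Proof. by move=> BA sf s z /BA; exact: sf. Qed.

Lemma smooth_local (R : realType) N (A : set 'rV[R]_N) f :
  (forall z, A z -> exists B, B z /\ rsmooth_on B f) -> rsmooth_on A f.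
Proof. by move=> h s z /h[B [Bz sf]]; exact: sf. Qed.

(** A derivative is usually known by a formula [g i] valid on [A] only. Since [A] is open, agreement
    on [A] is enough for all further derivatives. *)
Lemma Ck_succ (R : realType) N (A : set 'rV[R]_N) k f
    (g : 'I_N -> 'rV[R]_N -> R) : open A ->
  (forall z, A z -> {for z, continuous f}) ->
  (forall i z, A z -> is_derive z (delta_mx 0 i) f (g i z)) ->
  (forall i, Ck A k (g i)) -> Ck A k.+1 f.
Proof.
move=> oA cf df Cg; split=> //; split=> [i z /(df i)/@ex_derive//|i].
apply: (@eq_Ck _ _ _ _ (g i)) => // x Ax.
by rewrite /pd; move: (df i x Ax) => /@derive_val.
Qed.

Lemma Ck_is_derive (R : realType) N (A : set 'rV[R]_N) k f z i :
  Ck A k.+1 f -> A z -> is_derive z (delta_mx 0 i) f (pd i f z).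
Proof. by move=> [_ [df _]] Az; exact/derivableP/df. Qed.

(** * Closure of C^k and smooth functions under algebra and composition *)

Lemma Ck_cst (R : realType) N (A : set 'rV[R]_N) k (c : R) :
  Ck A k (fun=> c).
Proof.
elim: k c => [|k IH] c; split=> //; try by move=> z _; exact: cst_continuous.
split=> [i z _|i]; first exact: derivable_cst.
rewrite (_ : pd i _ = fun=> 0); first exact: IH.
by apply/funext => z; exact: derive_cst.
Qed.

Lemma CkD (R : realType) N (A : set 'rV[R]_N) k f g : open A ->
  Ck A k f -> Ck A k g -> Ck A k (fun z => f z + g z).
Proof.
move=> oA; elim: k f g => [|k IH] f g Cf Cg.
  by split=> // z Az; apply: (@continuousD _ _ _ f g); [exact: Ck_cont Cf _ Az|exact: Ck_cont Cg _ Az].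
apply: (Ck_succ (g := fun i z => pd i f z + pd i g z)) => //.
- by move=> z Az; apply: (@continuousD _ _ _ f g); [exact: Ck_cont Cf _ Az|exact: Ck_cont Cg _ Az].
- move=> i z Az.
  have := Ck_is_derive i Cf Az; have := Ck_is_derive i Cg Az => dg df.
  exact: (@is_deriveD _ _ _ f g).
- by move=> i; apply: IH; exact: Ck_pd.
Qed.

Lemma CkM (R : realType) N (A : set 'rV[R]_N) k f g : open A ->
  Ck A k f -> Ck A k g -> Ck A k (fun z => f z * g z).
Proof.
move=> oA; elim: k f g => [|k IH] f g Cf Cg.
  by split=> // z Az; apply: (@continuousM _ _ f g); [exact: Ck_cont Cf _ Az|exact: Ck_cont Cg _ Az].
apply: (Ck_succ (g := fun i z => f z * pd i g z + g z * pd i f z)) => //.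
- by move=> z Az; apply: (@continuousM _ _ f g); [exact: Ck_cont Cf _ Az|exact: Ck_cont Cg _ Az].
- move=> i z Az.
  have := Ck_is_derive i Cf Az; have := Ck_is_derive i Cg Az => dg df.
  exact: (@is_deriveM _ _ f g).
- by move=> i; apply: CkD => //; apply: IH; by [exact: CkS|exact: Ck_pd].
Qed.

(** The derivative [- f^-2 * pd i f] contains the inverse of [f] again, but only to order [k], where
    the induction hypothesis applies. *)
Lemma CkV (R : realType) N (A : set 'rV[R]_N) k f : open A ->
  (forall z, A z -> f z != 0) -> Ck A k f -> Ck A k (fun z => (f z)^-1).
Proof.
move=> oA f0; have cV (g : 'rV[R]_N -> R) : (forall z, A z -> {for z, continuous g}) ->
    (forall z, A z -> g z != 0) ->
    forall z, A z -> {for z, continuous (fun z => (g z)^-1)}.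
  move=> cg g0 z Az; exact: (@continuousV _ _ g z (g0 z Az) (cg z Az)).
elim: k => [|k IH] Cf; first by split=> //; apply: cV => //; exact: Ck_cont Cf.
apply: (Ck_succ (g := fun i z => (-1) * ((f z)^-1 * (f z)^-1) * pd i f z)) => //.
- by apply: cV => //; exact: Ck_cont Cf.
- move=> i z Az; have [df dfE] := Ck_is_derive i Cf Az.
  apply: DeriveDef; first by apply: derivableV => //; exact: f0.
  by rewrite deriveV ?f0// dfE /GRing.scale/= -exprVn expr2 mulN1r.
- move=> i; have CV := IH (CkS Cf).
  apply: CkM => //; last exact: Ck_pd.
  by apply: CkM => //; [exact: Ck_cst|exact: CkM].
Qed.

(** Turns a directional derivative into an ordinary one at 0, which makes the one-variable chain
    rule and mean value theorem available. *)
Lemma derive_line (R : realType) (V : normedModType R) (f : V -> R) z v :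
  (fun h : R => h^-1 *: ((f \o shift z) (h *: v) - f z)) =
  (fun h : R => h^-1 *: (((fun k : R => f (k *: v + z)) \o shift 0) (h *: 1)
     - (fun k : R => f (k *: v + z)) 0)).
Proof.
by apply/funext => h /=; rewrite scale0r add0r addr0 /GRing.scale/= mulr1.
Qed.

Lemma derivable_line (R : realType) (V : normedModType R) (f : V -> R) z v :
  derivable f z v <-> derivable (fun k : R => f (k *: v + z)) (0 : R) 1.
Proof. by rewrite /derivable (derive_line f). Qed.

Lemma derive_lineE (R : realType) (V : normedModType R) (f : V -> R) z v :
  'D_v f z = 'D_1 (fun k : R => f (k *: v + z)) (0 : R).
Proof. by rewrite /derive (derive_line f). Qed.

Lemma is_derive_line (R : realType) (V : normedModType R) (f : V -> R) z v l :
  is_derive z v f l <-> is_derive (0 : R) 1 (fun k : R => f (k *: v + z)) l.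
Proof.
split=> -[d e]; apply: DeriveDef.
- exact: (derivable_line f z v).1.
- by rewrite -derive_lineE.
- exact: (derivable_line f z v).2.
- by rewrite derive_lineE.
Qed.

(** The outer function comes with the tower of its successive derivatives. The induction treats all
    [j] at once because one differentiation moves from [phi j] to [phi j.+1]. *)
Lemma Ck_comp1 (R : realType) N (A : set 'rV[R]_N) (D : set R) k
    (phi : nat -> R -> R) j f : open A ->
  (forall j y, D y -> is_derive y 1 (phi j) (phi j.+1 y)) ->
  (forall z, A z -> D (f z)) -> Ck A k f -> Ck A k (fun z => phi j (f z)).
Proof.
move=> oA dphi AD; elim: k j => [|k IH] j Cf.
  split=> // z Az; apply: (@continuous_comp _ _ _ f (phi j)); first exact: Ck_cont Cf _ Az.
  apply/differentiable_continuous/derivable1_diffP.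
  by case: (dphi j _ (AD _ Az)).
apply: (Ck_succ (g := fun i z => phi j.+1 (f z) * pd i f z)) => //.
- move=> z Az; apply: (@continuous_comp _ _ _ f (phi j)); first exact: Ck_cont Cf _ Az.
  apply/differentiable_continuous/derivable1_diffP.
  by case: (dphi j _ (AD _ Az)).
- move=> i z Az; apply: (is_derive_line _ _ _ _).2.
  have df := (is_derive_line _ _ _ _).1 (Ck_is_derive i Cf Az).
  apply: (@is_derive1_comp _ (phi j) (fun k : R => f (k *: delta_mx 0 i + z))).
  by rewrite scale0r add0r; exact/dphi/AD.
- by move=> i; apply: CkM => //; [exact/IH/CkS|exact: Ck_pd].
Qed.

Lemma smooth_cst (R : realType) N (A : set 'rV[R]_N) (c : R) :
  rsmooth_on A (fun=> c).
Proof. by apply/smoothP => k; exact: Ck_cst. Qed.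

Lemma smoothD (R : realType) N (A : set 'rV[R]_N) f g : open A ->
  rsmooth_on A f -> rsmooth_on A g -> rsmooth_on A (fun z => f z + g z).
Proof. by move=> oA /smoothP Cf /smoothP Cg; apply/smoothP => k; exact: CkD. Qed.

Lemma smoothM (R : realType) N (A : set 'rV[R]_N) f g : open A ->
  rsmooth_on A f -> rsmooth_on A g -> rsmooth_on A (fun z => f z * g z).
Proof. by move=> oA /smoothP Cf /smoothP Cg; apply/smoothP => k; exact: CkM. Qed.

Lemma smoothV (R : realType) N (A : set 'rV[R]_N) f : open A ->
  (forall z, A z -> f z != 0) ->
  rsmooth_on A f -> rsmooth_on A (fun z => (f z)^-1).
Proof. by move=> oA f0 /smoothP Cf; apply/smoothP => k; exact: CkV. Qed.

Lemma smoothZ (R : realType) N (A : set 'rV[R]_N) (c : R) f : open A ->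
  rsmooth_on A f -> rsmooth_on A (fun z => c * f z).
Proof. by move=> oA; apply: smoothM => //; exact: smooth_cst. Qed.

Lemma smoothB (R : realType) N (A : set 'rV[R]_N) f g : open A ->
  rsmooth_on A f -> rsmooth_on A g -> rsmooth_on A (fun z => f z - g z).
Proof.
move=> oA sf sg; apply: (smoothD oA sf).
by apply: eq_smooth (smoothZ (-1) oA sg) => [//|z _]; rewrite mulN1r.
Qed.

Lemma smooth_sum (R : realType) N (A : set 'rV[R]_N) I (r : seq I)
    (f : I -> 'rV[R]_N -> R) : open A -> (forall i, rsmooth_on A (f i)) ->
  rsmooth_on A (fun z => \sum_(i <- r) f i z).
Proof.
move=> oA sf; elim: r => [|i r IH].
  apply: (@eq_smooth _ _ _ (fun=> 0) _ oA); last exact: smooth_cst.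
  by move=> z _; rewrite big_nil.
apply: (@eq_smooth _ _ _ (fun z => f i z + \sum_(i <- r) f i z) _ oA).
  by move=> z _; rewrite big_cons.
exact: (smoothD oA (sf i) IH).
Qed.

Lemma smoothX (R : realType) N (A : set 'rV[R]_N) f k : open A ->
  rsmooth_on A f -> rsmooth_on A (fun z => f z ^+ k).
Proof.
move=> oA sf; elim: k => [|k IH]; first exact: smooth_cst.
by apply: eq_smooth (smoothM oA sf IH) => // z _; rewrite exprS.
Qed.

Lemma smooth_comp1 (R : realType) N (A : set 'rV[R]_N) (D : set R)
    (phi : nat -> R -> R) f : open A ->
  (forall j y, D y -> is_derive y 1 (phi j) (phi j.+1 y)) ->
  (forall z, A z -> D (f z)) -> rsmooth_on A f ->
  rsmooth_on A (fun z => phi 0%N (f z)).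
Proof.
move=> oA dphi AD /smoothP Cf; apply/smoothP => k.
exact: Ck_comp1 oA dphi AD (Cf k).
Qed.

Lemma pdD (R : realType) N (A : set 'rV[R]_N) i f g z :
  rsmooth_on A f -> rsmooth_on A g -> A z ->
  pd i (fun z => f z + g z) z = pd i f z + pd i g z.
Proof.
move=> sf sg Az.
rewrite /pd -(deriveD (smooth_derivable sf Az) (smooth_derivable sg Az)); by [].
Qed.

Lemma pderivsD (R : realType) N (A : set 'rV[R]_N) s f g z : open A ->
  rsmooth_on A f -> rsmooth_on A g -> A z ->
  pderivs s (fun z => f z + g z) z = pderivs s f z + pderivs s g z.
Proof.
move=> oA sf sg; elim: s z => [//|i s IH] z Az.
rewrite !pderivs_cons (eq_pd _ oA IH Az).
by apply: pdD Az; exact: smooth_pderivs.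
Qed.

Lemma pdM (R : realType) N (A : set 'rV[R]_N) i f g z :
  rsmooth_on A f -> rsmooth_on A g -> A z ->
  pd i (fun z => f z * g z) z = f z * pd i g z + g z * pd i f z.
Proof.
move=> sf sg Az.
exact: (deriveM (smooth_derivable sf Az) (smooth_derivable sg Az)).
Qed.

Lemma pd_cst (R : realType) N i (c : R) : pd i (fun _ : 'rV[R]_N => c) = fun=> 0.
Proof. by apply/funext => z; exact: derive_cst. Qed.

Lemma pderivsZ (R : realType) N (A : set 'rV[R]_N) s c f z : open A ->
  rsmooth_on A f -> A z ->
  pderivs s (fun z => c * f z) z = c * pderivs s f z.
Proof.
move=> oA sf; elim: s z => [//|i s IH] z Az.
rewrite !pderivs_cons (eq_pd _ oA IH Az).
rewrite (pdM i (smooth_cst (A := A) c) (smooth_pderivs s sf) Az).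
by rewrite pd_cst mulr0 addr0.
Qed.

Lemma pderivsB (R : realType) N (A : set 'rV[R]_N) s f g z : open A ->
  rsmooth_on A f -> rsmooth_on A g -> A z ->
  pderivs s (fun z => f z - g z) z = pderivs s f z - pderivs s g z.
Proof.
move=> oA sf sg Az; rewrite -mulN1r -(pderivsZ s (-1) oA sg Az).
rewrite -(pderivsD s oA sf (smoothZ _ oA sg) Az).
by apply: eq_pderivs Az => // x _; rewrite mulN1r.
Qed.

Lemma pderivs_cst (R : realType) N i s (c : R) (z : 'rV[R]_N) :
  pderivs (i :: s) (fun=> c) z = 0.
Proof.
suff -> : pderivs (i :: s) (fun _ : 'rV[R]_N => c) = fun=> 0 by [].
elim: s i => [|j s IH] i; first exact: pd_cst.
by rewrite pderivs_cons IH pd_cst.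
Qed.

Lemma pderivs0 (R : realType) N s (z : 'rV[R]_N) : pderivs s (fun=> 0) z = 0.
Proof. by case: s => [//|i s]; exact: pderivs_cst. Qed.

Lemma pderivs_sum (R : realType) N (A : set 'rV[R]_N) s I (r : seq I)
    (f : I -> 'rV[R]_N -> R) z : open A -> (forall i, rsmooth_on A (f i)) ->
  A z -> pderivs s (fun z => \sum_(i <- r) f i z) z =
         \sum_(i <- r) pderivs s (f i) z.
Proof.
move=> oA sf Az; elim: r => [|i r IH].
  rewrite big_nil -[RHS](pderivs0 s z).
  by apply: eq_pderivs Az => // x _; rewrite big_nil.
rewrite big_cons -IH -(pderivsD s oA (sf i) (smooth_sum r oA sf) Az).
by apply: eq_pderivs Az => // x _; rewrite big_cons.
Qed.

(** * Restriction to lines and affine changes of coordinates *)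

Lemma is_derive_along (R : realType) (V : normedModType R) (f : V -> R) z v t l :
  is_derive (t *: v + z) v f l -> is_derive t 1 (fun k : R => f (k *: v + z)) l.
Proof.
move=> /is_derive_line df.
rewrite (_ : (fun k => _) = (fun k => f (k *: v + (t *: v + z))) \o (fun k => k - t)).
  rewrite -[l]mulr1; apply: is_derive1_comp; first by rewrite subrr.
  by apply: is_derive_eq; rewrite subr0.
by apply/funext => k /=; rewrite addrA -scalerDl subrK.
Qed.

(* [L] maps the direction [i] to [c i] times a coordinate direction, or is
   constant along it when [sigma i = None]. *)
Definition coord_affine (R : realType) N M (L : 'rV[R]_N -> 'rV[R]_M)
    (sigma : 'I_N -> option 'I_M) (c : 'I_N -> R) :=
  continuous L /\
  forall z h i, L (h *: delta_mx 0 i + z) =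
    (h * c i) *: (if sigma i is Some j then delta_mx 0 j else 0) + L z.

Lemma is_derive_affine (R : realType) (V W : normedModType R) (L : V -> W)
    (f : W -> R) z v w c l :
  (forall h : R, L (h *: v + z) = (h * c) *: w + L z) ->
  is_derive (L z) w f l -> is_derive z v (f \o L) (c * l).
Proof.
move=> Lz /is_derive_line df; apply: (is_derive_line _ _ _ _).2.
rewrite (_ : (fun k => _) = (fun k => f (k *: w + L z)) \o (fun k => k * c)).
  rewrite mulrC; apply: is_derive1_comp; first by rewrite mul0r.
  by apply: is_derive_eq; rewrite scaler0 add0r /GRing.scale/= mulr1.
by apply/funext => k /=; rewrite Lz.
Qed.

Lemma Ck_affine (R : realType) N M (A : set 'rV[R]_N) (B : set 'rV[R]_M) k
    L sigma c f : open A -> coord_affine L sigma c ->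
  (forall z, A z -> B (L z)) -> Ck B k f -> Ck A k (f \o L).
Proof.
move=> oA [cL La] AB; elim: k f => [|k IH] f Cf.
  split=> // z Az; apply: continuous_comp; first exact: cL.
  exact: Ck_cont Cf _ (AB _ Az).
apply: (Ck_succ (g := fun i z => c i *
   (if sigma i is Some j then pd j f (L z) else 0))) => //.
- move=> z Az; apply: continuous_comp; first exact: cL.
  exact: Ck_cont Cf _ (AB _ Az).
- move=> i z Az; apply: is_derive_affine (fun h => La z h i) _.
  case: (sigma i) => [j|]; last exact: is_derive0.
  exact: Ck_is_derive Cf (AB _ Az).
- move=> i; apply: CkM => //; first exact: Ck_cst.
  by case: (sigma i) => [j|]; [exact/IH/Ck_pd|exact: Ck_cst].
Qed.

Lemma smooth_affine (R : realType) N M (A : set 'rV[R]_N) (B : set 'rV[R]_M)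
    L sigma c f : open A -> coord_affine L sigma c ->
  (forall z, A z -> B (L z)) -> rsmooth_on B f -> rsmooth_on A (f \o L).
Proof.
move=> oA La AB /smoothP Cf; apply/smoothP => k.
exact: Ck_affine oA La AB (Cf k).
Qed.

(** Each index contributes its factor [c i], and a single index with [sigma i = None] kills the
    derivative, the composite being constant in that direction. This case serves projections such as
    [xpr], which forgets [t]. *)
Lemma pderivs_oaffine (R : realType) N M (A : set 'rV[R]_N) (B : set 'rV[R]_M)
    L sigma c f s z : open A -> coord_affine L sigma c ->
  (forall z, A z -> B (L z)) -> rsmooth_on B f -> A z ->
  pderivs s (f \o L) z = (\prod_(i <- s) c i) *
    (if all (isSome \o sigma) s then pderivs (pmap sigma s) f (L z) else 0).
Proof.
move=> oA La AB sf; elim: s z => [|i s IH] z Az; first by rewrite big_nil mul1r.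
rewrite pderivs_cons (eq_pd _ oA IH Az) big_cons [all _ (i :: s)]/=.
case: (all _ s); last first.
  by rewrite andbF !mulr0 pd_cst.
have sg := smooth_pderivs (pmap sigma s) sf.
set g := pderivs _ f in sg *.
have dg : is_derive z (delta_mx 0 i) (g \o L)
    (c i * (if sigma i is Some j then pd j g (L z) else 0)).
  apply: is_derive_affine (fun h => La.2 z h i) _.
  case: (sigma i) => [j|]; last exact: is_derive0.
  exact: smooth_is_derive sg (AB _ Az).
have sgL : rsmooth_on A (g \o L) by exact: smooth_affine oA La AB sg.
have gLE : pd i (g \o L) z = c i * (if sigma i is Some j then pd j g (L z) else 0).
  by case: dg.
rewrite [LHS](pdM i (smooth_cst (A := A) _) sgL Az) pd_cst mulr0 addr0 gLE /=.
by case: (sigma i) => [j|] /=; rewrite ?mulr0// mulrA [in RHS](mulrC (c i)).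
Qed.

Lemma pderivs_affine (R : realType) N M (A : set 'rV[R]_N) (B : set 'rV[R]_M)
    L sigma c f s z : open A -> coord_affine L (Some \o sigma) c ->
  (forall z, A z -> B (L z)) -> rsmooth_on B f -> A z ->
  pderivs s (f \o L) z = (\prod_(i <- s) c i) * pderivs (map sigma s) f (L z).
Proof.
move=> oA La AB sf Az; rewrite (pderivs_oaffine s oA La AB sf Az).
have -> : all (isSome \o (Some \o sigma)) s by apply/allP.
congr (_ * pderivs _ _ _); elim: s => //= i s ->; by [].
Qed.

(** * Mean value theorem and symmetry of mixed derivatives *)

Lemma MVT_along (R : realType) N (A : set 'rV[R]_N) f i z (h : R) : 0 <= h ->
  rsmooth_on A f -> (forall t, 0 <= t <= h -> A (t *: delta_mx 0 i + z)) ->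
  exists2 c, 0 <= c <= h &
    f (h *: delta_mx 0 i + z) - f z = h * pd i f (c *: delta_mx 0 i + z).
Proof.
move=> h0 sf Ah.
have df t : 0 <= t <= h -> is_derive t 1 (fun k : R => f (k *: delta_mx 0 i + z))
    (pd i f (t *: delta_mx 0 i + z)).
  move=> th; apply: is_derive_along; exact: smooth_is_derive sf (Ah _ th).
have [||c ch] := @MVT_segment _ (fun k : R => f (k *: delta_mx 0 i + z))
    (fun t => pd i f (t *: delta_mx 0 i + z)) 0 h h0.
- move=> x; rewrite in_itv/= => /andP[x0 xh]; apply: df.
  by rewrite !ltW.
- apply: derivable_within_continuous => x; rewrite in_itv/= => xh.
  by case: (df _ xh).
- rewrite scale0r add0r subr0 => fE; exists c; first by rewrite in_itv/= in ch.
  by rewrite fE mulrC.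
Qed.

(** Two applications of the mean value theorem: along [i] to the increment of [f] in the direction
    [j], then along [j] to [pd i f]. *)
Lemma second_difference (R : realType) N (A : set 'rV[R]_N) f i j z (h : R) :
  0 <= h -> rsmooth_on A f ->
  (forall s t, 0 <= s <= h -> 0 <= t <= h ->
    A (t *: delta_mx 0 j + (s *: delta_mx 0 i + z))) ->
  exists c c', [/\ 0 <= c <= h, 0 <= c' <= h &
    f (h *: delta_mx 0 j + (h *: delta_mx 0 i + z)) - f (h *: delta_mx 0 i + z)
    - (f (h *: delta_mx 0 j + z) - f z) =
    h * (h * pd j (pd i f) (c' *: delta_mx 0 j + (c *: delta_mx 0 i + z)))].
Proof.
move=> h0 sf Ah; set ei := delta_mx 0 i; set ej := delta_mx 0 j.
have hh : 0 <= h <= h by rewrite h0 lexx.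
have h00 : 0 <= (0 : R) <= h by rewrite lexx.
have A1 s : 0 <= s <= h -> A (s *: ei + (h *: ej + z)).
  by move=> sh; rewrite addrCA; apply: Ah.
have A2 s : 0 <= s <= h -> A (s *: ei + z).
  by move=> sh; have := Ah _ 0 sh h00; rewrite scale0r add0r.
pose phi (t : R) := f (t *: ei + (h *: ej + z)) - f (t *: ei + z).
pose phi' (t : R) := pd i f (t *: ei + (h *: ej + z)) - pd i f (t *: ei + z).
have dphi t : 0 <= t <= h -> is_derive t 1 phi (phi' t).
  move=> th; apply: (@is_deriveB _ _ _ (fun k : R => f (k *: ei + (h *: ej + z)))
     (fun k : R => f (k *: ei + z))); apply: is_derive_along.
    exact: smooth_is_derive sf (A1 _ th).
  exact: smooth_is_derive sf (A2 _ th).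
have [||c ch] := @MVT_segment _ phi phi' 0 h h0.
- move=> x; rewrite in_itv/= => /andP[x0 xh]; apply: dphi.
  by rewrite !ltW.
- apply: derivable_within_continuous => x; rewrite in_itv/= => xh.
  by case: (dphi _ xh).
rewrite in_itv/= in ch; rewrite subr0 {1 2}/phi scale0r !add0r => E.
have [c' c'h E'] := @MVT_along _ _ A (pd i f) j (c *: ei + z) h h0
   (smooth_pd i sf) (fun t => Ah c t ch).
exists c, c'; split=> //; rewrite -E' [LHS](_ : _ = phi' c * h); last first.
  by rewrite -E /phi addrCA.
by rewrite /phi' addrCA mulrC.
Qed.

Lemma sub_swap (R : realType) (a1 a2 a3 a4 x y : R) :
  a1 - a2 - (a3 - a4) = x -> a1 - a3 - (a2 - a4) = y -> x = y.
Proof. by move=> <- <-; ring. Qed.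

Lemma normB_close (R : realType) (x y w w' e : R) :
  w = w' -> `|y - w| < e / 2 -> `|x - w'| < e / 2 -> `|x - y| <= e.
Proof.
move=> -> yw xw; have := ler_normB (x - w') (y - w').
by rewrite (_ : x - w' - (y - w') = x - y); [lra|ring].
Qed.

(* Both mixed derivatives are values, at points near [z], of the same second
   difference quotient. *)
Lemma pd_comm (R : realType) N (A : set 'rV[R]_N) f i j z : open A ->
  rsmooth_on A f -> A z -> pd i (pd j f) z = pd j (pd i f) z.
Proof.
move=> oA sf Az; apply/eqP; rewrite -subr_eq0 -normr_le0; apply/ler_addgt0Pr => e e0.
rewrite add0r.
have c1 : {for z, continuous (pd i (pd j f))}.
  by apply: smooth_cont (smooth_pd i (smooth_pd j sf)) Az.
have c2 : {for z, continuous (pd j (pd i f))}.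
  by apply: smooth_cont (smooth_pd j (smooth_pd i sf)) Az.
have e20 : 0 < e / 2 by rewrite divr_gt0.
have n1 : \forall x \near z, `|pd i (pd j f) z - pd i (pd j f) x| < e / 2.
  by move/cvgrPdist_lt : c1; apply.
have n2 : \forall x \near z, `|pd j (pd i f) z - pd j (pd i f) x| < e / 2.
  by move/cvgrPdist_lt : c2; apply.
have n3 : \forall x \near z, A x by exact: near_set oA Az _.
have nA : nbhs z (fun x => A x /\ (`|pd i (pd j f) z - pd i (pd j f) x| < e / 2 /\
    `|pd j (pd i f) z - pd j (pd i f) x| < e / 2)).
  by apply: filter_app n1; apply: filter_app n2; apply: filterS n3 => x.
have [r /= r0 rP] := (nbhs_normP z _).1 nA.
pose B : R := `|delta_mx 0 i : 'rV[R]_N| + `|delta_mx 0 j : 'rV[R]_N| + 1.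
have B0 : 0 < B by rewrite /B ltr_wpDl// addr_ge0.
(* Displacements with both coefficients in [[0, h]] have norm at most [h * B = r / 2], so the whole
   square stays in the ball of radius [r]. *)
pose h := r / 2 / B.
have h0 : 0 < h by rewrite !divr_gt0.
have hr s t : 0 <= s <= h -> 0 <= t <= h ->
    ball_ Num.norm z r (t *: delta_mx 0 j + (s *: delta_mx 0 i + z)).
  move=> /andP[s0 sh] /andP[t0 th]; rewrite /ball_/=.
  rewrite addrA opprD addrCA subrr addr0 normrN.
  apply: (@le_lt_trans _ _ (h * B)).
    rewrite (le_trans (ler_normD _ _))// !normrZ !ger0_norm// /B !mulrDr mulr1.
    by rewrite ler_wpDr ?(ltW h0)// addrC lerD// ler_wpM2r.
  by rewrite /h divfK ?gt_eqF// ltr_pdivrMr// ltr_pMr// ltr1n.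
have hr' s t : 0 <= s <= h -> 0 <= t <= h ->
    ball_ Num.norm z r (t *: delta_mx 0 i + (s *: delta_mx 0 j + z)).
  by move=> sh th; rewrite addrCA; exact: hr.
have [c [c' [ch ch' E]]] := @second_difference _ _ A f i j z h (ltW h0) sf
   (fun s t sh th => (rP _ (hr s t sh th)).1).
have [b [b' [bh bh' F]]] := @second_difference _ _ A f j i z h (ltW h0) sf
   (fun s t sh th => (rP _ (hr' s t sh th)).1).
have [_ [_ P1]] := rP _ (hr _ _ ch ch').
have [_ [P2 _]] := rP _ (hr' _ _ bh bh').
rewrite (addrCA (h *: 'e_i) (h *: 'e_j) z) in F.
(* Exchanging [i] and [j] only regroups the four values of [f]; cancelling [h] twice equates the two
   mixed derivatives at nearby points. *)
have EF := mulfI (lt0r_neq0 h0) (mulfI (lt0r_neq0 h0) (sub_swap E F)).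
exact: normB_close EF P1 P2.
Qed.

(** Adjacent commutations bring the head of [s] to the front of [s']; the induction then treats the
    tails. *)
Lemma pderivs_perm (R : realType) N (A : set 'rV[R]_N) f s s' z : open A ->
  rsmooth_on A f -> A z -> perm_eq s s' -> pderivs s f z = pderivs s' f z.
Proof.
move=> oA sf Az; move: s s' z Az.
have move_front i s1 s2 z : A z ->
    pderivs (s1 ++ i :: s2) f z = pderivs (i :: s1 ++ s2) f z.
  elim: s1 z => [//|j s1 IH] z Az.
  rewrite cat_cons pderivs_cons (eq_pd _ oA IH Az).
  exact: (pd_comm _ _ oA (smooth_pderivs (s1 ++ s2) sf) Az).
elim=> [|i s IH] s' z Az; first by rewrite perm_sym => /perm_nilP ->.
move=> /[dup] /perm_mem /(_ i); rewrite mem_head => /esym /path.splitPr[s1 s2].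
rewrite perm_sym -cat1s perm_catCA cat1s perm_cons perm_sym => ps.
by rewrite (move_front i s1 s2 z Az) !pderivs_cons;
  apply: eq_pd oA _ Az => x Ax; exact: IH.
Qed.

(** * A smooth step function *)

(* Closed under differentiation, with [flat] as the case [p = 1]. *)
Definition exp_inv (R : realType) (p : {poly R}) (x : R) : R :=
  if 0 < x then p.[x^-1] * expR (- x^-1) else 0.

(** Termwise [y^i <= i! * exp y], read off the exponential series. *)
Lemma expR_dominates (R : realType) (p : {poly R}) :
  exists2 C : R, 0 <= C & forall y, 0 < y -> `|p.[y] * expR (- y)| <= C.
Proof.
exists (\sum_(i < size p) `|p`_i| * (i`!)%:R) => [|y y0].
  by apply: sumr_ge0 => i _; rewrite mulr_ge0.
rewrite horner_coef mulr_suml (le_trans (ler_norm_sum _ _ _))// ler_sum// => i _.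
rewrite -mulrA normrM ler_wpM2l// ger0_norm; last first.
  by rewrite mulr_ge0 ?expR_ge0// exprn_ge0 ?ltW.
rewrite expRN ler_pdivrMr ?expR_gt0//.
case: (i : nat) => [|k]; first by rewrite expr0 fact0 mul1r ltW// expR_gt1.
rewrite mulrC -ler_pdivrMr ?ltr0n ?fact_gt0//.
by apply: le_trans (expR_ge1Dxn k (ltW y0)); rewrite lerDr.
Qed.

Lemma is_derive_quadratic (R : realType) (f : R -> R) (C : R) :
  (forall h, `|f h| <= C * h ^+ 2) -> is_derive (0 : R) 1 f 0.
Proof.
move=> fC; have f0 : f 0 = 0.
  by apply/eqP; rewrite -normr_le0; have := fC 0; rewrite expr0n/= mulr0.
suff h : (fun h : R => h^-1 *: ((f \o shift 0) (h *: 1) - f 0)) @ 0^' --> (0 : R).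
  by apply: DeriveDef; [apply/cvg_ex; exists 0|exact/cvg_lim].
apply/cvgr0Pnorm_le => e e0.
have C0 : 0 <= C.
  by have := fC 1; rewrite expr1n mulr1; exact: le_trans.
near=> h; rewrite /= f0 subr0 addr0 /GRing.scale/= mulr1.
have h0 : h != 0 by near: h; exact: nbhs_dnbhs_neq.
rewrite normrM normfV ler_pdivrMl ?normr_gt0// (le_trans (fC h))//.
rewrite -real_normK ?num_real// expr2 mulrA mulrC ler_wpM2l//.
have hC : `|h| <= e / (C + 1).
  near: h; apply: dnbhs0_le.
  by rewrite divr_gt0// ltr_wpDl.
rewrite (le_trans (ler_wpM2l C0 hC))// mulrCA ler_piMr ?(ltW e0)//.
by rewrite ler_pdivrMr ?ltr_wpDl// mul1r lerDl.
Unshelve. all: by end_near. Qed.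

(** For [x > 0] the derivative of [p(1/x) exp(-1/x)] is [x^-2 (p - p')(1/x) exp(-1/x)]. Only [x = 0]
    needs an argument: there the function is [O(h^2)]. *)
Lemma is_derive_exp_inv (R : realType) (p : {poly R}) (x : R) :
  is_derive x 1 (exp_inv p) (exp_inv ('X^2 * (p - p^`())%R) x).
Proof.
have [x0|x0|<-] := ltgtP 0 x; last first.
- rewrite {2}/exp_inv ltxx.
  (* The extra factor ['X^2], evaluated at [1/h], is what yields the bound [C * h^2]. *)
  have [C C0 HC] := expR_dominates (p * 'X^2).
  apply: (@is_derive_quadratic _ _ C) => h; rewrite /exp_inv.
  case: ifPn => [h0|_]; last by rewrite normr0 mulr_ge0// sqr_ge0.
  have := HC h^-1; rewrite invr_gt0 => /(_ h0).
  rewrite hornerM hornerXn mulrAC normrM (ger0_norm (exprn_ge0 _ _)).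
    by rewrite exprVn ler_pdivrMr ?exprn_gt0.
  by rewrite invr_ge0 ltW.
- have -> : exp_inv ('X^2 * (p - p^`())%R) x = 0 by rewrite /exp_inv ltNge ltW.
  apply: (@near_eq_is_derive _ _ _ (fun=> 0)).
  near=> y; rewrite /exp_inv ltNge ltW//.
  by near: y; exact: lt_nbhsl.
- have -> : exp_inv ('X^2 * (p - p^`())%R) x = ('X^2 * (p - p^`())%R).[x^-1] * expR (- x^-1)
    by rewrite /exp_inv x0.
  have xn0 : x != 0 by rewrite gt_eqF.
  have dV : is_derive x 1 (fun y : R => y^-1) (- x ^- 2).
    rewrite -[X in is_derive _ _ _ X]mulr1; exact: (@is_deriveV _ id x 1 1).
  have dp : is_derive (x^-1) 1 (horner p) (p^`()).[x^-1].
    apply: DeriveDef; first exact: derivable_horner.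
    by rewrite -derive1E -derivE.
  have d1 := @is_derive1_comp _ (horner p) (fun y : R => y^-1) x _ _ dp dV.
  have d2 := @is_derive1_comp _ expR (fun y : R => - y^-1) x _ _
     (is_derive_expR _) (is_deriveN dV).
  have d3 := is_deriveM d1 d2.
  have {}d3 : is_derive x 1 (fun y => p.[y^-1] * expR (- y^-1))
      (('X^2 * (p - p^`())%R).[x^-1] * expR (- x^-1)).
    apply: is_derive_eq d3 _.
    rewrite /GRing.scale/= hornerM hornerXn hornerD hornerN -exprVn.
    by set a := _.[_]; set b := _.[_]; set c := expR _; ring.
  apply: near_eq_is_derive d3; near=> y; rewrite /exp_inv (_ : 0 < y)//.
  by near: y; exact: lt_nbhsr.
Unshelve. all: by end_near. Qed.

Definition flat (R : realType) (x : R) : R := exp_inv 1 x.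

Definition step (R : realType) (x : R) : R := flat x / (flat x + flat (1 - x)).

Lemma flat_ge0 (R : realType) (x : R) : 0 <= flat x.
Proof.
by rewrite /flat /exp_inv; case: ifP => // _; rewrite hornerC mul1r expR_ge0.
Qed.

Lemma flat_gt0 (R : realType) (x : R) : 0 < x -> 0 < flat x.
Proof. by move=> x0; rewrite /flat /exp_inv x0 hornerC mul1r expR_gt0. Qed.

Lemma flat_le0 (R : realType) (x : R) : x <= 0 -> flat x = 0.
Proof. by rewrite /flat /exp_inv leNgt => /negbTE ->. Qed.

(** [x] and [1 - x] are never both nonpositive, so one of the two nonnegative terms is positive. *)
Lemma flat_sum_neq0 (R : realType) (x : R) : flat x + flat (1 - x) != 0.
Proof.
have [x0|x0] := ltP 0 x.
  by rewrite gt_eqF// ltr_wpDr ?flat_ge0 ?flat_gt0.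
by rewrite gt_eqF// ltr_wpDl ?flat_ge0 ?flat_gt0// subr_gt0 (le_lt_trans x0).
Qed.

Lemma step_le0 (R : realType) (x : R) : x <= 0 -> step x = 0.
Proof. by move=> x0; rewrite /step flat_le0// mul0r. Qed.

Lemma step_ge1 (R : realType) (x : R) : 1 <= x -> step x = 1.
Proof.
move=> x1; rewrite /step [flat (1 - x)]flat_le0 ?subr_le0// addr0 divff//.
by rewrite gt_eqF// flat_gt0// (lt_le_trans _ x1).
Qed.

Lemma smooth_flat (R : realType) N (A : set 'rV[R]_N) f : open A ->
  rsmooth_on A f -> rsmooth_on A (fun z => flat (f z)).
Proof.
move=> oA; pose phi j := exp_inv (iter j (fun p : {poly R} => 'X^2 * (p - p^`())) 1).
by apply: (smooth_comp1 (D := setT) (phi := phi)) => // j y _; exact: is_derive_exp_inv.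
Qed.

Lemma smooth_step (R : realType) N (A : set 'rV[R]_N) f : open A ->
  rsmooth_on A f -> rsmooth_on A (fun z => step (f z)).
Proof.
move=> oA sf.
have s1 : rsmooth_on A (fun z => 1 - f z) := smoothB oA (smooth_cst (A := A) 1) sf.
have s2 := smooth_flat oA s1; have s3 := smooth_flat oA sf.
apply: (smoothM oA s3); apply: (smoothV oA _ (smoothD oA s3 s2)) => z _.
exact: flat_sum_neq0.
Qed.

(** * Homogeneous gauges and quasi-norms *)

Lemma rV_coord_le (R : realType) N (v : 'rV[R]_N) i : `|v 0 i| <= `|v|.
Proof.
by rewrite [leRHS]/Num.norm /= mx_normrE; apply/bigmax_geP; right => /=; exists (0, i).
Qed.

Lemma rV_norm_le (R : realType) N (v : 'rV[R]_N) (B : R) : 0 <= B ->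
  (forall i, `|v 0 i| <= B) -> `|v| <= B.
Proof.
move=> B0 vB; rewrite [leLHS]/Num.norm /= mx_normrE; apply/bigmax_leP; split => //=.
by move=> [a i] _ /=; rewrite (ord1 a).
Qed.

Lemma continuous_rV (R : realType) (T : topologicalType) N
    (L : T -> 'rV[R]_N) : (forall i, continuous (fun z => L z 0 i)) -> continuous L.
Proof.
move=> cL z; apply/cvgrPdist_le => e e0.
have : forall i : 'I_N, \forall x \near z, `|L z 0 i - L x 0 i| <= e.
  by move=> i; have /cvgrPdist_le := cL i z; apply.
move=> /filter_forall; apply: filterS => x h.
by apply: rV_norm_le => [|i]; [exact: ltW|rewrite !mxE; exact: h].
Qed.

Lemma continuous_coord (R : realType) N (i : 'I_N) :
  continuous (fun z : 'rV[R]_N => z 0 i).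
Proof. by move=> z; exact: coord_continuous. Qed.

Lemma smooth_coord (R : realType) N (A : set 'rV[R]_N) i :
  open A -> rsmooth_on A (fun z : 'rV[R]_N => z 0 i).
Proof.
move=> oA; apply/smoothP => -[|k]; first by split=> // z _; exact: continuous_coord.
apply: (Ck_succ (g := fun j _ => (i == j)%:R)) => //.
- by move=> z _; exact: continuous_coord.
- move=> j z _; apply: (is_derive_line _ _ _ _).2.
  have -> : (fun k0 : R => (k0 *: delta_mx 0 j + z) 0 i) =
            (fun k0 : R => k0 * (i == j)%:R + z 0 i).
    by apply/funext => h; rewrite !mxE eqxx.
  by apply: is_derive_eq; rewrite addr0 scaler0 add0r /GRing.scale/= mulr1.
- by move=> j; exact: Ck_cst.
Qed.

Lemma compact_le_bound (R : realType) (T : topologicalType) (K : set T) (f : T -> R) :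
  compact K -> (forall z, K z -> {for z, continuous f}) ->
  exists2 C, 0 < C & forall z, K z -> `|f z| <= C.
Proof.
move=> cK cf.
have wf : {within K, continuous f}.
  by apply: continuous_in_subspaceT => z /set_mem; exact: cf.
have /compact_bounded[M [_ MP]] := continuous_compact wf cK.
exists (`|M| + 1) => [|z Kz]; first by rewrite ltr_wpDl.
by apply: (MP (`|M| + 1)); [rewrite (le_lt_trans (ler_norm _))// ltrDl|exists z].
Qed.

Lemma open_prod_set (R : realType) n d (U : set 'rV[R]_n) (V : set 'rV[R]_d) :
  open U -> open V -> open (prod_set U V).
Proof.
move=> oU oV; apply: openI.
  by apply: open_comp oU => z _; exact: continuous_lsubmx.
by apply: open_comp oV => z _; exact: continuous_rsubmx.
Qed.

Lemma compact_prod_set (R : realType) n d (U : set 'rV[R]_n) (V : set 'rV[R]_d) :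
  compact U -> compact V -> compact (prod_set U V).
Proof.
move=> cU cV; apply: bounded_closed_compact; last first.
  apply: closedI.
    apply: closed_comp (compact_closed _ cU); last exact: norm_hausdorff.
    by move=> z _; exact: continuous_lsubmx.
  apply: closed_comp (compact_closed _ cV); last exact: norm_hausdorff.
  by move=> z _; exact: continuous_rsubmx.
have [M [_ MP]] := compact_bounded cU; have [B [_ BP]] := compact_bounded cV.
pose C := Num.max `|M| `|B| + 1.
have C0 : 0 < C by rewrite ltr_wpDl// le_max normr_ge0.
have UC u : U u -> `|u| <= C.
  by apply: MP; rewrite /C (le_lt_trans (ler_norm _))// ltr_pwDr// le_max lexx.
have VC v : V v -> `|v| <= C.
  by apply: BP; rewrite /C (le_lt_trans (ler_norm _))// ltr_pwDr// le_max lexx orbT.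
exists C; split; first by rewrite num_real.
move=> D CD z [zU zV]; apply: (le_trans _ (ltW CD)).
apply: rV_norm_le => [|i]; first exact: ltW.
rewrite -(hsubmxK z) mxE; case: fintype.split => j.
  exact: le_trans (rV_coord_le _ _) (UC _ zU).
exact: le_trans (rV_coord_le _ _) (VC _ zV).
Qed.

Lemma open_neq0 (R : realType) d : open [set xi : 'rV[R]_d | xi != 0].
Proof.
rewrite (_ : mkset _ = ~` [set 0]); last first.
  by apply/seteqP; split=> x /= /eqP.
by apply: closed_openC; exact/accessible_closed_set1/hausdorff_accessible/norm_hausdorff.
Qed.

Lemma prod_setP (R : realType) n d (U : set 'rV[R]_n) (V : set 'rV[R]_d) x xi :
  prod_set U V (row_mx x xi) <-> U x /\ V xi.
Proof. by rewrite /prod_set /= row_mxKl row_mxKr. Qed.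

Lemma prod_set_row (R : realType) n d (U : set 'rV[R]_n) (V : set 'rV[R]_d) x xi :
  U x -> V xi -> prod_set U V (row_mx x xi).
Proof. by move=> Ux Vxi; exact/prod_setP. Qed.

(* [M] is a common multiple of the weights, so that [gauge M rho] is a
   polynomial; it is homogeneous of degree [2 * M]. *)
Definition common_multiple D (M : nat) (rho : 'I_D -> nat) :=
  (0 < M)%N /\ forall i, (0 < rho i)%N /\ (rho i %| M)%N.

Definition gauge (R : realType) D (M : nat) (rho : 'I_D -> nat) (xi : 'rV[R]_D) : R :=
  \sum_(i < D) xi 0 i ^+ (2 * (M %/ rho i)).

(** Homogeneous of degree one, hence the measure of size in all estimates; arguments about
    continuity, open sets and smoothness go through [gauge]. *)
Definition hnorm (R : realType) D (M : nat) (rho : 'I_D -> nat) (xi : 'rV[R]_D) : R :=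
  gauge M rho xi `^ ((2 * M)%:R)^-1.

Lemma even_pow_ge0 (R : realType) (x : R) k : 0 <= x ^+ (2 * k).
Proof. by rewrite exprM exprn_ge0// sqr_ge0. Qed.

Lemma gauge_ge0 (R : realType) D M (rho : 'I_D -> nat) (xi : 'rV[R]_D) :
  0 <= gauge M rho xi.
Proof. by apply: sumr_ge0 => i _; exact: even_pow_ge0. Qed.

Lemma gauge_coord (R : realType) D M (rho : 'I_D -> nat) (xi : 'rV[R]_D) i :
  xi 0 i ^+ (2 * (M %/ rho i)) <= gauge M rho xi.
Proof.
rewrite /gauge (bigD1 i)//= lerDl; apply: sumr_ge0 => j _; exact: even_pow_ge0.
Qed.

Lemma gauge_dil (R : realType) D M (rho : 'I_D -> nat) s (xi : 'rV[R]_D) :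
  common_multiple M rho ->
  gauge M rho (dil rho s xi) = s ^+ (2 * M) * gauge M rho xi.
Proof.
move=> [_ rM]; rewrite /gauge mulr_sumr; apply: eq_bigr => i _.
rewrite mxE exprMn -exprM; congr (s ^+ _ * _).
by rewrite mulnCA [(rho i * _)%N]mulnC divnK//; case: (rM i).
Qed.

Lemma gauge_eq0 (R : realType) D M (rho : 'I_D -> nat) (xi : 'rV[R]_D) :
  common_multiple M rho -> (gauge M rho xi == 0) = (xi == 0).
Proof.
move=> [M0 rM]; have k0 i : (0 < 2 * (M %/ rho i))%N.
  by have [r0 rdM] := rM i; rewrite muln_gt0/= divn_gt0// dvdn_leq.
apply/eqP/eqP => [g0|->]; last first.
  by rewrite /gauge big1// => i _; rewrite mxE expr0n eqn0Ngt k0.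
apply/rowP => i; rewrite mxE; apply/eqP.
have := gauge_coord M rho xi i; rewrite g0 => h.
have : xi 0 i ^+ (2 * (M %/ rho i)) == 0 by rewrite eq_le h even_pow_ge0.
by rewrite expf_eq0 k0.
Qed.

Lemma gauge_gt0 (R : realType) D M (rho : 'I_D -> nat) (xi : 'rV[R]_D) :
  common_multiple M rho -> (0 < gauge M rho xi) = (xi != 0).
Proof. by move=> h; rewrite lt_neqAle gauge_ge0 andbT eq_sym gauge_eq0. Qed.

Lemma smooth_gauge (R : realType) D M (rho : 'I_D -> nat) (A : set 'rV[R]_D) :
  open A -> rsmooth_on A (gauge M rho).
Proof.
move=> oA.
have := @smooth_sum R D A 'I_D (index_enum 'I_D)
   (fun i xi => xi 0 i ^+ (2 * (M %/ rho i))) oA.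
by apply => i; exact/smoothX/smooth_coord.
Qed.

Lemma continuous_gauge (R : realType) D M (rho : 'I_D -> nat) :
  continuous (@gauge R D M rho).
Proof. by move=> z; apply: (smooth_cont (smooth_gauge M rho openT)). Qed.

Lemma hnorm_ge0 (R : realType) D M (rho : 'I_D -> nat) (xi : 'rV[R]_D) :
  0 <= hnorm M rho xi.
Proof. exact: powR_ge0. Qed.

Lemma hnormX (R : realType) D M (rho : 'I_D -> nat) (xi : 'rV[R]_D) :
  common_multiple M rho -> hnorm M rho xi ^+ (2 * M) = gauge M rho xi.
Proof.
move=> [M0 _]; rewrite -powR_mulrn ?hnorm_ge0// /hnorm -powRrM mulVf ?powRr1//.
  exact: gauge_ge0.
by rewrite pnatr_eq0 -lt0n muln_gt0.
Qed.

Lemma hnorm_gt0 (R : realType) D M (rho : 'I_D -> nat) (xi : 'rV[R]_D) :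
  common_multiple M rho -> (0 < hnorm M rho xi) = (xi != 0).
Proof.
move=> cM; apply/idP/idP => [|xi0]; last by rewrite powR_gt0// gauge_gt0.
apply: contraTneq => xi0.
rewrite /hnorm (_ : gauge _ _ _ = 0); last by apply/eqP; rewrite gauge_eq0// xi0.
by rewrite powR0 ?ltxx// invr_eq0 pnatr_eq0 -lt0n muln_gt0; case: cM.
Qed.

Lemma hnorm_dil (R : realType) D M (rho : 'I_D -> nat) s (xi : 'rV[R]_D) :
  common_multiple M rho -> 0 <= s ->
  hnorm M rho (dil rho s xi) = s * hnorm M rho xi.
Proof.
move=> cM s0; have [M0 _] := cM.
rewrite /hnorm gauge_dil// powRM ?gauge_ge0 ?exprn_ge0//; congr (_ * _).
by rewrite -powR_mulrn// -powRrM mulfV ?powRr1// pnatr_eq0 -lt0n muln_gt0.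
Qed.

Lemma hnorm_coord (R : realType) D M (rho : 'I_D -> nat) (xi : 'rV[R]_D) i :
  common_multiple M rho -> `|xi 0 i| <= hnorm M rho xi ^+ rho i.
Proof.
move=> cM; have [M0 rM] := cM; have [r0 rdM] := rM i.
have k0 : (0 < 2 * (M %/ rho i))%N by rewrite muln_gt0/= divn_gt0// dvdn_leq.
rewrite -(ler_pXn2r k0) ?nnegrE ?exprn_ge0 ?hnorm_ge0//.
rewrite -exprM mulnCA [(rho i * _)%N]mulnC divnK// hnormX//.
by rewrite exprM real_normK ?num_real// -exprM gauge_coord.
Qed.

Lemma hnorm_le (R : realType) D M (rho : 'I_D -> nat) (xi : 'rV[R]_D) b :
  common_multiple M rho -> 0 <= b ->
  (hnorm M rho xi <= b) = (gauge M rho xi <= b ^+ (2 * M)).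
Proof.
move=> cM b0; have [M0 _] := cM.
by rewrite -hnormX// ler_pXn2r ?nnegrE ?hnorm_ge0// muln_gt0.
Qed.

Lemma hnorm_ge (R : realType) D M (rho : 'I_D -> nat) (xi : 'rV[R]_D) b :
  common_multiple M rho -> 0 <= b ->
  (b <= hnorm M rho xi) = (b ^+ (2 * M) <= gauge M rho xi).
Proof.
move=> cM b0; have [M0 _] := cM.
by rewrite -hnormX// ler_pXn2r ?nnegrE ?hnorm_ge0// muln_gt0.
Qed.

(** Closed because it is cut out by inequalities on the continuous [gauge], bounded because
    [|xi_i| <= hnorm xi ^ rho_i]. *)
Lemma compact_hnorm_shell (R : realType) D M (rho : 'I_D -> nat) (a b : R) :
  common_multiple M rho -> 0 <= a -> 0 <= b ->
  compact [set xi : 'rV[R]_D | a <= hnorm M rho xi <= b].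
Proof.
move=> cM a0 b0; apply: bounded_closed_compact; last first.
  rewrite (_ : mkset _ = [set xi | a ^+ (2 * M) <= gauge M rho xi] `&`
                         [set xi | gauge M rho xi <= b ^+ (2 * M)]).
    apply: closedI.
      apply: (@closed_comp _ _ (gauge M rho) [set x | a ^+ (2 * M) <= x]) => //.
      by move=> z _; exact: continuous_gauge.
    apply: (@closed_comp _ _ (gauge M rho) [set x | x <= b ^+ (2 * M)]) => //.
    by move=> z _; exact: continuous_gauge.
  apply/seteqP; split=> x /=; rewrite -hnorm_le// -hnorm_ge//; first by move=> /andP.
  by move=> [-> ->].
pose B : R := \sum_(i < D) b ^+ rho i.
exists B; split; first by rewrite num_real.
move=> C BC x /= /andP[_ xb]; apply: le_trans (ltW BC).
apply: rV_norm_le => [|i]; first by apply: sumr_ge0 => i _; rewrite exprn_ge0.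
rewrite (le_trans (hnorm_coord x i cM))// /B (bigD1 i)//= ler_wpDr//.
  by apply: sumr_ge0 => j _; rewrite exprn_ge0.
by rewrite lerXn2r ?nnegrE// hnorm_ge0.
Qed.

Lemma quasinorm_sum (R : realType) D (delta : R -> 'rV[R]_D -> 'rV[R]_D) q I (r : seq I) :
  homogeneous_quasinorm delta q ->
  exists2 C : R, 0 < C & forall v : I -> 'rV[R]_D,
    q (\sum_(i <- r) v i) <= C * \sum_(i <- r) q (v i).
Proof.
move=> [q0 _ _ qz [C C0 qD]]; elim: r => [|i r [B B0 IH]].
  exists 1 => // v; rewrite !big_nil mulr0.
  by have -> : q 0 = 0 by exact/qz.
exists (C * (1 + B)) => [|v]; first by rewrite mulr_gt0// addr_gt0.
rewrite !big_cons (le_trans (qD _ _))// -mulrA ler_wpM2l ?(ltW C0)//.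
have s0 : 0 <= \sum_(j <- r) q (v j) by apply: sumr_ge0.
have := IH v; set x := q _; set y := \sum_(j <- r) _ in s0 *.
have := q0 (v i); set z := q (v i) => z0 xy.
by move: B0 xy z0 s0; clear; nra.
Qed.

(** Each axis is a dilation orbit up to sign, so homogeneity determines [q] there; the
    quasi-triangle inequality sums the coordinates. *)
Lemma quasinorm_le_hnorm (R : realType) D M (rho : 'I_D -> nat) (q : 'rV[R]_D -> R) :
  common_multiple M rho -> homogeneous_quasinorm (dil rho) q ->
  exists2 C : R, 0 < C & forall xi, q xi <= C * hnorm M rho xi.
Proof.
move=> cM hq; have [B B0 qB] := quasinorm_sum (index_enum 'I_D) hq.
have [q0 qN qdil qz _] := hq; have [M0 rM] := cM.
have qi (xi : 'rV[R]_D) i : q (xi 0 i *: delta_mx 0 i) <= hnorm M rho xi * q (delta_mx 0 i).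
  have [->|x0] := eqVneq (xi 0 i) 0.
    rewrite scale0r; have -> : q 0 = 0 by exact/qz.
    by rewrite mulr_ge0 ?hnorm_ge0.
  have [r0 _] := rM i.
  (* The dilation parameter with [s ^ rho i = |xi_i|]; the sign of the coordinate is absorbed by the
     evenness of [q]. *)
  pose s := `|xi 0 i| `^ ((rho i)%:R)^-1.
  have s0 : 0 < s by rewrite powR_gt0// normr_gt0.
  have sE : s ^+ rho i = `|xi 0 i|.
    by rewrite -powR_mulrn ?(ltW s0)// -powRrM mulVf ?powRr1// pnatr_eq0 -lt0n.
  have -> : q (xi 0 i *: delta_mx 0 i) = q (dil rho s (delta_mx 0 i)).
    have E : dil rho s (delta_mx 0 i) = `|xi 0 i| *: delta_mx 0 i.
      apply/rowP => j; rewrite !mxE eqxx/=; case: eqVneq => [->|]; first by rewrite sE.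
      by rewrite !mulr0.
    rewrite E; case: (leP 0 (xi 0 i)) => xi0; first by rewrite ger0_norm.
    by rewrite ltr0_norm// scaleNr qN.
  rewrite qdil// ler_wpM2r//.
  rewrite -(@ler_pXn2r _ (rho i)) ?nnegrE ?hnorm_ge0 ?(ltW s0)// sE.
  exact: hnorm_coord.
exists (B * (1 + \sum_(i < D) q (delta_mx 0 i))) => [|xi].
  by rewrite mulr_gt0// ltr_wpDr// sumr_ge0.
rewrite {1}(row_sum_delta xi) (le_trans (qB _))// -mulrA ler_wpM2l ?(ltW B0)//.
rewrite mulrDl mul1r ler_wpDl ?hnorm_ge0// mulr_suml ler_sum// => i _.
by rewrite mulrC.
Qed.

(* [q] need not be continuous, but [q x <= C (q (x - y) + q y)] with
   [q (x - y) <= B hnorm (x - y)] bounds it from below near each point of the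
   compact sphere [hnorm = 1]. *)
Lemma hnorm_le_quasinorm (R : realType) D M (rho : 'I_D -> nat) (q : 'rV[R]_D -> R) :
  common_multiple M rho -> homogeneous_quasinorm (dil rho) q ->
  exists2 C : R, 0 < C & forall xi, hnorm M rho xi <= C * q xi.
Proof.
move=> cM hq; have [B B0 qB] := quasinorm_le_hnorm cM hq.
have [q0 qN qdil qz [C C0 qD]] := hq.
have cS := compact_hnorm_shell cM (@ler01 R) (@ler01 R).
have /compact_near_coveringP := cS.
(* A positive lower bound for [q] on the sphere, phrased as [1 <= k * q y] for all large [k]
   uniformly in [y], is what a covering argument delivers without continuity of [q]. *)
move=> /(_ nat \oo (fun (k : nat) y => 1 <= k%:R * q y) _) [].
  move=> /= x /andP[x1 _].
  have x0 : x != 0 by rewrite -(hnorm_gt0 x cM) (lt_le_trans _ x1).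
  have qx : 0 < q x.
    by rewrite lt_neqAle q0 andbT eq_sym; apply: contra_neq x0 => /qz.
  (* Chosen so that [C * (B * e) = q x / 2]: the error term takes at most half of [q x], and the
     other half bounds [q y] from below. *)
  pose e := q x / (2 * C * B).
  have e0 : 0 < e by rewrite divr_gt0// !mulr_gt0.
  have nx : \forall y \near x, gauge M rho (x - y) < e ^+ (2 * M).
    have cg : {for x, continuous (fun y : 'rV[R]_D => gauge M rho (x - y))}.
      apply: (@continuous_comp _ _ _ (fun y : 'rV[R]_D => x - y) (gauge M rho)).
        by apply: (@continuousB _ _ _ (cst x) id); [exact: cst_continuous|].
      exact: continuous_gauge.
    have := cvgr_lt _ cg; apply; rewrite (_ : gauge _ _ _ = 0) ?exprn_gt0//.
    by apply/eqP; rewrite gauge_eq0// subrr.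
  have nk : \forall k \near \oo, 2 * C / q x <= k%:R.
    exact: nbhs_infty_ger.
  exists ([set y : 'rV[R]_D | gauge M rho (x - y) < e ^+ (2 * M)],
          [set k : nat | 2 * C / q x <= k%:R]).
    by split.
  move=> [y k] /= [ye kq].
  have h1 : hnorm M rho (x - y) <= e by rewrite hnorm_le// ltW.
  have h2 : q x <= C * (q (x - y) + q y) by rewrite -[in leLHS](subrK y x).
  have h3 : C * q (x - y) <= q x / 2.
    have -> : q x / 2 = C * (B * e).
      by rewrite /e; field; rewrite !gt_eqF.
    by rewrite ler_wpM2l ?(ltW C0)// (le_trans (qB _))// ler_wpM2l ?(ltW B0).
  have h4 : q x <= 2 * C * q y.
    by move: h2 h3; clear; rewrite mulrDr; lra.
  rewrite (le_trans _ (ler_wpM2r (q0 y) kq))//.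
  by rewrite mulrAC ler_pdivlMr// mul1r.
move=> k _ /(_ k.+1 (leqnSn k)) kP.
exists k.+1%:R => [|xi]; first by rewrite ltr0n.
have [->|xi0] := eqVneq xi 0.
  have := hnorm_gt0 (0 : 'rV[R]_D) cM; rewrite eqxx => /negbT; rewrite -leNgt => h.
  by rewrite (le_trans h)// mulr_ge0.
have h0 : 0 < hnorm M rho xi by rewrite hnorm_gt0.
pose s := (hnorm M rho xi)^-1; have s0 : 0 < s by rewrite invr_gt0.
have h1 : hnorm M rho (dil rho s xi) = 1.
  by rewrite hnorm_dil ?(ltW s0)// mulVf// gt_eqF.
have /= := kP (dil rho s xi); rewrite h1 lexx => /(_ isT).
by rewrite qdil// mulrCA /s ler_pdivlMl// mulr1.
Qed.

(** Stated for exponents of either sign, since symbol orders become negative after differentiation;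
    hence the two-sided hypothesis and the constant [c ^ |e|]. *)
Lemma powR_comparable (R : realType) (c e : R) : 1 <= c ->
  exists2 C : R, 0 < C & forall a b : R, 0 < a -> 0 < b ->
    a <= c * b -> b <= c * a -> a `^ e <= C * b `^ e.
Proof.
move=> c1; have c0 : 0 < c by exact: lt_le_trans c1.
exists (c `^ `|e|) => [|a b a0 b0 ab ba]; first exact: powR_gt0.
have [e0|e0] := leP 0 e.
  rewrite ger0_norm// -powRM ?(ltW c0) ?(ltW b0)// ge0_ler_powR// nnegrE ?(ltW a0)//.
  by rewrite mulr_ge0 ?(ltW c0) ?(ltW b0).
rewrite ltr0_norm//; have <- : (c^-1 * b) `^ e = c `^ (- e) * b `^ e.
  rewrite powRM ?invr_ge0 ?(ltW c0) ?(ltW b0)//; congr (_ * _).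
  by rewrite -powR_inv1 ?(ltW c0)// -powRrM mulN1r.
have h : c^-1 * b <= a by rewrite ler_pdivrMl.
have h0 : 0 < c^-1 * b by rewrite mulr_gt0 ?invr_gt0.
rewrite -[e]opprK !(powRN _ (- e)) lef_pV2 ?posrE ?powR_gt0//.
by rewrite ge0_ler_powR ?nnegrE ?(ltW a0) ?(ltW h0)// oppr_ge0 ltW.
Qed.

(** Makes the symbol and Schwartz classes independent of the chosen quasi-norm. *)
Lemma quasinorm_weight (R : realType) D M (rho : 'I_D -> nat) (q : 'rV[R]_D -> R) (e : R) :
  common_multiple M rho -> homogeneous_quasinorm (dil rho) q ->
  exists2 C : R, 0 < C & forall xi,
    (1 + q xi) `^ e <= C * (1 + hnorm M rho xi) `^ e /\
    (1 + hnorm M rho xi) `^ e <= C * (1 + q xi) `^ e.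
Proof.
move=> cM hq; have [B B0 qB] := quasinorm_le_hnorm cM hq.
have [C C0 qC] := hnorm_le_quasinorm cM hq.
have [q0 _ _ _ _] := hq.
pose c := 1 + B + C.
have c1 : 1 <= c by rewrite /c -addrA lerDl addr_ge0 ?ltW.
have [K K0 KP] := powR_comparable e c1.
exists K => // xi.
have h0 := hnorm_ge0 M rho xi; have {}q0 := q0 xi.
have {}qB := qB xi; have {}qC := qC xi.
have a1 : 1 + q xi <= c * (1 + hnorm M rho xi).
  by move: B0 C0 h0 q0 qB qC; rewrite /c; clear; nra.
have a2 : 1 + hnorm M rho xi <= c * (1 + q xi).
  by move: B0 C0 h0 q0 qB qC; rewrite /c; clear; nra.
by split; apply: KP => //; rewrite ltr_pwDl.
Qed.

(** * Symbol estimates *)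

(* Variables of [x] get weight [0], so that [xdil] is the dilation of the whole
   space [R^n x R^d] with weights [xw rho]. *)
Definition xw n d (rho : 'I_d -> nat) (i : 'I_(n + d)) : nat :=
  if fintype.split i is inr j then rho j else 0%N.

Definition sw n d (rho : 'I_d -> nat) (l : seq 'I_(n + d)) : nat :=
  (\sum_(i <- l) xw rho i)%N.

Definition rhot d (rho : 'I_d -> nat) (i : 'I_(d + 1)) : nat :=
  if fintype.split i is inl j then rho j else 1%N.

Definition xdil (R : realType) n d (rho : 'I_d -> nat) (s : R) (z : 'rV[R]_(n + d)) :=
  row_mx (lsubmx z) (dil rho s (rsubmx z)).

Lemma xw_lshift n d (rho : 'I_d -> nat) i : xw rho (lshift d i : 'I_(n + d)) = 0%N.
Proof. by rewrite /xw (unsplitK (inl i)). Qed.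

Lemma xw_rshift n d (rho : 'I_d -> nat) i : xw rho (rshift n i) = rho i.
Proof. by rewrite /xw (unsplitK (inr i)). Qed.

Lemma dilt_dil (R : realType) d (rho : 'I_d -> nat) (s : R) :
  dilt rho s = dil (rhot rho) s.
Proof.
apply/funext => z; apply/rowP => i; rewrite !mxE /rhot -{3}(splitK i).
by case: (fintype.split i) => j; rewrite !mxE //= expr1.
Qed.

Lemma rhot_multiple d (rho : 'I_d -> nat) M :
  common_multiple M rho -> common_multiple M (rhot rho).
Proof.
move=> [M0 rM]; split=> // i; rewrite /rhot; by case: (fintype.split i).
Qed.

Lemma common_multiple_prod d (rho : 'I_d -> nat) :
  (forall i, 0 < rho i)%N -> common_multiple (\prod_i rho i) rho.
Proof.
move=> r0; split; first by apply: prodn_gt0.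
by move=> i; split=> //; rewrite (bigD1 i)//= dvdn_mulr.
Qed.

Lemma xdil_row (R : realType) n d (rho : 'I_d -> nat) (s : R) (x : 'rV[R]_n) xi :
  xdil rho s (row_mx x xi) = row_mx x (dil rho s xi).
Proof. by rewrite /xdil row_mxKl row_mxKr. Qed.

Lemma xdil_coord (R : realType) n d (rho : 'I_d -> nat) (s : R) (z : 'rV[R]_(n + d)) i :
  xdil rho s z 0 i = s ^+ xw rho i * z 0 i.
Proof.
rewrite /xdil !mxE /xw -{3}(splitK i).
by case: (fintype.split i) => j; rewrite !mxE //= expr0 mul1r.
Qed.

Lemma coord_affine_xdil (R : realType) n d (rho : 'I_d -> nat) (s : R) :
  coord_affine (@xdil R n d rho s) (Some \o id) (fun i => s ^+ xw rho i).
Proof.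
split.
  apply: continuous_rV => i.
  rewrite (_ : (fun z => _) = (fun z : 'rV[R]_(n + d) => s ^+ xw rho i * z 0 i)).
    move=> z.
    exact: (smooth_cont (smoothZ (s ^+ xw rho i) openT (smooth_coord i openT)) I).
  by apply/funext => z; rewrite xdil_coord.
move=> z h i; apply/rowP => j; rewrite xdil_coord [RHS]mxE xdil_coord.
rewrite !mxE mulrDr !eqxx/=; congr (_ + _).
by case: eqVneq => [->|]; rewrite ?mulr0 ?mulr1 ?mulr0// mulrC.
Qed.

Lemma prod_expr (R : realType) n d (rho : 'I_d -> nat) (s : R) (l : seq 'I_(n + d)) :
  \prod_(i <- l) s ^+ xw rho i = s ^+ sw rho l.
Proof. by rewrite /sw expr_sum. Qed.

Lemma sw_cat n d (rho : 'I_d -> nat) (l1 l2 : seq 'I_(n + d)) :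
  sw rho (l1 ++ l2) = (sw rho l1 + sw rho l2)%N.
Proof. by rewrite /sw big_cat. Qed.

Lemma dil_neq0 (R : realType) d (rho : 'I_d -> nat) (s : R) (xi : 'rV[R]_d) :
  0 < s -> xi != 0 -> dil rho s xi != 0.
Proof.
move=> s0; apply: contra_neq => E; apply/rowP => i; rewrite mxE.
move/rowP: E => /(_ i); rewrite !mxE => /eqP; rewrite mulf_eq0 => /orP[|/eqP//].
by rewrite expf_eq0 (gt_eqF s0) andbF.
Qed.

Lemma dilM (R : realType) d (rho : 'I_d -> nat) (s t : R) (xi : 'rV[R]_d) :
  dil rho s (dil rho t xi) = dil rho (s * t) xi.
Proof. by apply/rowP => i; rewrite !mxE exprMn mulrA. Qed.

Lemma dil1 (R : realType) d (rho : 'I_d -> nat) (xi : 'rV[R]_d) : dil rho 1 xi = xi.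
Proof. by apply/rowP => i; rewrite !mxE expr1n mul1r. Qed.

Lemma count_mi N (g : 'I_N -> nat) i : count_mem i (mi_seq g) = g i.
Proof.
rewrite /mi_seq count_flatten sumnE !big_map (bigD1_seq i)/=.
- rewrite count_nseq/= eqxx mul1n big1 ?addn0// => j ji.
  by rewrite count_nseq/= (negbTE ji).
- by rewrite -enumT mem_enum.
- by rewrite -enumT enum_uniq.
Qed.

(** Every list of variables is a rearrangement of one in the normal form of [mderiv]; with the
    symmetry of derivatives, multi-index bounds thus cover all lists. *)
Lemma perm_mi_seq n d (l : seq 'I_(n + d)) :
  perm_eq l (map (@lshift n d) (mi_seq (fun i => count_mem (lshift d i) l)) ++
             map (@rshift n d) (mi_seq (fun i => count_mem (rshift n i) l))).
Proof.
apply/allP => k _ /=; apply/eqP; rewrite count_cat !count_map.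
rewrite -(splitK k); case: (fintype.split k) => i /=.
- have -> s : count (preim (@rshift n d) (pred1 (lshift d i))) s = 0%N.
    by rewrite (eq_count (a2 := pred0)) ?count_pred0// => j /=; rewrite eq_rlshift.
  rewrite addn0 (eq_count (a2 := pred1 i)) ?count_mi//.
- have -> s : count (preim (@lshift n d) (pred1 (rshift n i))) s = 0%N.
    by rewrite (eq_count (a2 := pred0)) ?count_pred0// => j /=; rewrite eq_lrshift.
  rewrite add0n (eq_count (a2 := pred1 i)) ?count_mi// => j.
  exact: eq_rshift.
Qed.

Lemma sw_perm n d (rho : 'I_d -> nat) (l l' : seq 'I_(n + d)) :
  perm_eq l l' -> sw rho l = sw rho l'.
Proof. exact: perm_big. Qed.

Lemma sw_mi n d (rho : 'I_d -> nat) (al : 'I_n -> nat) (be : 'I_d -> nat) :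
  sw rho (map (@lshift n d) (mi_seq al) ++ map (@rshift n d) (mi_seq be)) = wt rho be.
Proof.
rewrite sw_cat /sw !big_map big1 ?add0n => [|i _]; last by rewrite xw_lshift.
under eq_bigr do rewrite xw_rshift.
rewrite /mi_seq big_flatten big_map big_enum /wt; apply: eq_bigr => i _.
by rewrite big_nseq iter_addn_0.
Qed.

Definition hom_dil (R : realType) n d (rho : 'I_d -> nat) (U : set 'rV[R]_n) (m : R)
    (f : 'rV[R]_(n + d) -> R) :=
  forall (s : R) x xi, 0 < s -> U x -> xi != 0 ->
    f (row_mx x (dil rho s xi)) = s `^ m * f (row_mx x xi).

Definition punctured (R : realType) n d (U : set 'rV[R]_n) : set 'rV[R]_(n + d) :=
  prod_set U [set xi | xi != 0].

Lemma open_punctured (R : realType) n d (U : set 'rV[R]_n) :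
  open U -> open (@punctured R n d U).
Proof. by move=> oU; apply: open_prod_set => //; exact: open_neq0. Qed.

Lemma pderivs_xdil (R : realType) n d (rho : 'I_d -> nat) (s : R)
    (A B : set 'rV[R]_(n + d)) f l z : open A -> (forall z, A z -> B (xdil rho s z)) ->
  rsmooth_on B f -> A z ->
  pderivs l (f \o xdil rho s) z = s ^+ sw rho l * pderivs l f (xdil rho s z).
Proof.
move=> oA AB sf Az.
by rewrite (pderivs_affine l oA (@coord_affine_xdil R n d rho s) AB sf Az) map_id prod_expr.
Qed.

Lemma punctured_xdil (R : realType) n d (rho : 'I_d -> nat) (U : set 'rV[R]_n) (s : R) z :
  0 < s -> @punctured R n d U z -> punctured U (xdil rho s z).
Proof.
move=> s0 [Uz z0]; split; rewrite /xdil ?row_mxKl//= row_mxKr.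
exact: dil_neq0.
Qed.

(** Differentiating the homogeneity relation, the chain rule produces [s ^ sw rho l] on the dilated
    side; dividing by it lowers the degree. *)
Lemma pderivs_hom_dil (R : realType) n d (rho : 'I_d -> nat) (U : set 'rV[R]_n) (m : R)
    (f : 'rV[R]_(n + d) -> R) l : open U -> rsmooth_on (punctured U) f ->
  hom_dil rho U m f -> hom_dil rho U (m - (sw rho l)%:R) (pderivs l f).
Proof.
move=> oU sf hf s x xi s0 Ux xi0.
have oA := @open_punctured R n d U oU.
have Az : @punctured R n d U (row_mx x xi) by exact: prod_set_row.
have := pderivs_xdil l oA (fun z => @punctured_xdil R n d rho U s z s0) sf Az.
rewrite xdil_row (eq_pderivs (g := fun z => s `^ m * f z) l oA _ Az); last first.
  move=> z [Uz z0] /=; rewrite -[in RHS](hsubmxK z) -hf//.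
rewrite (pderivsZ l _ oA sf Az) => E.
rewrite powRB; last by apply/implyP => _; rewrite gt_eqF.
rewrite powR_mulrn ?(ltW s0)// mulrAC E mulrAC mulfV ?mul1r//.
by rewrite gt_eqF// exprn_gt0.
Qed.

(* Symbol estimates for a real function; the Schwartz class on
   [R^(d+1)] is the intersection of the [symb e] over all real [e].  In
   [symb_out] they are required for large [xi] only. *)
Definition symb (R : realType) n d M (rho : 'I_d -> nat) (U : set 'rV[R]_n) (e : R)
    (f : 'rV[R]_(n + d) -> R) :=
  forall K, compact K -> K `<=` U -> forall l : seq 'I_(n + d),
  exists2 C : R, 0 < C & forall x xi, K x ->
    `|pderivs l f (row_mx x xi)| <= C * (1 + hnorm M rho xi) `^ (e - (sw rho l)%:R).

Definition symb_out (R : realType) n d M (rho : 'I_d -> nat) (U : set 'rV[R]_n) (e : R)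
    (f : 'rV[R]_(n + d) -> R) :=
  forall K, compact K -> K `<=` U -> forall l : seq 'I_(n + d),
  exists B C : R, 0 < C /\ forall x xi, K x -> B <= hnorm M rho xi ->
    `|pderivs l f (row_mx x xi)| <= C * hnorm M rho xi `^ (e - (sw rho l)%:R).

Lemma powR_1D (R : realType) (e : R) : exists2 C : R, 0 < C & forall h : R, 1 <= h ->
  h `^ e <= C * (1 + h) `^ e /\ (1 + h) `^ e <= C * h `^ e.
Proof.
have [C C0 CP] := powR_comparable e (ler1n _ 2 : (1 : R) <= 2).
by exists C => // h h1; split; apply: CP; lra.
Qed.

Lemma symb_symb_out (R : realType) n d M (rho : 'I_d -> nat) (U : set 'rV[R]_n) (e : R)
    (f : 'rV[R]_(n + d) -> R) : symb M rho U e f -> symb_out M rho U e f.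
Proof.
move=> sf K cK KU l; have [C C0 CP] := sf K cK KU l.
have [B B0 BP] := powR_1D (e - (sw rho l)%:R).
exists 1, (C * B); split=> [|x xi Kx h1]; first exact: mulr_gt0.
rewrite (le_trans (CP _ _ Kx))// -mulrA ler_wpM2l ?(ltW C0)//.
by have [] := BP _ h1.
Qed.

(** Over a compact [K] the remaining region of bounded [xi] is compact, so smoothness bounds the
    derivative there, while the weight stays above a positive constant. *)
Lemma symb_out_symb (R : realType) n d M (rho : 'I_d -> nat) (U : set 'rV[R]_n) (e : R)
    (f : 'rV[R]_(n + d) -> R) : common_multiple M rho ->
  rsmooth_on (prod_set U setT) f -> symb_out M rho U e f -> symb M rho U e f.
Proof.
move=> cM sf of_ K cK KU l; have [B [C [C0 CP]]] := of_ K cK KU l.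
have [D D0 DP] := powR_1D (e - (sw rho l)%:R).
pose B' := Num.max B 1.
have B'0 : 0 <= B' by rewrite le_max ler01 orbT.
have cS := compact_hnorm_shell cM (lexx 0) B'0.
have cKS := compact_prod_set cK cS.
have [E E0 EP] : exists2 E, 0 < E & forall z, prod_set K
    [set xi | 0 <= hnorm M rho xi <= B'] z -> `|pderivs l f z| <= E.
  apply: compact_le_bound cKS _ => z [/KU Uz _].
  exact: smooth_cont (smooth_pderivs l sf) (conj Uz I).
have [F F0 FP] : exists2 F : R, 0 < F & forall xi, 0 <= hnorm M rho xi <= B' ->
    E <= F * (1 + hnorm M rho xi) `^ (e - (sw rho l)%:R).
  have c1 : 1 <= 1 + B' by rewrite lerDl.
  have [F F0 FP] := powR_comparable (e - (sw rho l)%:R) c1.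
  exists (E * F) => [|xi /andP[h0 hB]]; first exact: mulr_gt0.
  rewrite -mulrA ler_peMr ?(ltW E0)//.
  have := FP 1 (1 + hnorm M rho xi) ltr01; rewrite powR1; apply.
  - by rewrite ltr_pwDl.
  - by rewrite mulr_ege1// lerDl.
  - by rewrite mulr1 lerD2l.
exists (C * D + F) => [|x xi Kx]; first by rewrite addr_gt0// mulr_gt0.
have [hB|hB] := leP (hnorm M rho xi) B'.
  have hh : 0 <= hnorm M rho xi <= B' by rewrite hnorm_ge0.
  rewrite (le_trans (EP _ (prod_set_row Kx hh)))// (le_trans (FP _ hh))//.
  by rewrite ler_wpM2r ?powR_ge0// lerDr mulr_ge0 ?ltW.
have [hB1 h1] : B <= hnorm M rho xi /\ 1 <= hnorm M rho xi.
  by move: hB; rewrite gt_max => /andP[/ltW ? /ltW ?].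
rewrite (le_trans (CP _ _ Kx hB1))//.
rewrite (le_trans (ler_wpM2l (ltW C0) (DP _ h1).1))// mulrA.
by rewrite ler_wpM2r ?powR_ge0// lerDl ltW.
Qed.

(** The derivatives are homogeneous too, so their bound over [K] times the unit sphere, given by
    compactness, scales to all of [hnorm >= 1]. *)
Lemma hom_symb_out (R : realType) n d M (rho : 'I_d -> nat) (U : set 'rV[R]_n) (e : R)
    (f : 'rV[R]_(n + d) -> R) : common_multiple M rho -> open U ->
  rsmooth_on (punctured U) f -> hom_dil rho U e f -> symb_out M rho U e f.
Proof.
move=> cM oU sf hf K cK KU l.
have cKS := compact_prod_set cK (compact_hnorm_shell cM (@ler01 R) (@ler01 R)).
have [E E0 EP] : exists2 E, 0 < E & forall z, prod_set K
    [set xi | 1 <= hnorm M rho xi <= 1] z -> `|pderivs l f z| <= E.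
  apply: compact_le_bound cKS _ => z [/KU Uz /andP[h1 _]].
  apply: smooth_cont (smooth_pderivs l sf) (conj Uz _) => /=.
  by rewrite -(hnorm_gt0 _ cM); exact: lt_le_trans h1.
exists 1, E; split=> // x xi Kx h1.
set h := hnorm M rho xi in h1 *; have h0 : 0 < h by exact: lt_le_trans h1.
have xi0 : xi != 0 by rewrite -(hnorm_gt0 xi cM).
pose eta := dil rho h^-1 xi.
have eta0 : eta != 0 by apply: dil_neq0 => //; rewrite invr_gt0.
have -> : xi = dil rho h eta by rewrite dilM mulfV ?dil1// gt_eqF.
rewrite (pderivs_hom_dil l oU sf hf h0 (KU _ Kx) eta0) normrM ger0_norm ?powR_ge0//.
rewrite mulrC ler_wpM2r ?powR_ge0//; apply: EP; apply: prod_set_row Kx _ => /=.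
by rewrite hnorm_dil ?invr_ge0 ?(ltW h0)// mulVf ?gt_eqF// lexx.
Qed.

(** Agreement for large [xi] transfers to derivatives because the strict inequality defines an open
    set. Replacing [B] by [|B|] allows it to be written with [gauge]. *)
Lemma symb_out_eq (R : realType) n d M (rho : 'I_d -> nat) (U : set 'rV[R]_n) (e : R)
    (f g : 'rV[R]_(n + d) -> R) (B : R) : common_multiple M rho -> open U ->
  (forall x xi, U x -> B < hnorm M rho xi -> f (row_mx x xi) = g (row_mx x xi)) ->
  symb_out M rho U e f -> symb_out M rho U e g.
Proof.
move=> cM oU fg sf K cK KU l; have [B' [C [C0 CP]]] := sf K cK KU l.
pose B1 := `|B|.
exists (Num.max B' (B1 + 1)), C; split=> // x xi Kx.
rewrite ge_max => /andP[hB' hB].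
have oA : open (prod_set U [set xi : 'rV[R]_d | B1 ^+ (2 * M) < gauge M rho xi]).
  apply: open_prod_set oU _.
  apply: (@open_comp _ _ (gauge M rho) [set x | B1 ^+ (2 * M) < x]).
    by move=> z _; exact: continuous_gauge.
  exact: open_gt.
rewrite -(eq_pderivs (f := f) l oA); first exact: CP.
  move=> z [Uz] /=; rewrite ltNge -hnorm_le ?normr_ge0// -ltNge => h.
  by rewrite -(hsubmxK z); apply: fg => //; rewrite (le_lt_trans (ler_norm _)).
apply: prod_set_row; first exact: KU.
rewrite /= ltNge -hnorm_le ?normr_ge0// -ltNge; apply: lt_le_trans hB.
by rewrite ltrDl.
Qed.

Lemma symb_out_le (R : realType) n d M (rho : 'I_d -> nat) (U : set 'rV[R]_n) (e e' : R)
    (f : 'rV[R]_(n + d) -> R) : e <= e' ->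
  symb_out M rho U e f -> symb_out M rho U e' f.
Proof.
move=> ee sf K cK KU l; have [B [C [C0 CP]]] := sf K cK KU l.
exists (Num.max B 1), C; split=> // x xi Kx; rewrite ge_max => /andP[hB h1].
rewrite (le_trans (CP _ _ Kx hB))// ler_wpM2l ?(ltW C0)// ler_powR//.
by rewrite lerD2r.
Qed.

Lemma symb_outD (R : realType) n d M (rho : 'I_d -> nat) (U : set 'rV[R]_n) (e : R)
    (f g : 'rV[R]_(n + d) -> R) : common_multiple M rho -> open U ->
  rsmooth_on (punctured U) f -> rsmooth_on (punctured U) g ->
  symb_out M rho U e f -> symb_out M rho U e g ->
  symb_out M rho U e (fun z => f z + g z).
Proof.
move=> cM oU smf smg sf sg K cK KU l; have [B [C [C0 CP]]] := sf K cK KU l.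
have [B' [C' [C'0 CP']]] := sg K cK KU l.
exists (Num.max (Num.max B B') 1), (C + C'); split=> [|x xi Kx]; first exact: addr_gt0.
rewrite !ge_max => /andP[/andP[hB hB'] h1].
rewrite (pderivsD l (open_punctured oU) smf smg); last first.
  apply: prod_set_row; first exact: KU.
  by rewrite /= -(hnorm_gt0 _ cM); exact: lt_le_trans h1.
by rewrite (le_trans (ler_normD _ _))// mulrDl lerD ?CP ?CP'.
Qed.

Lemma symb_outZ (R : realType) n d M (rho : 'I_d -> nat) (U : set 'rV[R]_n) (e : R)
    (f : 'rV[R]_(n + d) -> R) c : common_multiple M rho -> open U ->
  rsmooth_on (punctured U) f ->
  symb_out M rho U e f -> symb_out M rho U e (fun z => c * f z).
Proof.
move=> cM oU smf sf K cK KU l; have [B [C [C0 CP]]] := sf K cK KU l.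
exists (Num.max B 1), ((`|c| + 1) * C); split=> [|x xi Kx].
  by rewrite mulr_gt0// ltr_wpDl.
rewrite ge_max => /andP[hB h1].
rewrite (pderivsZ l _ (open_punctured oU) smf); last first.
  apply: prod_set_row; first exact: KU.
  by rewrite /= -(hnorm_gt0 _ cM); exact: lt_le_trans h1.
rewrite normrM -mulrA ler_pM//; first by rewrite lerDl.
exact: CP.
Qed.

(** * Reduction of the complex classes to real estimates *)

Lemma normc_bounds (R : realType) (z : R[i]) :
  [/\ `|complex.Re z| <= Normc.normc z, `|complex.Im z| <= Normc.normc z &
      Normc.normc z <= `|complex.Re z| + `|complex.Im z|].
Proof.
case: z => a b /=; have ab0 : 0 <= a ^+ 2 + b ^+ 2 by rewrite addr_ge0 ?sqr_ge0.
split.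
- by rewrite -sqrtr_sqr ler_sqrt// lerDl sqr_ge0.
- by rewrite -sqrtr_sqr ler_sqrt// lerDr sqr_ge0.
- rewrite -[leRHS]ger0_norm ?addr_ge0// -sqrtr_sqr ler_sqrt ?sqr_ge0//.
  rewrite sqrrD !real_normK ?num_real// addrAC lerDl.
  by rewrite mulrn_wge0// mulr_ge0.
Qed.

(* The bounds on the mixed derivatives in the order prescribed by [mderiv]
   extend to all iterated derivatives by the symmetry of the latter. *)
Lemma mderiv_bounds (R : realType) n d (U : set 'rV[R]_n) (f : 'rV[R]_(n + d) -> R[i])
    (omega : nat -> 'rV[R]_d -> R) (rho : 'I_d -> nat) K : open U ->
  smooth_on (prod_set U setT) f -> K `<=` U ->
  (forall al be, exists2 C : R, 0 < C & forall x xi, K x ->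
    Normc.normc (mderiv al be f (row_mx x xi)) <= C * omega (wt rho be) xi) <->
  (forall l, (exists2 C : R, 0 < C & forall x xi, K x ->
    `|pderivs l (fun z => complex.Re (f z)) (row_mx x xi)| <= C * omega (sw rho l) xi) /\
   (exists2 C : R, 0 < C & forall x xi, K x ->
    `|pderivs l (fun z => complex.Im (f z)) (row_mx x xi)| <= C * omega (sw rho l) xi)).
Proof.
move=> oU [sR sI] KU; have oA : open (prod_set U [set: 'rV[R]_d]).
  by apply: open_prod_set => //; exact: openT.
have KA x xi : K x -> prod_set U [set: 'rV[R]_d] (row_mx x xi).
  by move=> /KU Ux; exact: prod_set_row.
split=> [h l|h al be].
  have pl := perm_mi_seq l.
  have [C C0 CP] := h (fun i => count_mem (lshift d i) l) (fun i => count_mem (rshift n i) l).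
  rewrite (sw_perm rho pl) sw_mi; split; exists C => // x xi Kx.
    rewrite (pderivs_perm oA sR (KA _ _ Kx) pl); apply: le_trans (CP _ _ Kx).
    by have [] := normc_bounds (mderiv (fun i => count_mem (lshift d i) l)
      (fun i => count_mem (rshift n i) l) f (row_mx x xi)).
  rewrite (pderivs_perm oA sI (KA _ _ Kx) pl); apply: le_trans (CP _ _ Kx).
  by have [] := normc_bounds (mderiv (fun i => count_mem (lshift d i) l)
    (fun i => count_mem (rshift n i) l) f (row_mx x xi)).
have [[C C0 CP] [D D0 DP]] := h (map (@lshift n d) (mi_seq al) ++ map (@rshift n d) (mi_seq be)).
exists (C + D) => [|x xi Kx]; first exact: addr_gt0.
have [_ _] := normc_bounds (mderiv al be f (row_mx x xi)); move/le_trans; apply.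
have := CP x xi Kx; have := DP x xi Kx; rewrite sw_mi mulrDl => h1 h2.
exact: lerD h2 h1.
Qed.

Lemma bound_le (R : realType) (X Y : Type) (K : X -> Prop) (g : X -> Y -> R)
    (w w' : Y -> R) :
  (exists2 Q : R, 0 < Q & forall y, w y <= Q * w' y) ->
  (exists2 C : R, 0 < C & forall x y, K x -> g x y <= C * w y) ->
  exists2 C : R, 0 < C & forall x y, K x -> g x y <= C * w' y.
Proof.
move=> [Q Q0 QP] [C C0 CP]; exists (C * Q) => [|x y Kx]; first exact: mulr_gt0.
by rewrite (le_trans (CP x y Kx))// -mulrA ler_wpM2l// ltW.
Qed.

Lemma symbol_classP (R : realType) n d M (rho : 'I_d -> nat) (q : 'rV[R]_d -> R)
    (U : set 'rV[R]_n) (m : R) (a : 'rV[R]_(n + d) -> R[i]) :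
  common_multiple M rho -> homogeneous_quasinorm (dil rho) q -> open U ->
  symbol_class rho q U m a <->
  smooth_on (prod_set U setT) a /\
  (symb M rho U m (fun z => complex.Re (a z)) /\ symb M rho U m (fun z => complex.Im (a z))).
Proof.
move=> cM hq oU.
have hw k : exists2 Q : R, 0 < Q & forall xi,
    (1 + q xi) `^ (m - k%:R) <= Q * (1 + hnorm M rho xi) `^ (m - k%:R).
  have [Q Q0 QP] := quasinorm_weight (m - k%:R) cM hq.
  by exists Q => // xi; case: (QP xi).
have wh k : exists2 Q : R, 0 < Q & forall xi,
    (1 + hnorm M rho xi) `^ (m - k%:R) <= Q * (1 + q xi) `^ (m - k%:R).
  have [Q Q0 QP] := quasinorm_weight (m - k%:R) cM hq.
  by exists Q => // xi; case: (QP xi).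
have H K (sa : smooth_on (prod_set U setT) a) (KU : K `<=` U) :=
  mderiv_bounds (fun k xi => (1 + q xi) `^ (m - k%:R)) rho oU sa KU.
split=> -[sa ha]; split=> //.
  by split=> K cK KU l; apply: bound_le (hw _) _;
    case: ((H K sa KU).1 (ha K cK KU) l).
move=> K cK KU; apply: (H K sa KU).2 => l.
by split; apply: bound_le (wh _) _; [exact: ha.1|exact: ha.2].
Qed.

Lemma schwartz_classP (R : realType) n d M (rho : 'I_d -> nat) (qt : 'rV[R]_(d + 1) -> R)
    (U : set 'rV[R]_n) (f : 'rV[R]_(n + (d + 1)) -> R[i]) :
  common_multiple M rho -> homogeneous_quasinorm (dilt rho) qt -> open U ->
  schwartz_class qt U f <->
  smooth_on (prod_set U setT) f /\
  forall e, symb M (rhot rho) U e (fun z => complex.Re (f z)) /\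
            symb M (rhot rho) U e (fun z => complex.Im (f z)).
Proof.
move=> cM'; have cM := rhot_multiple cM'.
have -> : @dilt R d rho = dil (rhot rho) by apply/funext => s; exact: dilt_dil.
move=> hq oU.
have [q0 _ _ _ _] := hq.
have H K (sf : smooth_on (prod_set U setT) f) (KU : K `<=` U) k :=
  mderiv_bounds (fun _ xi => (1 + qt xi) ^- k) (rhot rho) oU sf KU.
split=> -[sf hf]; split=> //.
  have hw e : exists k, exists2 Q : R, 0 < Q & forall xi,
      (1 + qt xi) ^- k <= Q * (1 + hnorm M (rhot rho) xi) `^ e.
    (* Then [- k <= e], and [1 + qt >= 1] makes the power [- k] the smaller one. *)
    pose k := Num.bound `|- e|; exists k.
    have [Q Q0 QP] := quasinorm_weight e cM hq.
    exists Q => // xi; apply: le_trans (QP xi).1.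
    have h1 : 0 <= 1 + qt xi by rewrite addr_ge0.
    rewrite -powR_invn// ler_powR ?lerDl// lerNl ltW//.
    exact: le_lt_trans (ler_norm _) (archi_boundP (normr_ge0 _)).
  move=> e; split=> K cK KU l; have [k hk] := hw (e - (sw (rhot rho) l)%:R);
    by apply: bound_le hk _; case: ((H K sf KU k).1 (hf K cK KU k) l).
move=> K cK KU k; apply: (H K sf KU k).2 => l.
(* The order [sw l - k] is chosen for each [l]: [symb] subtracts the weight [sw l] again and leaves
   the exponent [- k]. *)
have wh : exists2 Q : R, 0 < Q & forall xi, (1 + hnorm M (rhot rho) xi)
    `^ ((sw (rhot rho) l)%:R - k%:R - (sw (rhot rho) l)%:R) <= Q * (1 + qt xi) ^- k.
  have [Q Q0 QP] := quasinorm_weight (- k%:R) cM hq.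
  exists Q => // xi; rewrite addrAC subrr add0r; apply: le_trans (QP xi).2 _.
  by rewrite powR_invn// addr_ge0.
by split; apply: bound_le wh _; [exact: (hf _).1|exact: (hf _).2].
Qed.

(** * Limits of smooth functions with geometric rate *)

(** The intervals of radius [2 * C / 2^k] around [x k] are nested, the radius being the sum of all
    remaining steps; the limit is the infimum of their right ends. *)
Lemma geo_limit (R : realType) (x : nat -> R) (C : R) :
  (forall k, `|x k.+1 - x k| <= C / 2 ^+ k) ->
  exists L, forall k, `|L - x k| <= 2 * C / 2 ^+ k.
Proof.
move=> xC.
pose y k := x k + 2 * C / 2 ^+ k; pose z k := x k - 2 * C / 2 ^+ k.
have E k : 2 * C / 2 ^+ k = C / 2 ^+ k + 2 * C / 2 ^+ k.+1.
  by rewrite exprS; field; rewrite expf_neq0.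
have C0 : 0 <= C by have := xC 0%N; rewrite expr0 divr1; exact: le_trans.
have D0 k : 0 <= 2 * C / 2 ^+ k by rewrite divr_ge0 ?mulr_ge0// exprn_ge0.
have yd k : y k.+1 <= y k.
  by have := xC k; rewrite /y (E k) ler_norml => /andP[_ h]; lra.
have zd k : z k <= z k.+1.
  by have := xC k; rewrite /z (E k) ler_norml => /andP[h _]; lra.
have ym j k : (j <= k)%N -> y k <= y j.
  by move=> /subnK <-; elim: (k - j)%N => [//|i IH]; exact: le_trans (yd _) IH.
have zm j k : (j <= k)%N -> z j <= z k.
  by move=> /subnK <-; elim: (k - j)%N => [//|i IH]; exact: le_trans IH (zd _).
have zy j k : z j <= y k.
  apply: le_trans (zm _ _ (leq_maxl j k)) _; apply: le_trans _ (ym _ _ (leq_maxr j k)).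
  by rewrite /z /y lerD2l ge0_cp.
have hi : has_inf (range y).
  by split; [exists (y 0%N), 0%N|exists (z 0%N) => _ [k _ <-]].
exists (inf (range y)) => k.
have h1 : inf (range y) <= y k by apply: ge_inf; [case: hi|exists k].
have h2 : z k <= inf (range y) by apply: lb_le_inf; [case: hi|move=> _ [j _ <-]].
by move: h1 h2; rewrite /y /z ler_norml; lra.
Qed.

Lemma geo_small (R : realType) (C e : R) : 0 < e -> exists k, C / 2 ^+ k < e.
Proof.
move=> e0; pose k := Num.bound `|C / e|; exists k.
rewrite ltr_pdivrMr ?exprn_gt0// mulrC -ltr_pdivrMr//.
apply: lt_trans (_ : k%:R < _); last by rewrite -natrX ltr_nat ltn_expl.
exact: le_lt_trans (ler_norm _) (archi_boundP (normr_ge0 _)).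
Qed.

Lemma small_eq0 (R : realType) (a C : R) : (forall k, `|a| <= C / 2 ^+ k) -> a = 0.
Proof.
move=> h; apply/eqP; rewrite -normr_le0 leNgt; apply/negP => a0.
by have [k] := geo_small C a0; rewrite ltNge h.
Qed.

(* Junk value [0] when the sequence has no limit with rate [2^-k]. *)
Definition glim (R : realType) (x : nat -> R) : R :=
  xget 0 [set L | exists C, forall k, `|L - x k| <= C / 2 ^+ k].

(** [glim] is picked with some unknown constant; uniqueness of the limit lets the constant of the
    hypothesis take its place. *)
Lemma glimP (R : realType) (x : nat -> R) (C : R) :
  (forall k, `|x k.+1 - x k| <= C / 2 ^+ k) ->
  forall k, `|glim x - x k| <= 2 * C / 2 ^+ k.
Proof.
move=> xC; have [L LP] := geo_limit xC; have [D DP] : exists D, forall k, `|glim x - x k| <= D / 2 ^+ k.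
  by rewrite /glim; case: xgetP => [y _ //|/(_ L)[]]; exists (2 * C).
suff -> : glim x = L by [].
apply/eqP; rewrite -subr_eq0; apply/eqP; apply: (@small_eq0 _ _ (D + 2 * C)) => k.
rewrite mulrDl (_ : _ - L = (glim x - x k) - (L - x k)); last by ring.
by rewrite (le_trans (ler_normB _ _))// lerD.
Qed.

Lemma MVT_sym (R : realType) N (A : set 'rV[R]_N) f i z (h : R) :
  rsmooth_on A f -> (forall t, `|t| <= `|h| -> A (t *: delta_mx 0 i + z)) ->
  exists2 c, `|c| <= `|h| &
    f (h *: delta_mx 0 i + z) - f z = h * pd i f (c *: delta_mx 0 i + z).
Proof.
move=> sf Ah; have [h0|h0] := leP 0 h.
  have [|c /andP[c0 ch] E] := MVT_along h0 sf (z := z) (i := i).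
    by move=> t /andP[t0 th]; apply: Ah; rewrite !ger0_norm.
  by exists c => //; rewrite !ger0_norm.
have Nh0 : 0 <= - h by rewrite oppr_ge0 ltW.
have [|c /andP[c0 ch] E] := MVT_along Nh0 sf (z := h *: delta_mx 0 i + z) (i := i).
  move=> t /andP[t0 th]; rewrite addrA -scalerDl; apply: Ah.
  by rewrite (ltr0_norm h0) ler_norml opprK lerDr t0/=; move: th h0; clear; lra.
exists (c + h).
  by rewrite (ltr0_norm h0) ler_norml opprK lerDr c0/=; move: ch h0; clear; lra.
move: E; rewrite !addrA -!scalerDl addNr scale0r add0r => E.
by rewrite -[LHS]opprB E mulNr opprK.
Qed.

Lemma nbhs_segment (R : realType) N (A : set 'rV[R]_N) z (v : 'rV[R]_N) :
  nbhs z A -> exists2 r : R, 0 < r & forall t, `|t| < r -> A (t *: v + z).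
Proof.
move=> /nbhs_normP[r /= r0 rA].
exists (r / (`|v| + 1)) => [|t tr]; first by rewrite divr_gt0// ltr_wpDl.
apply: rA; rewrite /ball_/= opprD addrCA subrr addr0 normrN normrZ.
have v1 : 0 < `|v| + 1 by rewrite ltr_wpDl.
move: tr; rewrite ltr_pdivlMr//; apply: le_lt_trans.
by rewrite ler_wpM2l// lerDl.
Qed.

Lemma uniform_geo_continuous (R : realType) (T : topologicalType)
    (f : nat -> T -> R) g z C : (forall k, {for z, continuous (f k)}) ->
  (\forall w \near z, forall k, `|g w - f k w| <= C / 2 ^+ k) ->
  {for z, continuous g}.
Proof.
move=> cf gf; apply/cvgrPdist_lt => e e0.
have e30 : 0 < e / 3 by rewrite divr_gt0.
have [k kP] := geo_small C e30.
have nf : \forall w \near z, `|f k z - f k w| < e / 3.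
  by have /cvgrPdist_lt := cf k; apply; rewrite divr_gt0.
have h1 := nbhs_singleton gf k.
apply: filter_app nf; apply: filterS gf => w /(_ k) h2 hw.
rewrite (_ : g z - g w = (g z - f k z) + (f k z - f k w) - (g w - f k w)); last by ring.
apply: le_lt_trans (ler_normB _ _) _.
have := ler_normD (g z - f k z) (f k z - f k w).
by move: h1 h2 hw kP; clear; lra.
Qed.

(** Differentiation of a limit. Only the derivatives must converge uniformly on [B]; the rate of the
    functions themselves may depend on the point. *)
Lemma uniform_geo_derive (R : realType) N (A B : set 'rV[R]_N)
    (f : nat -> 'rV[R]_N -> R) g g' i z C :
  open B -> B z -> B `<=` A -> (forall k, rsmooth_on A (f k)) ->
  {for z, continuous g'} ->
  (forall w, B w -> exists D, forall k, `|g w - f k w| <= D / 2 ^+ k) ->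
  (forall k w, B w -> `|g' w - pd i (f k) w| <= C / 2 ^+ k) ->
  is_derive z (delta_mx 0 i) g (g' z).
Proof.
move=> oB Bz BA sf cg' gf gf'.
have [r r0 rB] := nbhs_segment (delta_mx 0 i) (open_nbhs_nbhs (conj oB Bz)).
suff cv : (fun h : R => h^-1 *: ((g \o shift z) (h *: delta_mx 0 i) - g z)) @ 0^' --> g' z.
  by apply: DeriveDef; [apply/cvg_ex; exists (g' z)|exact/cvg_lim].
apply/cvgrPdist_le => e e0.
have [s s0 sP] : exists2 s, 0 < s & forall t, `|t| < s ->
    `|g' z - g' (t *: delta_mx 0 i + z)| <= e.
  have /cvgrPdist_le /(_ e e0) nz := cg'.
  exact: nbhs_segment (delta_mx 0 i) nz.
near=> h.
have h0 : h != 0 by near: h; exact: nbhs_dnbhs_neq.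
have hr : `|h| < r by near: h; exact: dnbhs0_lt.
have hs : `|h| < s by near: h; exact: dnbhs0_lt.
rewrite /= /GRing.scale/=.
have hz : B (h *: delta_mx 0 i + z) by exact: rB.
have [D DP] := gf _ hz; have [D' DP'] := gf _ Bz.
pose w := h *: delta_mx 0 i + z.
suff key : `|(g w - g z) - h * g' z| <= `|h| * e.
  rewrite (_ : g' z - h^-1 * (g w - g z) = - (h^-1 * ((g w - g z) - h * g' z))).
    by rewrite normrN normrM normfV ler_pdivrMl// normr_gt0.
  by rewrite [in RHS]mulrBr mulKf// opprB.
(* With [h] now fixed, [k] may depend on it: the errors of [f k] at the two points and of its
   derivative are made smaller than [eta], and the mean value theorem for [f k] does the rest. *)
apply/ler_addgt0Pr => eta eta0.
have [k /ltW kP] := geo_small (D + D' + `|h| * C) eta0.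
have [t th|c ch E] := MVT_sym (z := z) (h := h) (i := i) (sf k).
  by apply/BA/rB; exact: le_lt_trans hr.
have h1 := DP k; have h2 := DP' k.
have h3 := gf' k _ (rB c (le_lt_trans ch hr)).
have h4 := sP c (le_lt_trans ch hs).
set c' := c *: _ + z in E h3 h4.
have -> : g w - g z - h * g' z = (g w - f k w) - (g z - f k z) +
    (h * (- (g' c' - pd i (f k) c') - (g' z - g' c'))).
  have {}E : f k w - f k z = h * pd i (f k) c' := E.
  rewrite !opprB mulrDr mulrBr -E mulrBr.
  by move: (f k w) (f k z) (g w) (g z) (g' c'); clear => *; ring.
apply: le_trans (ler_normD _ _) _; rewrite normrM.
have h5 : `|- (g' c' - pd i (f k) c') - (g' z - g' c')| <= C / 2 ^+ k + e.
  by apply: le_trans (ler_normB _ _) _; rewrite normrN lerD.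
have h6 := ler_normB (g w - f k w) (g z - f k z).
have h7 := ler_wpM2l (normr_ge0 h) h5.
move: kP; rewrite !mulrDl -mulrA => kP.
move: h1 h2 h6 h7 kP; rewrite mulrDr; clear; rewrite -/w.
move: `|_ - _| `|_ - _| `|_ + _| => *; lra.
Unshelve. all: by end_near. Qed.

(** All derivatives are passed to the limit separately as [G s], and [G (i :: s)] is then shown to
    be the derivative of [G s]. The final estimate needs the rate at the single point [z] only, so
    it carries sharper constants than the local ones used for existence. *)
Lemma smooth_geo_limit (R : realType) N (A : set 'rV[R]_N) (f : nat -> 'rV[R]_N -> R) :
  open A -> (forall k, rsmooth_on A (f k)) ->
  (forall s z, A z -> exists B C, [/\ open B, B z, B `<=` A & forall k w, B w ->
     `|pderivs s (f k.+1) w - pderivs s (f k) w| <= C / 2 ^+ k]) ->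
  exists2 g, rsmooth_on A g & forall s z C, A z ->
    (forall k, `|pderivs s (f k.+1) z - pderivs s (f k) z| <= C / 2 ^+ k) ->
    forall k, `|pderivs s g z - pderivs s (f k) z| <= 2 * C / 2 ^+ k.
Proof.
move=> oA sf hf.
pose G s z := glim (fun k => pderivs s (f k) z).
have cG s z : A z -> {for z, continuous (G s)}.
  move=> Az; have [B [C [oB Bz BA BC]]] := hf s z Az.
  apply: (@uniform_geo_continuous _ _ (fun k => pderivs s (f k)) _ _ (2 * C)).
    by move=> k; exact: smooth_cont (smooth_pderivs s (sf k)) Az.
  by apply: (near_set oB Bz) => w Bw; apply: glimP => j; exact: BC.
have dG s i z : A z -> is_derive z (delta_mx 0 i) (G s) (G (i :: s) z).
  move=> Az; have [B [C [oB Bz BA BC]]] := hf (i :: s) z Az.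
  apply: (@uniform_geo_derive _ _ A B (fun k => pderivs s (f k)) _ _ _ _ (2 * C)) => //.
  - by move=> k; exact: smooth_pderivs.
  - exact: cG.
  - move=> w Bw; have [B' [C' [_ Bw' _ BC']]] := hf s w (BA _ Bw).
    by exists (2 * C'); apply: glimP => j; exact: BC'.
  - by move=> k w Bw; apply: (@glimP _ (fun k => pderivs (i :: s) (f k) w)) => j; exact: BC.
have pG s z : A z -> pderivs s (G [::]) z = G s z.
  elim: s z => [//|i s IH] z Az.
  rewrite pderivs_cons (eq_pd i oA IH Az).
  by have [] := dG s i z Az.
exists (G [::]) => [|s z C Az hC k]; last by rewrite pG//; exact: glimP.
move=> s z Az; split.
  by apply: near_continuous (cG s z Az); apply: (near_set oA Az) => x Ax; rewrite pG.
move=> i; apply: (@near_eq_derivable _ _ _ (G s)).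
  by apply: (near_set oA Az) => x Ax; rewrite pG.
by have [] := dG s i z Az.
Qed.

(** * Homogeneous limit *)

Lemma open_full (R : realType) n d (U : set 'rV[R]_n) :
  open U -> open (prod_set U [set: 'rV[R]_d]).
Proof. by move=> oU; apply: open_prod_set => //; exact: openT. Qed.

Lemma punctured_full (R : realType) n d (U : set 'rV[R]_n) :
  @punctured R n d U `<=` prod_set U setT.
Proof. by move=> z [Uz _]. Qed.

Lemma full_xdil (R : realType) n d (rho : 'I_d -> nat) (U : set 'rV[R]_n) (s : R) z :
  prod_set U [set: 'rV[R]_d] z -> prod_set U [set: 'rV[R]_d] (xdil rho s z).
Proof. by move=> [Uz _]; split=> //; rewrite /xdil row_mxKl. Qed.

Lemma xdilM (R : realType) n d (rho : 'I_d -> nat) (s t : R) (z : 'rV[R]_(n + d)) :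
  xdil rho s (xdil rho t z) = xdil rho (s * t) z.
Proof. by apply/rowP => i; rewrite !xdil_coord exprMn mulrA. Qed.

Lemma xdil1 (R : realType) n d (rho : 'I_d -> nat) (z : 'rV[R]_(n + d)) :
  xdil rho 1 z = z.
Proof. by apply/rowP => i; rewrite xdil_coord expr1n mul1r. Qed.

Lemma powR_neg_le (R : realType) (a b e : R) : e <= 0 -> 0 < a -> a <= b ->
  b `^ e <= a `^ e.
Proof.
move=> e0 a0 ab; have b0 := lt_le_trans a0 ab.
rewrite -[e]opprK !(powRN _ (- e)) lef_pV2 ?posrE ?powR_gt0//.
by rewrite ge0_ler_powR ?nnegrE ?oppr_ge0 ?(ltW a0) ?(ltW b0).
Qed.

(** With [t = 2^k], the bound [(1 + t h)^E <= t^E h^E] leaves [t] to the power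
    [- m + j + (e - j) = e - m <= -1]. The [j] factors from the chain rule cancel against the gain
    from differentiating a symbol, so the rate is the same for all derivatives. *)
Lemma rapid_dilated (R : realType) (m e h : R) (k j : nat) (E := e - j%:R) :
  e <= m - 1 -> e <= 0 -> 0 < h ->
  ((2 ^+ k) `^ m)^-1 * ((2 ^+ k) ^+ j * (1 + 2 ^+ k * h) `^ E) <= h `^ E / 2 ^+ k.
Proof.
move=> em e0 h0; set t : R := 2 ^+ k.
have t0 : 0 < t by rewrite exprn_gt0.
have t1 : 1 <= t by rewrite exprn_ege1// ler1n.
have E0 : E <= 0 by rewrite /E subr_le0 (le_trans e0).
have le1 : (1 + t * h) `^ E <= t `^ E * h `^ E.
  rewrite -powRM ?(ltW t0) ?(ltW h0)//; apply: powR_neg_le => //.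
    exact: mulr_gt0.
  by rewrite lerDr.
have tn0 : t != 0 by rewrite gt_eqF.
have key : (t `^ m)^-1 * (t ^+ j * t `^ E) <= t^-1.
  rewrite -powR_mulrn ?(ltW t0)// -powRN -!powRD; last 2 first.
  - by apply/implyP.
  - by apply/implyP.
  rewrite -powR_inv1 ?(ltW t0)// ler_powR//.
  by rewrite /E; move: em; clear; lra.
apply: (@le_trans _ _ ((t `^ m)^-1 * (t ^+ j * t `^ E) * h `^ E)).
  rewrite -!mulrA ler_wpM2l ?invr_ge0 ?powR_ge0// ler_wpM2l ?exprn_ge0 ?(ltW t0)//.
by rewrite mulrC ler_wpM2l ?powR_ge0.
Qed.

Lemma compact_neighborhood (R : realType) N (U : set 'rV[R]_N) x : open U -> U x ->
  exists K B, [/\ compact K, K `<=` U, open B, B x & B `<=` K].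
Proof.
move=> oU Ux; have /nbhs_normP[r /= r0 rU] : nbhs x U by exact: open_nbhs_nbhs.
have cn : continuous (fun w : 'rV[R]_N => `|x - w|).
  move=> w; apply: (@continuous_comp _ _ _ (fun w : 'rV[R]_N => x - w) Num.norm).
    by apply: (@continuousB _ _ _ (cst x) id); [exact: cst_continuous|].
  exact: norm_continuous.
exists [set w | `|x - w| <= r / 2], [set w | `|x - w| < r / 2]; split.
- apply: bounded_closed_compact.
    exists (`|x| + r / 2); split; first by rewrite num_real.
    move=> M xM w /= xw; apply: le_trans (ltW xM).
    rewrite -[w](subKr x) (le_trans (ler_normB _ _))// lerD2l.
    exact: xw.
  by apply: (@closed_comp _ _ _ [set y | y <= r / 2]) => // w _; exact: cn.
- move=> w /= xw; apply: rU => /=; apply: le_lt_trans xw _.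
  by rewrite ltr_pdivrMr// ltr_pMr// ltr1n.
- by apply: (@open_comp _ _ _ [set y | y < r / 2]); [move=> w _; exact: cn|exact: open_lt].
- by rewrite /= subrr normr0 divr_gt0.
- by move=> w /= /ltW.
Qed.

Lemma scaled_triangle (R : realType) (v1 v2 f1 f2 s a b c : R) : 0 <= s ->
  `|v1 - f1| <= a -> `|v2 - f2| <= b -> `|f1 - s * f2| <= c ->
  `|v1 - s * v2| <= a + s * b + c.
Proof.
move=> s0 h1 h2 h3.
have h4 : `|s * (v2 - f2)| <= s * b by rewrite normrM ger0_norm// ler_wpM2l.
rewrite (_ : v1 - s * v2 = (v1 - f1) - s * (v2 - f2) + (f1 - s * f2)); last by ring.
rewrite (le_trans (ler_normD _ _))// lerD// (le_trans (ler_normB _ _))//.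
exact: lerD.
Qed.

(* [v] is the limit of [u (xdil rho (2^k) z) / (2^k)^m]. *)
Lemma homogeneous_limit (R : realType) n d M (rho : 'I_d -> nat) (U : set 'rV[R]_n) (m : R)
    (u : 'rV[R]_(n + d) -> R) : common_multiple M rho -> open U ->
  rsmooth_on (prod_set U setT) u ->
  (forall s, 0 < s -> forall e,
     symb M rho U e (fun z => u (xdil rho s z) - s `^ m * u z)) ->
  exists v, [/\ rsmooth_on (punctured U) v, hom_dil rho U m v &
    forall e, symb_out M rho U e (fun z => u z - v z)].
Proof.
move=> cM oU su hu.
have oF := @open_full R n d U oU.
have oP := @open_punctured R n d U oU.
pose t k : R := 2 ^+ k.
have t0 k : 0 < t k by rewrite exprn_gt0.
pose f k z := (t k `^ m)^-1 * u (xdil rho (t k) z).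
have suk k : rsmooth_on (prod_set U setT) (u \o xdil rho (t k)).
  by apply: smooth_affine oF (@coord_affine_xdil R n d rho (t k)) _ su => z; exact: full_xdil.
have sfF k : rsmooth_on (prod_set U setT) (f k) := smoothZ _ oF (suk k).
have sf k : rsmooth_on (punctured U) (f k).
  exact: sub_smooth (@punctured_full R n d U) (sfF k).
pose r s z := u (xdil rho s z) - s `^ m * u z.
have sr s : rsmooth_on (prod_set U setT) (r s).
  apply: (smoothB oF _ (smoothZ _ oF su)).
  by apply: smooth_affine oF (@coord_affine_xdil R n d rho s) _ su => z; exact: full_xdil.
(* A step of the sequence is the defect of homogeneity for [s = 2], dilated by [2^k]. *)
have ftel k z : f k.+1 z - f k z = (t k.+1 `^ m)^-1 * r 2 (xdil rho (t k) z).
  rewrite /f /r xdilM -exprS mulrBr; congr (_ - _).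
  by rewrite /t exprS powRM ?exprn_ge0// invfM mulrACA mulVf ?mul1r// gt_eqF// powR_gt0.
(* [e0 <= m - 1] gives the rate [2^-k], and [e0 <= 0] makes the weights decrease in [hnorm]. *)
pose e0 := Num.min (m - 1) 0.
have e0m : e0 <= m - 1 by rewrite ge_min lexx.
have e00 : e0 <= 0 by rewrite ge_min lexx orbT.
(* Kept for every order below [e0]: the construction of [v] uses [e0] alone, but the decay of
   [u - v] needs all orders. *)
have geom e K l : e <= e0 -> compact K -> K `<=` U -> exists2 C, 0 < C &
    forall k x xi, K x -> xi != 0 ->
    `|pderivs l (f k.+1) (row_mx x xi) - pderivs l (f k) (row_mx x xi)| <=
    C * hnorm M rho xi `^ (e - (sw rho l)%:R) / 2 ^+ k.
  move=> ee cK KU; have two0 : 0 < 2 :> R by [].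
  have [C C0 CP] := hu 2 two0 e K cK KU l.
  exists ((2 `^ m)^-1 * C) => [|k x xi Kx xi0].
    by rewrite mulr_gt0// invr_gt0 powR_gt0.
  have Fz : prod_set U [set: 'rV[R]_d] (row_mx x xi) by apply: prod_set_row => //; exact: KU.
  rewrite -(pderivsB l oF (sfF k.+1) (sfF k) Fz).
  have srk : rsmooth_on (prod_set U setT) (r 2 \o xdil rho (t k)).
    apply: smooth_affine oF (@coord_affine_xdil R n d rho (t k)) _ (sr 2) => z.
    exact: full_xdil.
  rewrite (eq_pderivs (g := fun z => (t k.+1 `^ m)^-1 * (r 2 \o xdil rho (t k)) z) l oF _ Fz);
    last by move=> z _; exact: ftel.
  rewrite (pderivsZ l _ oF srk Fz).
  rewrite (pderivs_xdil l oF (fun z => @full_xdil R n d rho U (t k) z) (sr 2) Fz).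
  rewrite xdil_row !normrM [`|_^-1|]ger0_norm ?invr_ge0 ?powR_ge0//.
  rewrite [`|_ ^+ _|]ger0_norm ?exprn_ge0 ?(ltW (t0 k))//.
  have h0 : 0 < hnorm M rho xi by rewrite hnorm_gt0.
  have := CP x (dil rho (t k) xi) Kx; rewrite hnorm_dil ?(ltW (t0 k))// => CP1.
  have e1 : e <= m - 1 := le_trans ee e0m.
  have e2 : e <= 0 := le_trans ee e00.
  have RD := @rapid_dilated R m e (hnorm M rho xi) k (sw rho l) e1 e2 h0.
  rewrite {1}/t exprS powRM ?exprn_ge0// invfM -!mulrA ler_wpM2l ?invr_ge0 ?powR_ge0//.
  apply: le_trans (_ : _ <= C * ((t k `^ m)^-1 * (t k ^+ sw rho l *
     (1 + t k * hnorm M rho xi) `^ (e - (sw rho l)%:R)))) _; last first.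
    by rewrite ler_wpM2l ?(ltW C0).
  rewrite [leRHS]mulrCA ler_wpM2l ?invr_ge0 ?powR_ge0// [leRHS]mulrCA.
  rewrite ler_wpM2l ?exprn_ge0 ?(ltW (t0 k))//.
have [v sv vP] : exists2 g, rsmooth_on (punctured U) g & forall s z C, punctured U z ->
    (forall k, `|pderivs s (f k.+1) z - pderivs s (f k) z| <= C / 2 ^+ k) ->
    forall k, `|pderivs s g z - pderivs s (f k) z| <= 2 * C / 2 ^+ k.
  apply: (smooth_geo_limit oP sf) => l z Pz; have [Uz z0] := Pz.
  have [K [B [cK KU oB Bz BK]]] := compact_neighborhood oU Uz.
  have [C C0 CP] := geom e0 _ l (lexx _) cK KU.
  (* On the neighbourhood where [hnorm > h] the decreasing weight is bounded by its value at [h],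
     which makes the rate locally uniform. *)
  pose h := hnorm M rho (rsubmx z) / 2.
  have h0 : 0 < h by rewrite divr_gt0// hnorm_gt0.
  exists (prod_set B [set xi | h ^+ (2 * M) < gauge M rho xi]).
  exists (C * h `^ (e0 - (sw rho l)%:R)); split.
  - apply: (open_prod_set oB).
    apply: (@open_comp _ _ (gauge M rho) [set x | h ^+ (2 * M) < x]).
      by move=> w _; exact: continuous_gauge.
    exact: open_gt.
  - split=> //; rewrite /= ltNge -hnorm_le ?(ltW h0)// -ltNge /h ltr_pdivrMr//.
    by rewrite ltr_pMr ?hnorm_gt0// ltr1n.
  - move=> w [wB]; rewrite /= => wh; split.
      exact/KU/BK.
    by rewrite /= -(gauge_gt0 _ cM); apply: le_lt_trans wh; rewrite exprn_ge0 ?(ltW h0).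
  - move=> k w [wB]; rewrite /= ltNge -hnorm_le ?(ltW h0)// -ltNge => wh.
    have w0 : rsubmx w != 0 by rewrite -(hnorm_gt0 _ cM) (lt_trans h0).
    rewrite -(hsubmxK w); apply: le_trans (CP k _ _ (BK _ wB) w0) _.
    rewrite ler_wpM2r ?invr_ge0 ?exprn_ge0// ler_wpM2l ?(ltW C0)//.
    apply: powR_neg_le => //; last exact: ltW.
    by rewrite subr_le0 (le_trans e00).
have vf l e K : e <= e0 -> compact K -> K `<=` U -> exists2 C, 0 < C &
    forall k x xi, K x -> xi != 0 ->
    `|pderivs l v (row_mx x xi) - pderivs l (f k) (row_mx x xi)| <=
    C * hnorm M rho xi `^ (e - (sw rho l)%:R) / 2 ^+ k.
  move=> ee cK KU; have [C C0 CP] := geom e K l ee cK KU.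
  exists (2 * C) => [|k x xi Kx xi0]; first exact: mulr_gt0.
  rewrite -(mulrA 2 C); apply: vP => [|j]; last exact: CP.
  by apply: prod_set_row => //; exact: KU.
exists v; split=> //.
- move=> s x xi s0 Ux xi0.
  have cK : compact [set x] by exact: compact_set1.
  have KU : [set x] `<=` U by move=> y ->.
  have [C C0 CP] := vf [::] e0 _ (lexx _) cK KU.
  have [D D0 DP] := hu s s0 e0 _ cK KU [::].
  apply/eqP; rewrite -subr_eq0; apply/eqP.
  have sxi0 := dil_neq0 rho s0 xi0.
  have h0 : 0 < hnorm M rho xi by rewrite hnorm_gt0.
  (* Dilations by [s] and [2^k] commute, so the defect of homogeneity of [f k] is a rescaled [r s]
     and tends to 0. Hence [v] is homogeneous for every [s], although the limit runs along powers of
     2. *)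
  have fE k : f k (row_mx x (dil rho s xi)) - s `^ m * f k (row_mx x xi) =
      (t k `^ m)^-1 * r s (row_mx x (dil rho (t k) xi)).
    by rewrite /f /r !xdil_row !dilM (mulrC s) mulrBr [s `^ m * _]mulrCA.
  have c2 k := CP k x (dil rho s xi) erefl sxi0.
  have c3 k := CP k x xi erefl xi0.
  have c4 k : `|f k (row_mx x (dil rho s xi)) - s `^ m * f k (row_mx x xi)| <=
      D * hnorm M rho xi `^ (e0 - 0%:R) / 2 ^+ k.
    rewrite fE normrM ger0_norm ?invr_ge0 ?powR_ge0//.
    have := @rapid_dilated R m e0 (hnorm M rho xi) k 0 e0m e00 h0.
    rewrite expr0 mul1r => RD; have := DP x (dil rho (t k) xi) erefl.
    rewrite hnorm_dil ?(ltW (t0 k))// /sw big_nil => DP1.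
    rewrite -mulrA; apply: le_trans (ler_wpM2l (ltW D0) RD); rewrite mulrCA.
    by rewrite ler_wpM2l ?invr_ge0 ?powR_ge0.
  move: c2 c3; rewrite /sw big_nil /= => c2 c3.
  set c2' := C * _ in c2; set c3' := C * _ in c3; set c4' := D * _ in c4.
  apply: (@small_eq0 _ _ (c2' + s `^ m * c3' + c4')) => k.
  apply: le_trans (scaled_triangle (powR_ge0 s m) (c2 k) (c3 k) (c4 k)) _.
  by rewrite !mulrDl mulrA.
(* The estimate between [v] and [f k] at [k = 0], where [f 0 = u], is already the decay sought. *)
- move=> e; apply: (@symb_out_le _ _ _ _ _ _ (Num.min e e0)); first by rewrite ge_min lexx.
  move=> K cK KU l.
  have ee : Num.min e e0 <= e0 by rewrite ge_min lexx orbT.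
  have [C C0 CP] := vf l _ K ee cK KU.
  exists 1, C; split=> // x xi Kx h1.
  have xi0 : xi != 0 by rewrite -(hnorm_gt0 _ cM); exact: lt_le_trans h1.
  have Pz : punctured U (row_mx x xi) by apply: prod_set_row => //; exact: KU.
  have su' := sub_smooth (@punctured_full R n d U) su.
  rewrite (pderivsB l oP su' sv Pz) distrC.
  have := CP 0%N x xi Kx xi0; rewrite expr0 divr1.
  rewrite (eq_pderivs (f := f 0%N) (g := u) l oP _ Pz)// => z _.
  by rewrite /f /t expr0 powR1 invr1 mul1r xdil1.
Qed.

(** * Taylor expansion at t = 0 *)

Lemma taylor_step (R : realType) N (c : nat -> R) (t : R) :
  is_derive t 1 (fun t => \sum_(j < N.+1) (j`!%:R)^-1 * c j * t ^+ j)
    (\sum_(j < N) (j`!%:R)^-1 * c j.+1 * t ^+ j).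
Proof.
pose p : {poly R} := \sum_(j < N.+1) ((j`!%:R)^-1 * c j) *: 'X^j.
have pE s : \sum_(j < N.+1) (j`!%:R)^-1 * c j * s ^+ j = p.[s].
  by rewrite /p horner_sum; apply: eq_bigr => j _; rewrite hornerZ hornerXn.
have -> : (fun t => \sum_(j < N.+1) (j`!%:R)^-1 * c j * t ^+ j) = horner p.
  by apply/funext => s; exact: pE.
have -> : \sum_(j < N) (j`!%:R)^-1 * c j.+1 * t ^+ j = (p^`()).[t].
  rewrite /p raddf_sum/= horner_sum big_ord_recl/= derivZ derivXn mulr0n scaler0 horner0 add0r.
  apply: eq_bigr => j _; rewrite derivZ derivXn hornerZ hornerMn hornerXn/=.
  rewrite /bump/= add1n add0n -[X in _ = _ * X]mulr_natr factS natrM.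
  have f0 : (j`!%:R : R) != 0 by rewrite pnatr_eq0 -lt0n fact_gt0.
  have j0 : (j.+1%:R : R) != 0 by rewrite pnatr_eq0.
  by move: (j.+1%:R) (j`!%:R) j0 f0 => x y x0 y0; field; rewrite x0 y0.
apply: DeriveDef; first exact: derivable_horner.
by rewrite -derive1E -derivE.
Qed.

(** Induction on [N]: the derivative of a remainder is the remainder of the shifted family, and the
    mean value theorem from 0 over a length at most 1 keeps the bound. The usual factor [1 / N!] is
    dispensed with. *)
Lemma taylor_bound (R : realType) (B : R) N (w : nat -> R -> R) (t : R) :
  (forall j (t : R), 0 <= t <= 1 -> is_derive t 1 (w j) (w j.+1 t)) ->
  (forall t : R, 0 <= t <= 1 -> `|w N t| <= B) -> 0 <= t <= 1 ->
  `|w 0%N t - \sum_(j < N) (j`!%:R)^-1 * w j 0 * t ^+ j| <= B.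
Proof.
elim: N w t => [|N IH] w t dw wB t01; first by rewrite big_ord0 subr0; exact: wB.
pose r s := w 0%N s - \sum_(j < N.+1) (j`!%:R)^-1 * w j 0 * s ^+ j.
pose r' s := w 1%N s - \sum_(j < N) (j`!%:R)^-1 * w j.+1 0 * s ^+ j.
have dr (s : R) : 0 <= s <= 1 -> is_derive s 1 r (r' s).
  move=> s01; have d1 := dw 0%N s s01; have d2 := taylor_step N (fun j => w j 0) s.
  exact: (is_deriveB d1 d2).
have r'B (s : R) : 0 <= s <= 1 -> `|r' s| <= B.
  by move=> s01; apply: (IH (fun j => w j.+1)) => // j; exact: dw.
have r0 : r 0 = 0.
  rewrite /r big_ord_recl big1/=; last by move=> j _; rewrite expr0n/= mulr0.
  by rewrite addr0 expr0 mulr1 fact0 invr1 mul1r subrr.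
have /andP[t0 t1] := t01.
have [||c ct E] := @MVT_segment _ r r' 0 t t0.
- move=> s; rewrite in_itv/= => /andP[s0 st]; apply: dr.
  by rewrite (ltW s0) (le_trans (ltW st)).
- apply: derivable_within_continuous => s; rewrite in_itv/= => /andP[s0 st].
  have s01 : 0 <= s <= 1 by rewrite s0 (le_trans st).
  by case: (dr s s01).
move: E; rewrite r0 !subr0 -/(r t) => ->.
move: ct; rewrite in_itv/= => /andP[c0 ct].
have c01 : 0 <= c <= 1 by rewrite c0 (le_trans ct).
rewrite normrM (ger0_norm t0) (le_trans _ (r'B c c01))// ler_piMr//.
Qed.

(* [tix] is the index of the variable [t] in [R^(n + (d + 1))], [sg] embeds the
   other indices, and [emb c] is the embedding as the hyperplane [t = c]. *)
Definition tix n d : 'I_(n + (d + 1)) := rshift n (rshift d ord0).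

Definition sg n d (i : 'I_(n + d)) : 'I_(n + (d + 1)) :=
  match fintype.split i with
  | inl j => lshift (d + 1) j
  | inr j => rshift n (lshift 1 j)
  end.

Definition emb (R : realType) n d (c : R) (z : 'rV[R]_(n + d)) : 'rV[R]_(n + (d + 1)) :=
  row_mx (lsubmx z) (row_mx (rsubmx z) (const_mx c)).

Lemma emb_row (R : realType) n d (c : R) (x : 'rV[R]_n) (xi : 'rV[R]_d) :
  emb c (row_mx x xi) = row_mx x (row_mx xi (const_mx c)).
Proof. by rewrite /emb row_mxKl row_mxKr. Qed.

Lemma sg_lshift n d i : sg (lshift d i : 'I_(n + d)) = lshift (d + 1) i.
Proof. by rewrite /sg (unsplitK (inl i)). Qed.

Lemma sg_rshift n d i : sg (rshift n i : 'I_(n + d)) = rshift n (lshift 1 i).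
Proof. by rewrite /sg (unsplitK (inr i)). Qed.

Lemma ord_cases n d (P : 'I_(n + (d + 1)) -> Prop) :
  (forall i : 'I_(n + d), P (sg i)) -> P (tix n d) -> forall i, P i.
Proof.
move=> Psg Pt i; rewrite -(splitK i); case: (fintype.split i) => j /=.
  by rewrite -sg_lshift.
rewrite -(splitK j); case: (fintype.split j) => k /=; first by rewrite -sg_rshift.
by rewrite (ord1 k).
Qed.

Lemma emb_sg (R : realType) n d (c : R) (z : 'rV[R]_(n + d)) i : emb c z 0 (sg i) = z 0 i.
Proof.
rewrite -(hsubmxK z) emb_row -(splitK i); case: (fintype.split i) => j /=.
  by rewrite sg_lshift !row_mxEl.
by rewrite sg_rshift !row_mxEr row_mxEl.
Qed.

Lemma emb_tix (R : realType) n d (c : R) (z : 'rV[R]_(n + d)) : emb c z 0 (tix n d) = c.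
Proof. by rewrite /emb /tix !row_mxEr mxE. Qed.

Lemma sg_inj n d : injective (@sg n d).
Proof.
move=> i j; rewrite -(splitK i) -(splitK j).
case: (fintype.split i) => k; case: (fintype.split j) => l /=;
  rewrite ?sg_lshift ?sg_rshift.
- by move=> /lshift_inj ->.
- by move/eqP; rewrite eq_lrshift.
- by move/eqP; rewrite eq_rlshift.
- by move=> /rshift_inj /lshift_inj ->.
Qed.

Lemma sg_tix n d (i : 'I_(n + d)) : (tix n d == sg i) = false.
Proof.
rewrite -(splitK i); case: (fintype.split i) => k /=; rewrite ?sg_lshift ?sg_rshift.
  by rewrite /tix eq_rlshift.
by rewrite /tix eq_rshift eq_rlshift.
Qed.

Lemma emb_line (R : realType) n d (c h : R) (z : 'rV[R]_(n + d)) :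
  h *: delta_mx 0 (tix n d) + emb c z = emb (h + c) z.
Proof.
apply/rowP; apply: ord_cases => [i|].
  by rewrite [LHS]mxE !emb_sg !mxE eqxx eq_sym sg_tix mulr0 add0r.
by rewrite [LHS]mxE !emb_tix !mxE !eqxx mulr1.
Qed.

Lemma coord_affine_emb (R : realType) n d (c : R) :
  coord_affine (@emb R n d c) (Some \o @sg n d) (fun=> 1).
Proof.
split.
  apply: continuous_rV; apply: ord_cases => [i|].
    rewrite (_ : (fun z => _) = (fun z : 'rV[R]_(n + d) => z 0 i)).
      exact: continuous_coord.
    by apply/funext => z; rewrite emb_sg.
  rewrite (_ : (fun z => _) = (fun z : 'rV[R]_(n + d) => c)).
    exact: cst_continuous.
  by apply/funext => z; rewrite emb_tix.
move=> z h i; rewrite mulr1; apply/rowP; apply: ord_cases => [j|].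
  by rewrite emb_sg [RHS]mxE emb_sg !mxE eqxx/= (inj_eq (@sg_inj n d)).
by rewrite emb_tix [RHS]mxE emb_tix !mxE eqxx/= sg_tix mulr0 add0r.
Qed.

Lemma pderivs_emb (R : realType) n d (c : R) (A : set 'rV[R]_(n + d))
    (B : set 'rV[R]_(n + (d + 1))) f l z : open A -> (forall z, A z -> B (emb c z)) ->
  rsmooth_on B f -> A z ->
  pderivs l (f \o emb c) z = pderivs (map (@sg n d) l) f (emb c z).
Proof.
move=> oA AB sf Az.
rewrite (pderivs_affine l oA (@coord_affine_emb R n d c) AB sf Az).
by rewrite big1 ?mul1r.
Qed.

Lemma smooth_emb (R : realType) n d (c : R) (A : set 'rV[R]_(n + d))
    (B : set 'rV[R]_(n + (d + 1))) f : open A -> (forall z, A z -> B (emb c z)) ->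
  rsmooth_on B f -> rsmooth_on A (f \o emb c).
Proof. by move=> oA; exact: smooth_affine oA (@coord_affine_emb R n d c). Qed.

Lemma xw_sg n d (rho : 'I_d -> nat) (i : 'I_(n + d)) : xw (rhot rho) (sg i) = xw rho i.
Proof.
rewrite -(splitK i); case: (fintype.split i) => k /=; rewrite ?sg_lshift ?sg_rshift.
  by rewrite !xw_lshift.
by rewrite !xw_rshift /rhot (unsplitK (inl k)).
Qed.

Lemma xw_tix n d (rho : 'I_d -> nat) : xw (rhot rho) (tix n d) = 1%N.
Proof. by rewrite /tix xw_rshift /rhot (unsplitK (inr ord0)). Qed.

Lemma sw_sg n d (rho : 'I_d -> nat) (l : seq 'I_(n + d)) :
  sw (rhot rho) (map (@sg n d) l) = sw rho l.
Proof. by rewrite /sw big_map; apply: eq_bigr => i _; rewrite xw_sg. Qed.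

Lemma sw_tix n d (rho : 'I_d -> nat) k : sw (rhot rho) (nseq k (tix n d)) = k.
Proof. by rewrite /sw big_nseq iter_addn_0 xw_tix mul1n. Qed.

Lemma xdil_emb (R : realType) n d (rho : 'I_d -> nat) (s c : R) (z : 'rV[R]_(n + d)) :
  xdil (rhot rho) s (emb c z) = emb (s * c) (xdil rho s z).
Proof.
apply/rowP; apply: ord_cases => [i|].
  by rewrite xdil_coord !emb_sg xw_sg xdil_coord.
by rewrite xdil_coord !emb_tix xw_tix expr1.
Qed.

Lemma punctured_emb (R : realType) n d (U : set 'rV[R]_n) (c : R) (z : 'rV[R]_(n + d)) :
  punctured U z -> punctured U (emb c z).
Proof.
move=> [Uz z0]; split; first by rewrite /emb row_mxKl.
rewrite /= /emb row_mxKr; apply: contra_neq z0 => /(congr1 lsubmx).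
by rewrite row_mxKl linear0.
Qed.

Lemma gauge_row (R : realType) d M (rho : 'I_d -> nat) (xi : 'rV[R]_d) (c : R) :
  gauge M (rhot rho) (row_mx xi (const_mx c)) = gauge M rho xi + c ^+ (2 * M).
Proof.
rewrite /gauge big_split_ord/= big_ord1; congr (_ + _).
  by apply: eq_bigr => i _; rewrite row_mxEl /rhot (unsplitK (inl i)).
by rewrite row_mxEr mxE /rhot (unsplitK (inr ord0)) divn1.
Qed.

Lemma hnorm_row (R : realType) d M (rho : 'I_d -> nat) (xi : 'rV[R]_d) (t : R) :
  common_multiple M rho -> 0 <= t <= 1 -> 1 <= hnorm M rho xi ->
  hnorm M rho xi <= hnorm M (rhot rho) (row_mx xi (const_mx t)) <= 2 * hnorm M rho xi.
Proof.
move=> cM /andP[t0 t1] h1; have cM' := rhot_multiple cM; have [M0 _] := cM.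
have h0 := le_trans ler01 h1.
rewrite hnorm_ge// hnorm_le ?mulr_ge0// gauge_row hnormX// lerDl exprn_ge0//=.
rewrite exprMn hnormX//.
have g1 : 1 <= gauge M rho xi by rewrite -hnormX// exprn_ege1.
have tt : t ^+ (2 * M) <= 1 by rewrite exprn_ile1.
have two : 2 <= 2 ^+ (2 * M) :> R.
  by rewrite -[leLHS]expr1 ler_weXn2l ?ler1n// muln_gt0.
by move: g1 tt two; clear; nra.
Qed.

Definition taylor_coef (R : realType) n d (v : 'rV[R]_(n + (d + 1)) -> R) (j : nat)
    (z : 'rV[R]_(n + d)) : R :=
  (j`!%:R)^-1 * pderivs (nseq j (tix n d)) v (emb 0 z).

Lemma smooth_taylor_coef (R : realType) n d (U : set 'rV[R]_n)
    (v : 'rV[R]_(n + (d + 1)) -> R) j : open U -> rsmooth_on (punctured U) v ->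
  rsmooth_on (punctured U) (taylor_coef v j).
Proof.
move=> oU sv; have oP := @open_punctured R n d U oU.
apply: (smoothZ _ oP); apply: smooth_emb oP (@punctured_emb R n d U 0) _.
exact: smooth_pderivs.
Qed.

(** The hyperplane [t = 0] is invariant under dilations, and each derivative in [t], a variable of
    weight 1, lowers the degree by 1. *)
Lemma hom_taylor_coef (R : realType) n d (rho : 'I_d -> nat) (U : set 'rV[R]_n) (m : R)
    (v : 'rV[R]_(n + (d + 1)) -> R) j : open U -> rsmooth_on (punctured U) v ->
  hom_dil (rhot rho) U m v -> hom_dil rho U (m - j%:R) (taylor_coef v j).
Proof.
move=> oU sv hv s x xi s0 Ux xi0; rewrite /taylor_coef mulrCA; congr (_ * _).
have := pderivs_hom_dil (nseq j (tix n d)) oU sv hv s0 Ux.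
rewrite sw_tix !emb_row => /(_ (row_mx xi (const_mx 0))) <-; last first.
  apply: contra_neq xi0 => /(congr1 lsubmx); by rewrite row_mxKl linear0.
by rewrite -[in RHS](xdil_row (rhot rho)) -!emb_row xdil_emb mulr0 xdil_row.
Qed.

(** Taylor's formula in [t] is applied to each derivative of [v]. The segment from [t = 0] to
    [t = 1] stays away from the origin for large [xi], and there [hnorm (xi, t)] is comparable to
    [hnorm xi]. *)
Lemma taylor_symb (R : realType) n d M (rho : 'I_d -> nat) (U : set 'rV[R]_n) (m : R)
    (v : 'rV[R]_(n + (d + 1)) -> R) N : common_multiple M rho -> open U ->
  rsmooth_on (punctured U) v -> hom_dil (rhot rho) U m v ->
  symb_out M rho U (m - N%:R) (fun z => v (emb 1 z) - \sum_(j < N) taylor_coef v j z).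
Proof.
move=> cM oU sv hv K cK KU l; have cM' := rhot_multiple cM.
have oP := @open_punctured R n d U oU.
have oP1 := @open_punctured R n (d + 1) U oU.
pose l' := map (@sg n d) l.
have [B [C [C0 CP]]] := hom_symb_out cM' oU sv hv cK KU (nseq N (tix n d) ++ l').
move: CP; rewrite sw_cat sw_tix sw_sg => CP.
have [D D0 DP] := powR_comparable (m - (N + sw rho l)%:R) (ler1n _ 2 : (1 : R) <= 2).
exists (Num.max B 1), (C * D); split=> [|x xi Kx]; first exact: mulr_gt0.
rewrite ge_max => /andP[hB h1].
have h0 : 0 < hnorm M rho xi by exact: lt_le_trans h1.
have Pz : punctured U (row_mx x xi).
  by apply: prod_set_row; [exact: KU|rewrite /= -(hnorm_gt0 _ cM)].
set z := row_mx x xi in Pz *.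
(* The derivatives in [t] stand in front, so that differentiating [w j] in [t] gives [w j.+1] by
   definition. *)
pose w j t := pderivs (nseq j (tix n d) ++ l') v (emb t z).
have dw j (t : R) : is_derive t 1 (w j) (w j.+1 t).
  have sw' := smooth_pderivs (nseq j (tix n d) ++ l') sv.
  have E s : w j s = pderivs (nseq j (tix n d) ++ l') v
      (s *: delta_mx 0 (tix n d) + emb 0 z) by rewrite emb_line addr0.
  rewrite (funext E : w j = _); apply: is_derive_along.
  rewrite emb_line addr0; apply: smooth_is_derive sw' _.
  exact: punctured_emb.
have wB (t : R) : 0 <= t <= 1 -> `|w N t| <= C * D * hnorm M rho xi `^ (m - N%:R - (sw rho l)%:R).
  move=> t01; have /andP[ha hb] := hnorm_row cM t01 h1.
  rewrite /w /z emb_row; apply: le_trans (CP _ _ Kx (le_trans hB ha)) _.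
  rewrite -mulrA ler_wpM2l ?(ltW C0)// -addrA -opprD -natrD; apply: DP => //.
    exact: lt_le_trans ha.
  by rewrite (le_trans ha)// ler_peMl ?ler1n// hnorm_ge0.
have st j : rsmooth_on (punctured U) (@taylor_coef R n d v j) by exact: smooth_taylor_coef.
have se : rsmooth_on (punctured U) (v \o @emb R n d 1).
  exact: smooth_emb oP (@punctured_emb R n d U 1) sv.
have -> : pderivs l (fun z => v (emb 1 z) - \sum_(j < N) taylor_coef v j z) z =
    w 0%N 1 - \sum_(j < N) (j`!%:R)^-1 * w j 0 * 1 ^+ j.
  rewrite [LHS](pderivsB l oP se (smooth_sum (index_enum 'I_N) oP st) Pz).
  rewrite (pderivs_sum l (index_enum 'I_N) oP st Pz).
  rewrite (pderivs_emb l oP (@punctured_emb R n d U 1) sv Pz); congr (_ - _).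
  apply: eq_bigr => j _; rewrite expr1n mulr1.
  have sj := smooth_pderivs (nseq j (tix n d)) sv.
  have sj0 := smooth_emb oP (@punctured_emb R n d U 0) sj.
  rewrite [LHS](pderivsZ l _ oP sj0 Pz).
  rewrite (pderivs_emb l oP (@punctured_emb R n d U 0) sj Pz) -pderivs_cat.
  congr (_ * _); apply: pderivs_perm oP1 sv (punctured_emb 0 Pz) _.
  by rewrite perm_catC.
apply: (taylor_bound (w := w) _ wB); by rewrite ler01 lexx.
Qed.

(** * Borel summation *)

Definition xpr (R : realType) n d (z : 'rV[R]_(n + (d + 1))) : 'rV[R]_(n + d) :=
  \row_i z 0 (sg i).

Definition tscale (R : realType) n d (mu : R) (z : 'rV[R]_(n + (d + 1))) :
    'rV[R]_(n + (d + 1)) := emb (mu * z 0 (tix n d)) (xpr z).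

Lemma emb_xpr (R : realType) n d (z : 'rV[R]_(n + (d + 1))) :
  emb (z 0 (tix n d)) (xpr z) = z.
Proof.
by apply/rowP; apply: ord_cases => [i|]; rewrite ?emb_sg ?emb_tix ?mxE.
Qed.

Lemma xpr_emb (R : realType) n d (c : R) (z : 'rV[R]_(n + d)) : xpr (emb c z) = z.
Proof. by apply/rowP => i; rewrite mxE emb_sg. Qed.

Lemma continuous_xpr (R : realType) n d : continuous (@xpr R n d).
Proof.
apply: continuous_rV => i.
rewrite (_ : (fun z => _) = (fun z : 'rV[R]_(n + (d + 1)) => z 0 (sg i))).
  exact: continuous_coord.
by apply/funext => z; rewrite mxE.
Qed.

Lemma tix_pick n d : [pick j : 'I_(n + d) | sg j == tix n d] = None.
Proof. by case: pickP => // j; rewrite eq_sym sg_tix. Qed.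

Lemma sg_pick n d i : [pick j : 'I_(n + d) | sg j == sg i] = Some i.
Proof.
case: pickP => [j /eqP/sg_inj -> //|/(_ i)]; by rewrite eqxx.
Qed.

Lemma coord_affine_xpr (R : realType) n d :
  coord_affine (@xpr R n d) (fun i => [pick j | sg j == i]) (fun=> 1).
Proof.
split=> [|z h i]; first exact: continuous_xpr.
rewrite mulr1; apply/rowP => k; move: i; apply: ord_cases => [i|].
  by rewrite sg_pick !mxE !eqxx/= (inj_eq (@sg_inj n d)).
by rewrite tix_pick scaler0 add0r !mxE eq_sym sg_tix andbF mulr0 add0r.
Qed.

Lemma coord_affine_tscale (R : realType) n d (mu : R) :
  coord_affine (@tscale R n d mu) (Some \o id) (fun i => if i == tix n d then mu else 1).
Proof.
split.
  apply: continuous_rV; apply: ord_cases => [i|].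
    rewrite (_ : (fun z => _) = (fun z : 'rV[R]_(n + (d + 1)) => z 0 (sg i))).
      exact: continuous_coord.
    by apply/funext => z; rewrite emb_sg mxE.
  rewrite (_ : (fun z => _) = (fun z : 'rV[R]_(n + (d + 1)) => mu * z 0 (tix n d))).
    by move=> z; exact: (smooth_cont (smoothZ mu openT (smooth_coord _ openT)) I).
  by apply/funext => z; rewrite emb_tix.
move=> z h i; apply/rowP; apply: ord_cases => [j|].
  rewrite emb_sg [RHS]mxE emb_sg !mxE eqxx/=; congr (_ + _).
  have [<-|_] := eqVneq (sg j) i; last by rewrite !mulr0.
  by rewrite eq_sym sg_tix !mulr1.
rewrite emb_tix [RHS]mxE emb_tix !mxE eqxx/= mulrDr; congr (_ + _).
have [_|_] := eqVneq (tix n d) i; last by rewrite !mulr0.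
by rewrite !mulr1 mulrC.
Qed.

Lemma xpr_tscale (R : realType) n d mu (z : 'rV[R]_(n + (d + 1))) :
  xpr (tscale mu z) = xpr z.
Proof. exact: xpr_emb. Qed.

Lemma lsubmx_xpr (R : realType) n d (z : 'rV[R]_(n + (d + 1))) :
  lsubmx (xpr z) = lsubmx z.
Proof. by rewrite -[in RHS](emb_xpr z) /emb row_mxKl. Qed.

Lemma xpr_row (R : realType) n d x (xi : 'rV[R]_(d + 1)) :
  xpr (row_mx x xi : 'rV[R]_(n + (d + 1))) = row_mx x (lsubmx xi).
Proof.
apply/rowP => i; rewrite mxE -(splitK i); case: (fintype.split i) => j /=.
  by rewrite sg_lshift !row_mxEl.
by rewrite sg_rshift !row_mxEr -[in LHS](hsubmxK xi) row_mxEl.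
Qed.

(** There are finitely many lists of length at most [k], so one constant serves them all; it is
    built letter by letter, summing over the possible heads. *)
Lemma bound_seq (R : realType) (I : finType) (P : seq I -> R -> Prop) k :
  (forall s (c c' : R), c <= c' -> P s c -> P s c') ->
  (forall s, exists2 c, 0 < c & P s c) ->
  exists2 c, 0 < c & forall s, (size s <= k)%N -> P s c.
Proof.
elim: k P => [|k IH] P mP eP.
  by have [c c0 Pc] := eP [::]; exists c => // s; rewrite leqn0 => /nilP ->.
have [c c0 Pc] := eP [::].
have h i : exists2 c, 0 < c & forall s, (size s <= k)%N -> P (i :: s) c.
  by apply: IH => [s|s]; [exact: mP|exact: eP].
have [C CP] := choice (fun i => let: ex_intro2 c h1 h2 := h i in ex_intro (fun c => 0 < c /\
  forall s, (size s <= k)%N -> P (i :: s) c) c (conj h1 h2)).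
exists (c + \sum_i C i).
  by rewrite ltr_pwDl// sumr_ge0// => i _; have [/ltW] := CP i.
move=> [|i s] /= sk.
  by apply: mP Pc; rewrite lerDl sumr_ge0// => i _; have [/ltW] := CP i.
have [Ci0 Ci] := CP i; apply: mP (Ci s sk).
rewrite (bigD1 i)//= addrCA lerDl addr_ge0 ?(ltW c0)// sumr_ge0// => j _.
by have [/ltW] := CP j.
Qed.

(** The usual exhaustion by points of norm at most [k] whose distance to the complement is at least
    [1 / (k + 1)]. *)
Lemma compact_exhaustion (R : realType) N (P : set 'rV[R]_N) : open P ->
  exists E : nat -> set 'rV[R]_N, [/\ forall k, compact (E k), forall k, E k `<=` P,
    forall j k, (j <= k)%N -> E j `<=` E k &
    forall z, P z -> exists k B, [/\ open B, B z & B `<=` E k]].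
Proof.
move=> oP; have inv0 k : 0 < (k.+1%:R)^-1 :> R by rewrite invr_gt0.
exists (fun k => [set z | `|z| <= k%:R /\ forall w, ~ P w -> (k.+1%:R)^-1 <= `|z - w|]).
have cn w : continuous (fun z : 'rV[R]_N => `|z - w|).
  move=> z; apply: (@continuous_comp _ _ _ (fun z : 'rV[R]_N => z - w) Num.norm).
    by apply: (@continuousB _ _ _ id (cst w)); [|exact: cst_continuous].
  exact: norm_continuous.
split.
- move=> k; apply: bounded_closed_compact.
    by exists k%:R; split; [rewrite num_real|move=> M kM z [/le_trans zk _]; exact/zk/ltW].
  have -> : [set z : 'rV[R]_N | `|z| <= k%:R /\ forall w, ~ P w -> (k.+1%:R)^-1 <= `|z - w|] =
      [set z | `|z| <= k%:R] `&`
      \bigcap_(w in ~` P) [set z | (k.+1%:R)^-1 <= `|z - w|].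
    by apply/seteqP; split=> z [h1 h]; split=> // w; exact: h.
  apply: closedI.
    apply: (@closed_comp _ _ (fun z : 'rV[R]_N => `|z|) [set x | x <= k%:R]) => // z _.
    exact: norm_continuous.
  apply: closed_bigI => w _.
  by apply: (@closed_comp _ _ (fun z : 'rV[R]_N => `|z - w|) [set x | (k.+1%:R)^-1 <= x]) => // z _; exact: cn.
- move=> k z [_ h]; apply: contrapT => /h; rewrite subrr normr0 leNgt.
  by rewrite inv0.
- move=> j k jk z [zj h]; split; first by rewrite (le_trans zj)// ler_nat.
  by move=> w /h; apply: le_trans; rewrite lef_pV2 ?posrE// ler_nat.
- move=> z Pz; have /nbhs_normP[r /= r0 rP] : nbhs z P by exact: open_nbhs_nbhs.
  (* One [k] large enough for both conditions on the ball of radius [r / 2]: it exceeds [|z| + r]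
     and [2 / r]. *)
  pose k := Num.bound (`|z| + r + (r / 2)^-1).
  have kb : `|z| + r + (r / 2)^-1 < k%:R.
    by apply: archi_boundP; rewrite !addr_ge0// ?(ltW r0)// invr_ge0 ltW// divr_gt0.
  have r20 : 0 < r / 2 by rewrite divr_gt0.
  have r2i : 0 < (r / 2)^-1 by rewrite invr_gt0.
  exists k, [set w : 'rV[R]_N | `|z - w| < r / 2]; split.
  + apply: (@open_comp _ _ (fun w : 'rV[R]_N => `|z - w|) [set x | x < r / 2]); last exact: open_lt.
    move=> w _; rewrite (_ : (fun w : 'rV[R]_N => `|z - w|) = (fun w => `|w - z|)); first exact: cn.
    by apply/funext => y; rewrite distrC.
  + by rewrite /= subrr normr0.
  + move=> w /= wz; split.
      have := ler_normB z (z - w); rewrite subKr.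
      by move: wz kb r0 r2i; clear; lra.
    move=> y Py; have zy : r <= `|z - y|.
      by rewrite leNgt; apply/negP => /rP.
    have h1 : r / 2 <= `|w - y|.
      have := ler_normD (z - w) (w - y); rewrite addrA subrK.
      by move: zy wz; clear; lra.
    apply: le_trans h1; rewrite -[leRHS]invrK lef_pV2 ?posrE//.
    have : k%:R <= k.+1%:R :> R by rewrite ler_nat.
    have := normr_ge0 z.
    by move: kb r0; clear; lra.
Qed.

Definition tmonomial (R : realType) n d (k : nat) (c : R) (A : 'rV[R]_(n + d) -> R)
  (z : 'rV[R]_(n + (d + 1))) : R := c * z 0 (tix n d) ^+ k * A (xpr z).

Lemma pd_tmonomial (R : realType) n d k (c : R) (A : 'rV[R]_(n + d) -> R) :
  pd (tix n d) (tmonomial k c A) = tmonomial k.-1 (c * k%:R) A.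
Proof.
apply/funext => z; rewrite /pd derive_lineE.
have -> : (fun h : R => tmonomial k c A (h *: delta_mx 0 (tix n d) + z)) =
          (fun h => c * (h + z 0 (tix n d)) ^+ k * A (xpr z)).
  apply/funext => h; rewrite /tmonomial -{1 2}(emb_xpr z) emb_line emb_tix.
  by rewrite xpr_emb.
set t := z 0 _.
have d1 : is_derive (0 : R) 1 (fun h : R => h + t) 1.
  by apply: is_derive_eq; rewrite addr0.
have d0 : is_derive (0 + t) 1 (fun h : R => h ^+ k) (k%:R * t ^+ k.-1).
  apply: DeriveDef; first exact: exprn_derivable.
  by rewrite exp_derive /GRing.scale/= mulr1 add0r.
have d2 := @is_derive1_comp _ (fun h => h ^+ k) (fun h : R => h + t) 0 _ _
  d0 d1.
have d3 : is_derive (0 : R) 1 (fun h => c * (h + t) ^+ k * A (xpr z))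
     (c * (k%:R * t ^+ k.-1) * A (xpr z)).
  have := is_deriveM (is_deriveM (is_derive_cst c (0 : R) (1 : R)) d2) (is_derive_cst (A (xpr z)) (0 : R) (1 : R)).
  move=> d4; apply: is_derive_eq d4 _.
  rewrite /= !scaler0 !(add0r, addr0) /GRing.scale/= ?mulr1.
  by rewrite [RHS]mulrC.
have [_ ->] := d3.
by rewrite /tmonomial mulrA.
Qed.

Lemma pderivs_tmonomial (R : realType) n d i k (A : 'rV[R]_(n + d) -> R) :
  pderivs (nseq i (tix n d)) (tmonomial k 1 A) = tmonomial (k - i) (k ^_ i)%:R A.
Proof.
elim: i => [|i IH]; first by rewrite subn0 ffactn0.
rewrite [LHS]/= -/(pd _ _) -/(pderivs _ _) IH [LHS]pd_tmonomial.
by rewrite -natrM -ffactnSr subnS.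
Qed.

Definition tgauge (R : realType) n d M (rho : 'I_d -> nat) (z : 'rV[R]_(n + (d + 1))) : R :=
  gauge M rho (rsubmx (xpr z)).

(** Smaller than [punctured U] in the variables [(xi, t)]: the whole t-axis is removed, and not only
    the origin, because the coefficients are functions of [xi]. *)
Definition offaxis (R : realType) n d (U : set 'rV[R]_n) : set 'rV[R]_(n + (d + 1)) :=
  [set z | punctured U (xpr z)].

(* The cutoff [step (2 - t^(2M) / |xi|^(2M))] is [1] for [|t| <= |xi|] and [0]
   for large [t], so the derivatives are bounded uniformly in [t]. *)
Definition borel_term (R : realType) n d M (rho : 'I_d -> nat) (A : 'rV[R]_(n + d) -> R)
    (k : nat) (z : 'rV[R]_(n + (d + 1))) : R :=
  z 0 (tix n d) ^+ k * step (2 - z 0 (tix n d) ^+ (2 * M) / tgauge M rho z) * A (xpr z).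

Lemma open_lt_smooth (R : realType) N (f g : 'rV[R]_N -> R) :
  rsmooth_on setT f -> rsmooth_on setT g -> open [set z | f z < g z].
Proof.
move=> sf sg; have sD := smoothB openT sg sf.
have -> : [set z | f z < g z] = (fun z => g z - f z) @^-1` [set x | 0 < x].
  by apply/seteqP; split=> w /=; rewrite subr_gt0.
apply: (@open_comp _ _ (fun z => g z - f z) [set x | 0 < x]); last exact: open_gt.
by move=> w _; exact: smooth_cont sD I.
Qed.

Lemma smooth_tgauge (R : realType) n d M (rho : 'I_d -> nat)
    (B : set 'rV[R]_(n + (d + 1))) : open B -> rsmooth_on B (tgauge M rho).
Proof.
move=> oB.
apply: (@eq_smooth _ _ _ (fun z => \sum_(i < d) z 0 (sg (rshift n i)) ^+ (2 * (M %/ rho i))) _ oB).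
  by move=> z _; apply: eq_bigr => i _; rewrite !mxE.
by apply: (smooth_sum _ oB) => i; exact/(smoothX _ oB)/smooth_coord.
Qed.

Lemma open_offaxis (R : realType) n d (U : set 'rV[R]_n) :
  open U -> open (@offaxis R n d U).
Proof.
move=> oU; apply: open_comp (open_punctured oU) => z _; exact: continuous_xpr.
Qed.

Lemma tgauge_gt0 (R : realType) n d M (rho : 'I_d -> nat) (U : set 'rV[R]_n)
    (z : 'rV[R]_(n + (d + 1))) : common_multiple M rho ->
  offaxis U z -> 0 < tgauge M rho z.
Proof. by move=> cM [_ z0]; rewrite /tgauge gauge_gt0. Qed.

Lemma smooth_borel_term (R : realType) n d M (rho : 'I_d -> nat) (U : set 'rV[R]_n)
    (A : 'rV[R]_(n + d) -> R) k : common_multiple M rho -> open U ->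
  rsmooth_on (punctured U) A -> rsmooth_on (offaxis U) (borel_term M rho A k).
Proof.
move=> cM oU sA; have oW := @open_offaxis R n d U oU.
have sc := smooth_coord (tix n d) oW.
apply: (smoothM oW).
  apply: (smoothM oW (smoothX k oW sc)); apply: (smooth_step oW).
  apply: (smoothB oW (smooth_cst (A := offaxis U) 2)).
  apply: (smoothM oW (smoothX _ oW sc)); apply: (smoothV oW) => [z Wz|].
    by rewrite gt_eqF// (tgauge_gt0 cM Wz).
  exact: smooth_tgauge.
exact: smooth_affine oW (@coord_affine_xpr R n d) _ sA.
Qed.

Lemma borel_term_eq0 (R : realType) n d M (rho : 'I_d -> nat) (U : set 'rV[R]_n)
    (A : 'rV[R]_(n + d) -> R) k (z : 'rV[R]_(n + (d + 1))) : common_multiple M rho ->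
  offaxis U z -> 2 * tgauge M rho z <= z 0 (tix n d) ^+ (2 * M) ->
  borel_term M rho A k z = 0.
Proof.
move=> cM Wz h; rewrite /borel_term step_le0 ?mulr0 ?mul0r//.
by rewrite subr_le0 ler_pdivlMr// (tgauge_gt0 cM Wz).
Qed.

Lemma borel_term_near0 (R : realType) n d M (rho : 'I_d -> nat) (U : set 'rV[R]_n)
    (A : 'rV[R]_(n + d) -> R) k (z : 'rV[R]_(n + (d + 1))) : common_multiple M rho ->
  offaxis U z -> z 0 (tix n d) ^+ (2 * M) <= tgauge M rho z ->
  borel_term M rho A k z = tmonomial k 1 A z.
Proof.
move=> cM Wz h; rewrite /borel_term /tmonomial step_ge1 ?mulr1 ?mul1r//.
rewrite lerBrDr -lerBrDl (_ : 2 - 1 = 1); last by ring.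
by rewrite ler_pdivrMr ?mul1r// (tgauge_gt0 cM Wz).
Qed.

Lemma borel_term_bounded (R : realType) n d M (rho : 'I_d -> nat) (U : set 'rV[R]_n)
    (A : 'rV[R]_(n + d) -> R) k s (K : set 'rV[R]_(n + d)) :
  common_multiple M rho -> open U -> rsmooth_on (punctured U) A ->
  compact K -> K `<=` punctured U ->
  exists2 C : R, 0 < C & forall z, K (xpr z) -> `|pderivs s (borel_term M rho A k) z| <= C.
Proof.
move=> cM oU sA cK KP; have oW := @open_offaxis R n d U oU; have [M0 _] := cM.
have sT := smooth_borel_term k cM oU sA.
have [Q Q0 QP] : exists2 Q : R, 0 < Q & forall w, K w -> `|gauge M rho (rsubmx w)| <= Q.
  apply: compact_le_bound cK _ => w _; apply: continuous_comp; first exact: continuous_rsubmx.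
  exact: continuous_gauge.
(* If [|t| > b], then [t^(2M) >= |t| > 2 Q], the first inequality because [b >= 1]; the term
   vanishes there, and the rest of the region is compact. *)
pose b := 2 * Q + 1.
have b1 : 1 <= b by rewrite lerDr mulr_ge0// ltW.
have b0 : 0 <= b := le_trans ler01 b1.
pose L := [set z : 'rV[R]_(n + (d + 1)) | K (xpr z) /\ `|z 0 (tix n d)| <= b].
have cL : compact L.
  apply: bounded_closed_compact.
    have [B [_ BP]] := compact_bounded cK.
    exists (`|B| + 1 + b); split; first by rewrite num_real.
    move=> C BC z [Kz zb]; apply: le_trans (ltW BC).
    apply: rV_norm_le; first by apply: addr_ge0 => //; exact: addr_ge0.
    apply: ord_cases => [i|]; last by rewrite (le_trans zb)// lerDr addr_ge0.
    have : `|xpr z 0 i| <= `|B| + 1.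
      apply: le_trans (rV_coord_le _ _) _; apply: BP Kz.
      by rewrite (le_lt_trans (ler_norm _))// ltrDl.
    by rewrite mxE => /le_trans; apply; rewrite lerDl.
  rewrite (_ : L = (@xpr R n d @^-1` K) `&` [set z | `|z 0 (tix n d)| <= b])//.
  apply: closedI.
    apply: closed_comp (compact_closed _ cK); last exact: norm_hausdorff.
    by move=> z _; exact: continuous_xpr.
  apply: (@closed_comp _ _ (fun z : 'rV[R]_(n + (d + 1)) => `|z 0 (tix n d)|) [set x | x <= b]) => // z _.
  apply: (@continuous_comp _ _ _ (fun z : 'rV[R]_(n + (d + 1)) => z 0 (tix n d)) Num.norm).
    exact: continuous_coord.
  exact: norm_continuous.
have [C C0 CP] : exists2 C : R, 0 < C & forall z, L z ->
    `|pderivs s (borel_term M rho A k) z| <= C.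
  apply: compact_le_bound cL _ => z [Kz _].
  exact: smooth_cont (smooth_pderivs s sT) (KP _ Kz).
exists C => // z Kz; have [zb|zb] := leP `|z 0 (tix n d)| b; first exact: CP.
have Wz : offaxis U z by exact: KP.
have oV : open (offaxis U `&` [set z | 2 * tgauge M rho z < z 0 (tix n d) ^+ (2 * M)]).
  apply: openI => //; apply: open_lt_smooth.
    exact/(smoothZ _ openT)/smooth_tgauge/openT.
  exact/(smoothX _ openT)/smooth_coord/openT.
rewrite (eq_pderivs (g := fun=> 0) s oV).
- by rewrite pderivs0 normr0 ltW.
- by move=> w [Ww /= wt]; apply: (borel_term_eq0 A k cM Ww); exact: ltW.
- split=> //=; have zQ := QP _ Kz; rewrite ger0_norm ?gauge_ge0// in zQ.
  apply: (@le_lt_trans _ _ b).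
    by apply: le_trans (ler_wpM2l _ zQ) _; rewrite ?ler0n// /b lerDl.
  apply: (lt_le_trans zb); rewrite exprM -(real_normK (num_real (z 0 _))) -exprM.
  rewrite -[leLHS]expr1 ler_weXn2l ?muln_gt0//.
  by rewrite (le_trans b1)// ltW.
Qed.

(* This is [t^k A(x, xi) phi(mu t / |xi|)]. As a rescaling of a fixed function it
   has derivatives of order [N] bounded by [mu^(N - k)], uniformly in [t]. *)
Definition borel_summand (R : realType) n d M (rho : 'I_d -> nat) (A : 'rV[R]_(n + d) -> R)
    (k : nat) (mu : R) (z : 'rV[R]_(n + (d + 1))) : R :=
  mu ^- k * borel_term M rho A k (tscale mu z).

Lemma tgauge_tscale (R : realType) n d M (rho : 'I_d -> nat) mu
    (z : 'rV[R]_(n + (d + 1))) : tgauge M rho (tscale mu z) = tgauge M rho z.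
Proof. by rewrite /tgauge xpr_tscale. Qed.

Lemma offaxis_tscale (R : realType) n d (U : set 'rV[R]_n) mu (z : 'rV[R]_(n + (d + 1))) :
  offaxis U z -> offaxis U (tscale mu z).
Proof. by rewrite /offaxis/= xpr_tscale. Qed.

Lemma smooth_borel_summand (R : realType) n d M (rho : 'I_d -> nat) (U : set 'rV[R]_n)
    (A : 'rV[R]_(n + d) -> R) k mu : common_multiple M rho -> open U ->
  rsmooth_on (punctured U) A -> rsmooth_on (offaxis U) (borel_summand M rho A k mu).
Proof.
move=> cM oU sA; have oW := @open_offaxis R n d U oU.
apply: (smoothZ _ oW); apply: smooth_affine oW (@coord_affine_tscale R n d mu) _
  (smooth_borel_term k cM oU sA) => z; exact: offaxis_tscale.
Qed.

(** By the chain rule each derivative in [t] brings a factor [mu] and every other one a factor 1, at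
    most [mu^N] in all because [mu >= 1]. *)
Lemma borel_summand_bounded (R : realType) n d M (rho : 'I_d -> nat) (U : set 'rV[R]_n)
    (A : 'rV[R]_(n + d) -> R) k (K : set 'rV[R]_(n + d)) N :
  common_multiple M rho -> open U -> rsmooth_on (punctured U) A ->
  compact K -> K `<=` punctured U ->
  exists2 C : R, 0 < C & forall s, (size s <= N)%N -> forall mu, 1 <= mu ->
    forall z, K (xpr z) ->
    `|pderivs s (borel_summand M rho A k mu) z| <= mu ^- k * (mu ^+ N * C).
Proof.
move=> cM oU sA cK KP; have oW := @open_offaxis R n d U oU.
have [C C0 CP] := @bound_seq R 'I_(n + (d + 1)) (fun s C => forall z, K (xpr z) ->
  `|pderivs s (borel_term M rho A k) z| <= C) N
  (fun s c c' cc' h z Kz => le_trans (h z Kz) cc')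
  (fun s => borel_term_bounded k s cM oU sA cK KP).
exists C => // s sN mu mu1 z Kz; have Wz : offaxis U z by exact: KP.
have mu0 : 0 < mu by exact: lt_le_trans mu1.
have sT := smooth_borel_term k cM oU sA.
have WW w : offaxis U w -> offaxis U (@tscale R n d mu w) by exact: offaxis_tscale.
have sTt := smooth_affine oW (@coord_affine_tscale R n d mu) WW sT.
rewrite (pderivsZ s _ oW sTt Wz).
rewrite (pderivs_affine s oW (@coord_affine_tscale R n d mu) WW sT Wz) map_id.
rewrite !normrM ger0_norm ?invr_ge0 ?exprn_ge0 ?(ltW mu0)//.
rewrite ler_wpM2l ?invr_ge0 ?exprn_ge0 ?(ltW mu0)//.
apply: ler_pM => //; last by apply: (CP _ sN); rewrite xpr_tscale.
apply: (@le_trans _ _ (mu ^+ size s)); last by rewrite ler_weXn2l.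
elim: s {sN} => [|i s IH]; first by rewrite big_nil normr1.
rewrite big_cons normrM exprS ler_pM//.
by case: ifP => _; rewrite ger0_norm// ltW.
Qed.

Lemma xpr_xdil (R : realType) n d (rho : 'I_d -> nat) (s : R) (z : 'rV[R]_(n + (d + 1))) :
  xpr (xdil (rhot rho) s z) = xdil rho s (xpr z).
Proof. by rewrite -[in LHS](emb_xpr z) xdil_emb xpr_emb. Qed.

Lemma tix_xdil (R : realType) n d (rho : 'I_d -> nat) (s : R) (z : 'rV[R]_(n + (d + 1))) :
  xdil (rhot rho) s z 0 (tix n d) = s * z 0 (tix n d).
Proof. by rewrite xdil_coord xw_tix expr1. Qed.

Lemma tgauge_xdil (R : realType) n d M (rho : 'I_d -> nat) (s : R)
    (z : 'rV[R]_(n + (d + 1))) : common_multiple M rho ->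
  tgauge M rho (xdil (rhot rho) s z) = s ^+ (2 * M) * tgauge M rho z.
Proof. by move=> cM; rewrite /tgauge xpr_xdil /xdil row_mxKr gauge_dil. Qed.

(** The argument of the cutoff is a quotient of two quantities of degree [2 M], hence invariant; the
    factor [t^k] restores the degree [k] that [A] lacks. *)
Lemma borel_summand_xdil (R : realType) n d M (rho : 'I_d -> nat) (U : set 'rV[R]_n) m
    (A : 'rV[R]_(n + d) -> R) k mu s (z : 'rV[R]_(n + (d + 1))) :
  common_multiple M rho -> hom_dil rho U (m - k%:R) A -> 0 < s -> offaxis U z ->
  borel_summand M rho A k mu (xdil (rhot rho) s z) = s `^ m * borel_summand M rho A k mu z.
Proof.
move=> cM hA s0 [Uz z0]; rewrite /borel_summand /borel_term !tgauge_tscale !xpr_tscale.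
rewrite /tscale !emb_tix tix_xdil tgauge_xdil// xpr_xdil.
have -> : A (xdil rho s (xpr z)) = s `^ (m - k%:R) * A (xpr z).
  by rewrite -[in RHS](hsubmxK (xpr z)) -hA.
have sM : s ^+ (2 * M) != 0 by rewrite expf_neq0// gt_eqF.
rewrite (mulrCA mu s) [(s * (mu * _)) ^+ (2 * M)]exprMn -mulf_div divff// mul1r.
rewrite [(s * (mu * _)) ^+ k]exprMn.
have -> : s `^ m = s ^+ k * s `^ (m - k%:R).
  rewrite -powR_mulrn ?(ltW s0)// -powRD; last by apply/implyP => _; rewrite gt_eqF.
  by rewrite addrC subrK.
by move: (step _) (mu ^- k) (A _) (s `^ _) (_ ^+ k) (_ ^+ k) => *; ring.
Qed.

(** Near [t = 0] the cutoff is 1 and the powers of [mu] cancel, so the summand is exactly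
    [t^k A]. *)
Lemma borel_summand_taylor (R : realType) n d M (rho : 'I_d -> nat) (U : set 'rV[R]_n)
    (A : 'rV[R]_(n + d) -> R) k mu i (z : 'rV[R]_(n + d)) :
  common_multiple M rho -> open U -> 0 < mu -> punctured U z ->
  pderivs (nseq i (tix n d)) (borel_summand M rho A k mu) (emb 0 z) =
  if k == i then i`!%:R * A z else 0.
Proof.
move=> cM oU mu0 Pz; have oW := @open_offaxis R n d U oU; have [M0 _] := cM.
have Wz : offaxis U (emb 0 z) by rewrite /offaxis/= xpr_emb.
have oV : open (offaxis U `&`
    [set w : 'rV[R]_(n + (d + 1)) | (mu * w 0 (tix n d)) ^+ (2 * M) < tgauge M rho w]).
  apply: openI => //; apply: open_lt_smooth.
    exact/(smoothX _ openT)/(smoothZ _ openT)/smooth_coord/openT.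
  exact/smooth_tgauge/openT.
rewrite (eq_pderivs (g := tmonomial k 1 A) _ oV).
- rewrite pderivs_tmonomial /tmonomial emb_tix xpr_emb.
  have [->|ki] := eqVneq k i; first by rewrite subnn expr0 mulr1 ffactnn.
  have [lt|gt|eq] := ltngtP k i; last by rewrite eq eqxx in ki.
    by rewrite ffact_small// !mul0r.
  by rewrite expr0n subn_eq0 leqNgt gt mulr0 mul0r.
- move=> w [Ww /= hw]; rewrite /borel_summand (borel_term_near0 (U := U))//.
  + rewrite /tmonomial /tscale emb_tix xpr_emb !mul1r exprMn mulrA mulrA mulVf ?mul1r//.
    by rewrite expf_neq0// gt_eqF.
  + exact: offaxis_tscale.
  + by rewrite tgauge_tscale /tscale emb_tix ltW.
- split=> //=; rewrite emb_tix mulr0 expr0n muln_eq0/= eqn0Ngt M0/=.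
  exact: (tgauge_gt0 cM Wz).
Qed.

Lemma borel_summand_xpr0 (R : realType) n d M (rho : 'I_d -> nat) (U : set 'rV[R]_n)
    (A : 'rV[R]_(n + d) -> R) k mu (z : 'rV[R]_(n + (d + 1))) :
  common_multiple M rho -> 1 <= mu -> offaxis U z ->
  2 * tgauge M rho z <= z 0 (tix n d) ^+ (2 * M) -> borel_summand M rho A k mu z = 0.
Proof.
move=> cM mu1 Wz h; rewrite /borel_summand (borel_term_eq0 (U := U))// ?mulr0//.
  exact: offaxis_tscale.
rewrite tgauge_tscale /tscale emb_tix (le_trans h)// exprMn ler_peMl//.
  exact: even_pow_ge0.
exact: exprn_ege1.
Qed.

Lemma expf_ratio (R : realType) (x c : R) k : (0 < k)%N -> x != 0 ->
  x ^- k * (x ^+ k.-1 * c) = c / x.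
Proof.
case: k => // k _ x0 /=; rewrite exprS.
by have xk := expf_neq0 k x0; field; rewrite x0 xk.
Qed.

(** On [E k] the [k]-th summand and its derivatives of order below [k] are at most [C k / mu k], so
    [mu k = 1 + C k * 2^k] brings them below [2^-k]. For a given order and point only finitely many
    summands escape; they enter the constant. *)
Lemma borel_series (R : realType) n d M (rho : 'I_d -> nat) (U : set 'rV[R]_n)
    (a : nat -> 'rV[R]_(n + d) -> R) :
  common_multiple M rho -> open U -> (forall j, rsmooth_on (punctured U) (a j)) ->
  exists mu : nat -> R, (forall k, 1 <= mu k) /\
    forall s z, offaxis U z -> exists B C, [/\ open B, B z, B `<=` offaxis U &
      forall k w, B w ->
        `|pderivs s (borel_summand M rho (a k) k (mu k)) w| <= C / 2 ^+ k].
Proof.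
move=> cM oU sa; have oP := @open_punctured R n d U oU.
have [E [cE EP Emono Eloc]] := compact_exhaustion oP.
(* Orders up to [k - 1] against the prefactor [mu^-k] leave one spare factor [1 / mu]. *)
have hC k := borel_summand_bounded k k.-1 cM oU (sa k) (cE k) (@EP k).
have [C CP] := choice (fun k => let: ex_intro2 c h1 h2 := hC k in
  ex_intro (fun c => 0 < c /\ forall s, (size s <= k.-1)%N -> forall mu, 1 <= mu ->
    forall z, E k (xpr z) -> `|pderivs s (borel_summand M rho (a k) k mu) z| <=
      mu ^- k * (mu ^+ k.-1 * c)) c (conj h1 h2)).
pose mu k := 1 + C k * 2 ^+ k.
have C0 k : 0 < C k by case: (CP k).
have mu1 k : 1 <= mu k by rewrite lerDl mulr_ge0 ?(ltW (C0 k))// exprn_ge0.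
have mu0 k : 0 < mu k := lt_le_trans ltr01 (mu1 k).
have tail k s w : (size s < k)%N -> E k (xpr w) ->
    `|pderivs s (borel_summand M rho (a k) k (mu k)) w| <= 1 / 2 ^+ k.
  move=> sk Ew; have k0 : (0 < k)%N by exact: leq_ltn_trans sk.
  have [_ /(_ s _ (mu k) (mu1 k) w Ew)] := CP k.
  rewrite -ltnS prednK// => /(_ sk) /le_trans; apply.
  rewrite expf_ratio ?gt_eqF//.
  rewrite ler_pdivlMr ?exprn_gt0// mulrAC ler_pdivrMr// mul1r.
  by rewrite /mu lerDr.
exists mu; split=> // s z Wz; have [k0 [B0 [oB0 B0z B0E]]] := Eloc _ Wz.
pose K0 := maxn k0 (size s).+1.
have hD k := borel_summand_bounded k (size s) cM oU (sa k) (cE k0) (@EP k0).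
have [D DP] := choice (fun k => let: ex_intro2 c h1 h2 := hD k in
  ex_intro (fun c => 0 < c /\ forall s', (size s' <= size s)%N -> forall mu, 1 <= mu ->
    forall z, E k0 (xpr z) -> `|pderivs s' (borel_summand M rho (a k) k mu) z| <=
      mu ^- k * (mu ^+ size s * c)) c (conj h1 h2)).
pose F k := mu k ^- k * (mu k ^+ size s * D k) * 2 ^+ k.
have F0 k : 0 <= F k.
  rewrite /F !mulr_ge0 ?invr_ge0 ?exprn_ge0 ?(ltW (mu0 k))//.
  by have [/ltW] := DP k.
exists (@xpr R n d @^-1` B0), (1 + \sum_(k < K0) F k); split=> //.
- by apply: open_comp oB0 => w _; exact: continuous_xpr.
- by move=> w /B0E /EP.
- move=> k w /B0E Ew; have [kK|kK] := ltnP k K0.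
    rewrite ler_pdivlMr ?exprn_gt0// (@le_trans _ _ (F k))//.
      rewrite /F ler_wpM2r ?exprn_ge0//.
      by have [_ /(_ s (leqnn _) (mu k) (mu1 k) w Ew)] := DP k.
    rewrite (bigD1 (Ordinal kK))//= addrCA lerDl; apply: addr_ge0 => //.
    by apply: sumr_ge0 => j _; exact: F0.
  have [k0k sk] : (k0 <= k)%N /\ (size s < k)%N.
    by move: kK; rewrite geq_max => /andP[].
  apply: le_trans (tail k s w sk (Emono _ _ k0k _ Ew)) _.
  rewrite ler_wpM2r ?invr_ge0 ?exprn_ge0// lerDl.
  by apply: sumr_ge0 => j _; exact: F0.
Qed.

Lemma borel_sum (R : realType) n d M (rho : 'I_d -> nat) (U : set 'rV[R]_n) m
    (a : nat -> 'rV[R]_(n + d) -> R) :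
  common_multiple M rho -> open U -> (forall j, rsmooth_on (punctured U) (a j)) ->
  (forall j, hom_dil rho U (m - j%:R) (a j)) ->
  exists b, [/\ rsmooth_on (punctured U) b, hom_dil (rhot rho) U m b &
    forall j z, punctured U z -> taylor_coef b j z = a j z].
Proof.
move=> cM oU sa ha; have [M0 _] := cM.
have [mu [mu1 muP]] := borel_series cM oU sa.
have mu0 k : 0 < mu k := lt_le_trans ltr01 (mu1 k).
have oW := @open_offaxis R n d U oU.
pose T k := borel_summand M rho (a k) k (mu k).
pose f k (z : 'rV[R]_(n + (d + 1))) := \sum_(0 <= j < k) T j z.
have sT k : rsmooth_on (offaxis U) (T k) := smooth_borel_summand k (mu k) cM oU (sa k).
have sf k : rsmooth_on (offaxis U) (f k) := smooth_sum (index_iota 0 k) oW sT.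
have fS k s z : offaxis U z ->
    pderivs s (f k.+1) z - pderivs s (f k) z = pderivs s (T k) z.
  move=> Wz; rewrite -(pderivsB s oW (sf k.+1) (sf k) Wz).
  by apply: eq_pderivs oW _ Wz => w _; rewrite /f big_nat_recr//= addrAC subrr add0r.
have [g sg gP] : exists2 g, rsmooth_on (offaxis U) g & forall s z C, offaxis U z ->
    (forall k, `|pderivs s (f k.+1) z - pderivs s (f k) z| <= C / 2 ^+ k) ->
    forall k, `|pderivs s g z - pderivs s (f k) z| <= 2 * C / 2 ^+ k.
  apply: (smooth_geo_limit oW sf) => s z Wz.
  have [B [C [oB Bz BW BC]]] := muP s z Wz; exists B, C; split=> // k w Bw.
  by rewrite (fS k s w (BW _ Bw)); exact: BC.
have gC s z : offaxis U z ->
    exists C, forall k, `|pderivs s g z - pderivs s (f k) z| <= C / 2 ^+ k.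
  move=> Wz; have [B [C [oB Bz BW BC]]] := muP s z Wz; exists (2 * C).
  by apply: (gP s z C Wz) => k; rewrite (fS k s z Wz); exact: BC.
(* The limit [g] is controlled off the t-axis only; on the axis the value 0 is the one that extends
   it smoothly. *)
pose b z := if rsubmx (xpr z) != 0 then g z else 0.
have bW z : offaxis U z -> g z = b z by move=> [_ /= z0]; rewrite /b z0.
have sbW : rsmooth_on (offaxis U) b by exact: eq_smooth oW bW sg.
exists b; split.
- apply: smooth_local => z [Uz zne]; have [z0|z0] := eqVneq (rsubmx (xpr z)) 0; last first.
    exists (offaxis U); split=> //; split=> //=; by rewrite lsubmx_xpr.
  (* A neighbourhood of a point of the axis with [t <> 0], on which every cutoff, being at least as
     narrow as the one for [mu = 1], vanishes; so does the limit. *)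
  pose V := prod_set U setT `&` [set z : 'rV[R]_(n + (d + 1)) |
     2 * tgauge M rho z < z 0 (tix n d) ^+ (2 * M)].
  have oV : open V.
    apply: openI; first exact: open_full.
    apply: open_lt_smooth; first exact/(smoothZ _ openT)/smooth_tgauge/openT.
    exact/(smoothX _ openT)/smooth_coord/openT.
  exists V; split.
    split; first by split.
    have t0 : z 0 (tix n d) != 0.
      apply: contra_neq zne => t0; rewrite -(emb_xpr z) t0 /emb row_mxKr z0.
      by apply/rowP => i; rewrite mxE; case: fintype.splitP => j _; rewrite !mxE.
    rewrite /= /tgauge z0 (_ : gauge _ _ _ = 0); last by apply/eqP; rewrite gauge_eq0.
    by rewrite mulr0 lt_neqAle eq_sym expf_neq0//= even_pow_ge0.
  apply: (@eq_smooth _ _ _ (fun=> 0) _ oV); last exact: smooth_cst.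
  move=> w [[Uw _] /= hw]; rewrite /b; case: ifPn => // w0.
  have Ww : offaxis U w by split=> //; rewrite lsubmx_xpr.
  have [C CP] := gC [::] w Ww; apply/esym; apply: (@small_eq0 _ _ C) => k.
  apply: le_trans (CP k); rewrite /= /f big1 ?subr0// => j _.
  by apply: (borel_summand_xpr0 _ _ cM (mu1 j) Ww); exact: ltW.
- move=> s x xi s0 Ux xi0; rewrite -xdil_row; set z := row_mx x xi.
  have Uz : U (lsubmx (xpr z)) by rewrite lsubmx_xpr /z row_mxKl.
  have [z0|z0] := eqVneq (rsubmx (xpr z)) 0.
    rewrite /b z0 eqxx mulr0 ifF// xpr_xdil /xdil row_mxKr z0.
    by apply/negbTE; rewrite negbK; apply/eqP/rowP => i; rewrite !mxE mulr0.
  have Wz : offaxis U z by [].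
  have Wsz : offaxis U (xdil (rhot rho) s z).
    by rewrite /offaxis/= xpr_xdil; exact: punctured_xdil.
  rewrite -!bW//; have [C CP] := gC [::] z Wz; have [C' CP'] := gC [::] _ Wsz.
  apply/eqP; rewrite -subr_eq0; apply/eqP.
  apply: (@small_eq0 _ _ (C' + s `^ m * C + 0)) => k.
  have fE : `|f k (xdil (rhot rho) s z) - s `^ m * f k z| <= 0 / 2 ^+ k.
    rewrite mul0r /f mulr_sumr -sumrB big1 ?normr0// => j _.
    by rewrite /T (borel_summand_xdil _ cM (ha j) s0 Wz) subrr.
  apply: le_trans (scaled_triangle (powR_ge0 s m) (CP' k) (CP k) fE) _.
  by rewrite !mulrDl mulrA.
- move=> i z Pz; have Wz : offaxis U (emb 0 z) by rewrite /offaxis/= xpr_emb.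
  rewrite /taylor_coef (eq_pderivs (g := g) _ oW _ Wz); last by move=> w /bW.
  suff -> : pderivs (nseq i (tix n d)) g (emb 0 z) = i`!%:R * a i z.
    by rewrite mulrA mulVf ?mul1r// pnatr_eq0 -lt0n fact_gt0.
  (* From [k = i + 1] on the partial sums have the exact [i]-th coefficient, so the limit inherits
     it; the index [k + i.+1] below stays in that range. *)
  have fi k : (i < k)%N -> pderivs (nseq i (tix n d)) (f k) (emb 0 z) = i`!%:R * a i z.
    move=> ik; rewrite (pderivs_sum _ (index_iota 0 k) oW sT Wz).
    rewrite (bigD1_seq i) ?mem_index_iota ?iota_uniq//= /T.
    rewrite (borel_summand_taylor (U := U))// eqxx big1 ?addr0// => j ji.
    by rewrite (borel_summand_taylor (U := U))// (negbTE ji).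
  have [C CP] := gC (nseq i (tix n d)) _ Wz.
  have C0 : 0 <= C by have := CP 0%N; rewrite expr0 divr1; exact: le_trans.
  apply/eqP; rewrite -subr_eq0; apply/eqP; apply: (@small_eq0 _ _ C) => k.
  have := CP (k + i.+1)%N; rewrite fi ?ltn_addl// => /le_trans; apply.
  rewrite ler_wpM2l// lef_pV2 ?posrE ?exprn_gt0//.
  by rewrite ler_weXn2l ?ler1n// leq_addr.
Qed.

(** * The equivalence *)

(** A Leibniz rule for bounds. Peeling off the innermost derivative replaces the product by two
    products of the same kind, so no binomial formula is needed; the weights must not depend on the
    list. *)
Lemma pderivsM_bounded (R : realType) N (A Z : set 'rV[R]_N) (f g w1 w2 : 'rV[R]_N -> R) :
  open A -> Z `<=` A -> rsmooth_on A f -> rsmooth_on A g ->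
  (forall s, exists2 C : R, 0 < C & forall z, Z z -> `|pderivs s f z| <= C * w1 z) ->
  (forall s, exists2 C : R, 0 < C & forall z, Z z -> `|pderivs s g z| <= C * w2 z) ->
  forall s, exists2 C : R, 0 < C & forall z, Z z ->
    `|pderivs s (fun z => f z * g z) z| <= C * (w1 z * w2 z).
Proof.
move=> oA ZA sf sg hf hg s; move: f g sf sg hf hg.
elim/last_ind: s => [|s i IH] f g sf sg hf hg.
  have [[C C0 CP] [D D0 DP]] := (hf [::], hg [::]).
  exists (C * D) => [|z Zz]; first exact: mulr_gt0.
  by rewrite /= normrM mulrACA ler_pM// ?CP ?DP.
have sfi := smooth_pd i sf; have sgi := smooth_pd i sg.
have hfi t : exists2 C : R, 0 < C & forall z, Z z -> `|pderivs t (pd i f) z| <= C * w1 z.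
  by have := hf (rcons t i); rewrite pderivs_rcons.
have hgi t : exists2 C : R, 0 < C & forall z, Z z -> `|pderivs t (pd i g) z| <= C * w2 z.
  by have := hg (rcons t i); rewrite pderivs_rcons.
have [C C0 CP] := IH f (pd i g) sf sgi hf hgi.
have [D D0 DP] := IH (pd i f) g sfi sg hfi hg.
exists (C + D) => [|z Zz]; first exact: addr_gt0.
have Az := ZA _ Zz; rewrite pderivs_rcons.
rewrite (eq_pderivs (g := fun z => f z * pd i g z + pd i f z * g z) s oA _ Az); last first.
  by move=> w Aw; rewrite (pdM i sf sg Aw) [g w * _]mulrC.
rewrite (pderivsD s oA (smoothM oA sf sgi) (smoothM oA sfi sg) Az).
by rewrite (le_trans (ler_normD _ _))// mulrDl lerD ?CP ?DP.
Qed.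

(* Functions of [t] alone factor through [tline], whose image of a set with
   bounded [t] is relatively compact. *)
Definition tline (R : realType) n d (z : 'rV[R]_(n + (d + 1))) : 'rV[R]_(n + (d + 1)) :=
  emb (z 0 (tix n d)) 0.

Lemma coord_affine_tline (R : realType) n d :
  coord_affine (@tline R n d) (Some \o id) (fun i => (i == tix n d)%:R).
Proof.
split.
  apply: continuous_rV; apply: ord_cases => [i|].
    rewrite (_ : (fun z => _) = (fun z : 'rV[R]_(n + (d + 1)) => 0)).
      exact: cst_continuous.
    by apply/funext => z; rewrite emb_sg mxE.
  rewrite (_ : (fun z => _) = (fun z : 'rV[R]_(n + (d + 1)) => z 0 (tix n d))).
    exact: continuous_coord.
  by apply/funext => z; rewrite emb_tix.
move=> z h i; apply/rowP; apply: ord_cases => [j|].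
  rewrite emb_sg [RHS]mxE emb_sg !mxE eqxx/= addr0.
  have [<-|_] := eqVneq (sg j) i; last by rewrite mulr0.
  by rewrite eq_sym sg_tix mulr0 mul0r.
rewrite emb_tix [RHS]mxE emb_tix !mxE eqxx/=; congr (_ + _).
by have [_|_] := eqVneq (tix n d) i; rewrite ?mulr1 ?mulr0.
Qed.

(** The function is its own composite with [tline], whose image meets [|t| <= b] in a compact set;
    for larger [|t|] it vanishes on an open set. *)
Lemma tline_bounded (R : realType) n d (eta : R -> R) (b : R) :
  rsmooth_on setT (fun z : 'rV[R]_(n + (d + 1)) => eta (z 0 (tix n d))) ->
  (forall t, b <= `|t| -> eta t = 0) ->
  forall s, exists2 C : R, 0 < C & forall z : 'rV[R]_(n + (d + 1)),
    `|pderivs s (fun z => eta (z 0 (tix n d))) z| <= C * (`|z 0 (tix n d)| <= b)%R%:R.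
Proof.
move=> se eta0 s; set h := fun z : 'rV[R]_(n + (d + 1)) => eta (z 0 (tix n d)).
have cL : compact [set z : 'rV[R]_(n + (d + 1)) | tline z = z /\ `|z 0 (tix n d)| <= b].
  apply: bounded_closed_compact.
    exists `|b|; split; first by rewrite num_real.
    move=> C bC z [zl zb]; apply: le_trans (ltW bC); apply: rV_norm_le => //.
    apply: ord_cases => [i|]; last by rewrite (le_trans zb)// ler_norm.
    by rewrite -zl /tline emb_sg mxE normr0.
  have -> : [set z : 'rV[R]_(n + (d + 1)) | tline z = z /\ `|z 0 (tix n d)| <= b] =
     (fun z => tline z - z) @^-1` [set 0] `&` [set z | `|z 0 (tix n d)| <= b].
    by apply/seteqP; split=> z /= [h1 h2]; split=> //;
      [rewrite h1 subrr|apply/eqP; rewrite -subr_eq0 h1].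
  apply: closedI.
    apply: (@closed_comp _ _ (fun z : 'rV[R]_(n + (d + 1)) => tline z - z) [set 0]).
      move=> z _; apply: (@continuousB _ _ _ (@tline R n d) id); last by [].
      exact: (coord_affine_tline R n d).1.
    exact/accessible_closed_set1/hausdorff_accessible/norm_hausdorff.
  apply: (@closed_comp _ _ (fun z : 'rV[R]_(n + (d + 1)) => `|z 0 (tix n d)|) [set x | x <= b]) => // z _.
  apply: (@continuous_comp _ _ _ (fun z : 'rV[R]_(n + (d + 1)) => z 0 (tix n d)) Num.norm).
    exact: continuous_coord.
  exact: norm_continuous.
have [C C0 CP] := compact_le_bound cL
  (fun z _ => smooth_cont (smooth_pderivs s se) (I : [set: 'rV[R]_(n + (d + 1))] z)).
exists C => // z; have [zb|zb] := leP `|z 0 (tix n d)| b; last first.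
  rewrite mulr0 (@eq_pderivs _ _ [set z : 'rV[R]_(n + (d + 1)) | b < `|z 0 (tix n d)|] s _ (fun=> 0)).
  - by rewrite pderivs0 normr0.
  - apply: (@open_comp _ _ (fun z : 'rV[R]_(n + (d + 1)) => `|z 0 (tix n d)|) [set x | b < x]);
      last exact: open_gt.
    move=> w _.
    apply: (@continuous_comp _ _ _ (fun z : 'rV[R]_(n + (d + 1)) => z 0 (tix n d)) Num.norm).
      exact: continuous_coord.
    exact: norm_continuous.
  - by move=> w /= /ltW /eta0.
  - exact: zb.
rewrite mulr1 (eq_pderivs (g := h \o @tline R n d) s openT)//; last first.
  by move=> w _; rewrite /h /= /tline emb_tix.
rewrite (pderivs_affine s openT (coord_affine_tline R n d) (fun _ _ => I) se I) map_id.
rewrite normrM -[leRHS]mul1r ler_pM//.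
  elim: (s) => [|i l IH]; first by rewrite big_nil normr1.
  by rewrite big_cons normrM mulr_ile1//; case: eqP; rewrite ?normr1 ?normr0.
by apply: CP; rewrite /= /tline emb_tix.
Qed.

Lemma exprD_ge (R : realType) (x y : R) k : (0 < k)%N -> 0 <= x -> 0 <= y ->
  x ^+ k + y ^+ k <= (x + y) ^+ k.
Proof.
case: k => // k _ x0 y0; rewrite !exprS mulrDl lerD// ler_wpM2l//.
  by rewrite lerXn2r ?nnegrE ?addr_ge0// lerDl.
by rewrite lerXn2r ?nnegrE ?addr_ge0// lerDr.
Qed.

Lemma hnorm_row_le (R : realType) d M (rho : 'I_d -> nat) (xi : 'rV[R]_d) (t : R) :
  common_multiple M rho ->
  hnorm M rho xi <= hnorm M (rhot rho) (row_mx xi (const_mx t)) <= hnorm M rho xi + `|t|.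
Proof.
move=> cM; have cM' := rhot_multiple cM; have [M0 _] := cM.
have h0 := hnorm_ge0 M rho xi.
rewrite hnorm_ge// hnorm_le ?addr_ge0// gauge_row hnormX// lerDl even_pow_ge0/=.
rewrite exprM -(real_normK (num_real t)) -exprM -hnormX//.
by apply: exprD_ge => //; rewrite muln_gt0.
Qed.

(** If [h'] exceeds [h] by at most 3, then [1 + h' <= 4 * (1 + h)]; the 3 is the bound on [|t|] in
    the support of the bump. *)
Lemma powR_Nneg (R : realType) (r : R) : exists2 C : R, 0 < C & forall h h' b : R,
  0 <= h -> h <= h' -> h' <= h + b -> 0 <= b <= 3 -> (1 + h) `^ r <= C * (1 + h') `^ r.
Proof.
have [C C0 CP] := powR_comparable r (ler1n _ 4 : (1 : R) <= 4).
exists C => // h h' b h0 hh hb /andP[b0 b3]; apply: CP; move: h0 hh hb b0 b3; clear; lra.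
Qed.

(** On the support of [eta], [t] is bounded, so decay in [xi] is decay in [(xi, t)]. That [f] has
    every order makes up for the derivatives in [t], which gain nothing. *)
Lemma tensor_symb (R : realType) n d M (rho : 'I_d -> nat) (U : set 'rV[R]_n)
    (f : 'rV[R]_(n + d) -> R) (eta : R -> R) : common_multiple M rho -> open U ->
  rsmooth_on (prod_set U setT) f -> (forall e, symb M rho U e f) ->
  rsmooth_on setT (fun z : 'rV[R]_(n + (d + 1)) => eta (z 0 (tix n d))) ->
  (forall t, 3 <= `|t| -> eta t = 0) ->
  forall e, symb M (rhot rho) U e (fun z => f (xpr z) * eta (z 0 (tix n d))).
Proof.
move=> cM oU sf hf se eta0 e K cK KU l; have oF := @open_full R n (d + 1) U oU.
set r := e - _.
pose Z := prod_set K [set: 'rV[R]_(d + 1)].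
have ZA : Z `<=` prod_set U setT by move=> z [/KU].
have AF (z : 'rV[R]_(n + (d + 1))) : prod_set U [set: 'rV[R]_(d + 1)] z ->
    prod_set U [set: 'rV[R]_d] (xpr z) by move=> [Uz _]; split=> //; rewrite lsubmx_xpr.
have sfx := smooth_affine oF (coord_affine_xpr R n d) AF sf.
have se' := sub_smooth (@subsetT _ (prod_set U [set: 'rV[R]_(d + 1)])) se.
have hfx s : exists2 C : R, 0 < C & forall z, Z z ->
    `|pderivs s (f \o @xpr R n d) z| <= C * (1 + hnorm M rho (rsubmx (xpr z))) `^ r.
  set p := pmap (fun i => [pick j | sg j == i]) s.
  (* The order is raised by the weight of [p], which [symb] subtracts again, so that all lists share
     the exponent [r]. *)
  have [C C0 CP] := hf (r + (sw rho p)%:R) K cK KU p.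
  exists C => // z Zz; rewrite (pderivs_oaffine s oF (coord_affine_xpr R n d) AF sf (ZA _ Zz)).
  rewrite big1// mul1r; case: ifP => _; last first.
    by rewrite normr0 mulr_ge0 ?powR_ge0// ltW.
  have Kx : K (lsubmx (xpr z)) by rewrite lsubmx_xpr; case: Zz.
  by have := CP _ (rsubmx (xpr z)) Kx; rewrite hsubmxK addrK.
have hex s : exists2 C : R, 0 < C & forall z, Z z ->
    `|pderivs s (fun z => eta (z 0 (tix n d))) z| <= C * (`|z 0 (tix n d)| <= 3)%R%:R.
  by have [C C0 CP] := tline_bounded se eta0 s; exists C => // z _; exact: CP.
have [C C0 CP] := pderivsM_bounded oF ZA sfx se' hfx hex l.
have [D D0 DP] := powR_Nneg r.
exists (C * D) => [|x xi Kx]; first exact: mulr_gt0.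
have Zz : Z (row_mx x xi) by exact: prod_set_row.
apply: le_trans (CP _ Zz) _; rewrite -mulrA ler_wpM2l ?(ltW C0)//.
set t := row_mx x xi 0 (tix n d).
have [t3|_] := leP `|t| 3; last by rewrite mulr0 mulr_ge0 ?powR_ge0 ?(ltW D0).
rewrite mulr1 xpr_row row_mxKr.
have xiE : xi = row_mx (lsubmx xi) (const_mx t).
  have := emb_xpr (row_mx x xi); rewrite -/t xpr_row emb_row.
  by move=> /(congr1 rsubmx); rewrite !row_mxKr.
have := hnorm_row_le (lsubmx xi) t cM; rewrite -xiE => /andP[h1 h2].
by apply: DP h1 h2 _; [exact: hnorm_ge0|rewrite normr_ge0].
Qed.

(** [1 + s h] and [1 + h] are comparable with the constant [1 + s + 1 / s]. *)
Lemma symb_xdil (R : realType) n d M (rho : 'I_d -> nat) (U : set 'rV[R]_n)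
    (f : 'rV[R]_(n + d) -> R) e s : common_multiple M rho -> open U -> 0 < s ->
  rsmooth_on (prod_set U setT) f -> symb M rho U e f ->
  symb M rho U e (f \o xdil rho s).
Proof.
move=> cM oU s0 sf hf K cK KU l; have [C C0 CP] := hf K cK KU l.
have oF := @open_full R n d U oU.
have si0 : 0 < s^-1 by rewrite invr_gt0.
have c1 : 1 <= 1 + s + s^-1 by rewrite -addrA lerDl addr_ge0 ?ltW.
have [D D0 DP] := powR_comparable (e - (sw rho l)%:R) c1.
exists (s ^+ sw rho l * (C * D)) => [|x xi Kx]; first by rewrite mulr_gt0 ?exprn_gt0 ?mulr_gt0.
have Fz : prod_set U [set: 'rV[R]_d] (row_mx x xi) by apply: prod_set_row => //; exact: KU.
rewrite (pderivs_xdil l oF (fun z => @full_xdil R n d rho U s z) sf Fz) xdil_row.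
rewrite normrM ger0_norm ?exprn_ge0 ?(ltW s0)// -mulrA ler_wpM2l ?exprn_ge0 ?(ltW s0)//.
apply: le_trans (CP _ _ Kx) _; rewrite -mulrA ler_wpM2l ?(ltW C0)//.
rewrite hnorm_dil ?(ltW s0)//.
have h0 := hnorm_ge0 M rho xi; have sh0 := mulr_ge0 (ltW s0) h0.
apply: DP; rewrite ?ltr_pwDl//.
  by move: s0 si0 h0 sh0; set h := hnorm _ _ _; clear; nra.
have : s^-1 * (s * hnorm M rho xi) = hnorm M rho xi by rewrite mulKf// gt_eqF.
have := mulr_ge0 (ltW s0) sh0.
by move: s0 si0 h0 sh0; set h := hnorm _ _ _; clear; set u := s * h; nra.
Qed.

Lemma symb_out_emb (R : realType) n d M (rho : 'I_d -> nat) (U : set 'rV[R]_n)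
    (f : 'rV[R]_(n + (d + 1)) -> R) e : common_multiple M rho -> open U ->
  rsmooth_on (punctured U) f -> symb_out M (rhot rho) U e f ->
  symb_out M rho U e (f \o emb 1).
Proof.
move=> cM oU sf hf K cK KU l.
have [B [C [C0 CP]]] := hf K cK KU (map (@sg n d) l); rewrite sw_sg in CP.
have [D D0 DP] := powR_comparable (e - (sw rho l)%:R) (ler1n _ 2 : (1 : R) <= 2).
exists (Num.max B 1), (C * D); split=> [|x xi Kx]; first exact: mulr_gt0.
rewrite ge_max => /andP[hB h1]; have h0 : 0 < hnorm M rho xi by exact: lt_le_trans h1.
have oP := @open_punctured R n d U oU.
have Pz : punctured U (row_mx x xi).
  by apply: prod_set_row; [exact: KU|rewrite /= -(hnorm_gt0 _ cM)].
rewrite (pderivs_emb l oP (@punctured_emb R n d U 1) sf Pz) emb_row.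
have t01 : 0 <= (1 : R) <= 1 by rewrite ler01 lexx.
have /andP[ha hb] := hnorm_row cM t01 h1.
apply: le_trans (CP _ _ Kx (le_trans hB ha)) _; rewrite -mulrA ler_wpM2l ?(ltW C0)//.
apply: DP => //; first exact: lt_le_trans ha.
by rewrite (le_trans ha)// ler_peMl ?ler1n// hnorm_ge0.
Qed.

Definition hs_real (R : realType) n d M (rho : 'I_d -> nat) (U : set 'rV[R]_n) (m : R)
    (u : 'rV[R]_(n + d) -> R) :=
  rsmooth_on (prod_set U setT) u /\ forall s, 0 < s -> forall e,
    symb M rho U e (fun z => u (xdil rho s z) - s `^ m * u z).

Lemma symb_out0 (R : realType) n d M (rho : 'I_d -> nat) (U : set 'rV[R]_n) e :
  symb_out M rho U e (fun _ : 'rV[R]_(n + d) => 0).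
Proof.
move=> K cK KU l; exists 0, 1; split=> // x xi _ _.
by rewrite pderivs0 normr0 mul1r powR_ge0.
Qed.

(** At [t = 1] the function splits as [(u - v) + v]: the first part has every order, the second has
    its Taylor expansion. *)
Lemma hs_real_expansion (R : realType) n d M (rho : 'I_d -> nat) (U : set 'rV[R]_n) (m : R)
    (u : 'rV[R]_(n + (d + 1)) -> R) (f : 'rV[R]_(n + d) -> R) :
  common_multiple M rho -> open U -> rsmooth_on (prod_set U setT) f ->
  hs_real M (rhot rho) U m u ->
  (forall z, prod_set U setT z -> u (emb 1 z) = f z) ->
  exists a : nat -> 'rV[R]_(n + d) -> R,
    [/\ forall j, rsmooth_on (punctured U) (a j),
        forall j, hom_dil rho U (m - j%:R) (a j) &
        forall N, symb_out M rho U (m - N%:R) (fun z => f z - \sum_(j < N) a j z)].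
Proof.
move=> cM oU sf [su hu] uf; have cM' := rhot_multiple cM.
have [v [sv hv uv]] := homogeneous_limit cM' oU su hu.
have oP := @open_punctured R n d U oU.
have suP := sub_smooth (@punctured_full R n (d + 1) U) su.
have suv := smoothB (@open_punctured R n (d + 1) U oU) suP sv.
exists (taylor_coef v); split=> [j|j|N].
- exact: smooth_taylor_coef.
- exact: hom_taylor_coef.
- have s1 := smooth_emb oP (@punctured_emb R n d U 1) suv.
  have s2 : rsmooth_on (punctured U)
      (fun z => v (emb 1 z) - \sum_(j < N) @taylor_coef R n d v j z).
    apply: (smoothB oP); first exact: smooth_emb oP (@punctured_emb R n d U 1) sv.
    by apply: (smooth_sum _ oP) => j; exact: smooth_taylor_coef.
  have h1 := symb_out_emb cM oU suv (uv (m - N%:R)).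
  have h2 := taylor_symb N cM oU sv hv.
  apply: (symb_out_eq (B := 0) cM oU _ (symb_outD cM oU s1 s2 h1 h2)) => x xi Ux _ /=.
  by rewrite uf ?addrA ?subrK//; exact: prod_set_row.
Qed.

(* [u = psi b + r(x, xi) eta(t)], where [b] is the Borel sum, [psi] cuts off a
   neighbourhood of the origin, [eta 1 = 1], and [r = f - (psi b)(., 1)] is of
   order [-oo] because [f] and [b(., 1)] have the same expansion. *)
Lemma hs_real_exists (R : realType) n d M (rho : 'I_d -> nat) (U : set 'rV[R]_n) (m : R)
    (f : 'rV[R]_(n + d) -> R) (a : nat -> 'rV[R]_(n + d) -> R) :
  common_multiple M rho -> open U -> rsmooth_on (prod_set U setT) f ->
  (forall j, rsmooth_on (punctured U) (a j)) ->
  (forall j, hom_dil rho U (m - j%:R) (a j)) ->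
  (forall N, symb_out M rho U (m - N%:R) (fun z => f z - \sum_(j < N) a j z)) ->
  exists2 u : 'rV[R]_(n + (d + 1)) -> R, hs_real M (rhot rho) U m u &
    forall z, prod_set U setT z -> u (emb 1 z) = f z.
Proof.
move=> cM oU sf sa ha fa; have cM' := rhot_multiple cM.
have [b [sb hb tb]] := borel_sum cM oU sa ha.
have oF := @open_full R n d U oU; have oF1 := @open_full R n (d + 1) U oU.
have oP := @open_punctured R n d U oU; have oP1 := @open_punctured R n (d + 1) U oU.
pose G (z : 'rV[R]_(n + (d + 1))) := gauge M (rhot rho) (rsubmx z).
have sG (A : set 'rV[R]_(n + (d + 1))) : open A -> rsmooth_on A G.
  move=> oA; apply: (@eq_smooth _ _ _ (fun z => \sum_(i < d + 1)
     z 0 (rshift n i) ^+ (2 * (M %/ rhot rho i))) _ oA).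
    by move=> z _; apply: eq_bigr => i _; rewrite mxE.
  by apply: (smooth_sum _ oA) => i; exact/(smoothX _ oA)/smooth_coord.
(* It is 0 where [G <= 1], which removes the singularity of [b], and 1 where [G >= 2]. *)
pose psi z := step (G z - 1).
have spsi (A : set 'rV[R]_(n + (d + 1))) : open A -> rsmooth_on A psi.
  by move=> oA; exact/(smooth_step oA)/(smoothB oA (sG _ oA))/smooth_cst.
pose ub z := psi z * b z.
have sub : rsmooth_on (prod_set U setT) ub.
  apply: smooth_local => z [Uz _].
  have [z0|z0] := eqVneq (rsubmx z) 0; last first.
    by exists (punctured U); split; [split|exact: smoothM oP1 (spsi _ oP1) sb].
  pose V := [set w : 'rV[R]_(n + (d + 1)) | G w < 1].
  have oV : open V.
    apply: open_lt_smooth; first exact/sG/openT.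
    exact: smooth_cst.
  exists V; split.
    by rewrite /V /= /G z0 (_ : gauge _ _ _ = 0) ?ltr01//; apply/eqP; rewrite gauge_eq0.
  apply: (@eq_smooth _ _ _ (fun=> 0) _ oV); last exact: smooth_cst.
  by move=> w /= Gw; rewrite /ub /psi step_le0 ?mul0r// subr_le0 ltW.
pose r z := f z - ub (emb 1 z).
have FF z : prod_set U [set: 'rV[R]_d] z -> prod_set U [set: 'rV[R]_(d + 1)] (emb 1 z).
  by move=> [Uz _]; split=> //; rewrite /emb row_mxKl.
have sr : rsmooth_on (prod_set U setT) r.
  exact: (smoothB oF sf (smooth_emb oF FF sub)).
have psi1 (z : 'rV[R]_(n + (d + 1))) : 2 < hnorm M (rhot rho) (rsubmx z) -> psi z = 1.
  move=> h; apply: step_ge1; rewrite lerBrDr /G -hnormX//.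
  apply: (le_trans (ltW h)); rewrite -[leLHS]expr1 ler_weXn2l//.
    by rewrite (le_trans _ (ltW h))// ler1n.
  by rewrite muln_gt0; case: cM.
(* Given [e], take [N] with [m - N <= e] and subtract the expansions of [f] and [b(., 1)] up to [N]:
   the partial sums coincide and the cutoff is 1 for large [xi]. *)
have hr e : symb M rho U e r.
  apply: symb_out_symb => //.
  pose N := Num.bound `|m - e|.
  have Ne : m - N%:R <= e.
    rewrite lerBlDr -lerBlDl ltW//.
    exact: le_lt_trans (ler_norm _) (archi_boundP (normr_ge0 _)).
  apply: (symb_out_le Ne).
  have sS : rsmooth_on (punctured U) (fun z => \sum_(j < N) a j z).
    exact: (smooth_sum (index_enum 'I_N) oP (fun j : 'I_N => sa j)).
  have s1 : rsmooth_on (punctured U) (fun z => f z - \sum_(j < N) a j z).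
    exact: (smoothB oP (sub_smooth (@punctured_full R n d U) sf) sS).
  have sS2 : rsmooth_on (punctured U) (fun z => \sum_(j < N) @taylor_coef R n d b j z).
    by apply: (smooth_sum _ oP) => j; exact: smooth_taylor_coef.
  have s2 : rsmooth_on (punctured U)
      (fun z => b (emb 1 z) - \sum_(j < N) @taylor_coef R n d b j z).
    exact: (smoothB oP (smooth_emb oP (@punctured_emb R n d U 1) sb) sS2).
  have h2 := symb_outZ (-1) cM oU s2 (taylor_symb N cM oU sb hb).
  have h3 := symb_outD cM oU s1 (smoothZ (-1) oP s2) (fa N) h2.
  apply: (symb_out_eq (B := 2) cM oU _ h3) => x xi Ux hxi.
  have h0 : 0 < hnorm M rho xi by exact: lt_trans hxi.
  have Pz : punctured U (row_mx x xi).
    by apply: prod_set_row => //=; rewrite -(hnorm_gt0 _ cM).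
  have SE : \sum_(j < N) taylor_coef b j (row_mx x xi) = \sum_(j < N) a j (row_mx x xi).
    by apply: eq_bigr => j _; exact: tb.
  rewrite SE /r /ub psi1; last first.
    rewrite emb_row row_mxKr; apply: lt_le_trans hxi _.
    by case/andP: (hnorm_row_le xi 1 cM).
  by rewrite mulN1r opprB mul1r addrA subrK.
(* It is 1 for [|t - 1| <= 1] and 0 for [(t - 1)^2 >= 2], in particular for [|t| >= 3]. *)
pose eta (t : R) := step (2 - (t - 1) ^+ 2).
have seta (A : set 'rV[R]_(n + (d + 1))) : open A ->
    rsmooth_on A (fun z => eta (z 0 (tix n d))).
  move=> oA; apply/(smooth_step oA)/(smoothB oA); first exact: smooth_cst.
  by apply/(smoothX _ oA)/(smoothB oA); [exact: smooth_coord|exact: smooth_cst].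
have eta0 (t : R) : 3 <= `|t| -> eta t = 0.
  move=> t3; apply: step_le0; rewrite subr_le0.
  have [t0|t0] := leP 0 t; [rewrite ger0_norm// in t3|rewrite ltr0_norm// in t3];
    by move: t3; clear; nra.
have eta1 : eta 1 = 1.
  by apply: step_ge1; rewrite subrr expr0n/= subr0 ler1n.
pose h (z : 'rV[R]_(n + (d + 1))) := r (xpr z) * eta (z 0 (tix n d)).
have Xx (z : 'rV[R]_(n + (d + 1))) : prod_set U [set: 'rV[R]_(d + 1)] z ->
    prod_set U [set: 'rV[R]_d] (xpr z).
  by move=> [Uz _]; split=> //; rewrite lsubmx_xpr.
have sh : rsmooth_on (prod_set U setT) h.
  exact: (smoothM oF1 (smooth_affine oF1 (coord_affine_xpr R n d) Xx sr) (seta _ oF1)).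
have hh := tensor_symb cM oU sr hr (seta _ openT) eta0.
exists (fun z => ub z + h z); last first.
  by move=> z Fz; rewrite /h xpr_emb emb_tix eta1 mulr1 /r addrC subrK.
split=> [|s s0 e]; first exact: smoothD.
have Fx z := @full_xdil R n (d + 1) (rhot rho) U s z.
have cx := @coord_affine_xdil R n (d + 1) (rhot rho) s.
have sup : rsmooth_on (prod_set U setT) (fun z => ub (xdil (rhot rho) s z) - s `^ m * ub z).
  exact: (smoothB oF1 (smooth_affine oF1 cx Fx sub) (smoothZ _ oF1 sub)).
have shx := smooth_affine oF1 cx Fx sh.
have sms := smoothZ (- s `^ m) oF1 sh.
have PF := @punctured_full R n (d + 1) U.
apply: (symb_out_symb cM').
  by apply: (smoothB oF1); [apply: smooth_affine oF1 cx Fx (smoothD oF1 sub sh)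
    |exact/(smoothZ _ oF1)/smoothD].
(* For [hnorm > max 2 (2 / s)] the cutoff is 1 both at the point and at its dilate, and [b] is
   exactly homogeneous, so the defect is identically 0. *)
have o1 : symb_out M (rhot rho) U e (fun z => ub (xdil (rhot rho) s z) - s `^ m * ub z).
  pose B := Num.max 2 (2 / s).
  apply: (symb_out_eq (B := B) cM' oU _ (@symb_out0 R n (d + 1) M (rhot rho) U e)).
  move=> x xi Ux; rewrite gt_max => /andP[h1 h2]; rewrite xdil_row /ub !psi1.
  - have xi0 : xi != 0 by rewrite -(hnorm_gt0 _ cM'); exact: lt_trans h1.
    by rewrite !mul1r hb// subrr.
  - by rewrite row_mxKr.
  - by rewrite row_mxKr hnorm_dil ?(ltW s0)// mulrC -ltr_pdivrMr.
have o2 := symb_symb_out (symb_xdil cM' oU s0 sh (hh e)).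
have o3 := symb_outZ (- s `^ m) cM' oU (sub_smooth PF sh) (symb_symb_out (hh e)).
have o23 := symb_outD cM' oU (sub_smooth PF shx) (sub_smooth PF sms) o2 o3.
have o123 := symb_outD cM' oU (sub_smooth PF sup)
  (smoothD oP1 (sub_smooth PF shx) (sub_smooth PF sms)) o1 o23.
apply: (symb_out_eq (B := 0) cM' oU _ o123) => x xi Ux _ /=.
by rewrite mulrDr opprD addrACA mulNr.
Qed.

(** * Cutoffs and the passage between complex and real expansions *)

Lemma cutoff_mul_smooth (R : realType) n d (U : set 'rV[R]_n) (c : 'rV[R]_d -> R)
    (A : 'rV[R]_(n + d) -> R) (K : set 'rV[R]_d) : open U ->
  rsmooth_on setT c -> nbhs (0 : 'rV[R]_d) K -> (forall xi, K xi -> c xi = 0) ->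
  rsmooth_on (punctured U) A ->
  rsmooth_on (prod_set U setT) (fun z => c (rsubmx z) * A z).
Proof.
move=> oU sc nK cK sA; have oF := @open_full R n d U oU.
have oP := @open_punctured R n d U oU.
have scr : rsmooth_on (prod_set U setT) (c \o rsubmx).
  have ca : coord_affine (rsubmx : 'rV[R]_(n + d) -> 'rV[R]_d)
      (fun i => if fintype.split i is inr j then Some j else None) (fun=> 1).
    split=> [|z h i]; first exact: continuous_rsubmx.
    rewrite -(splitK i) unsplitK mulr1; apply/rowP => k.
    case: (fintype.split i) => j /=; rewrite !mxE eqxx/=; congr (_ + _).
      by rewrite eq_rlshift.
    by rewrite eq_rshift.
  exact: smooth_affine oF ca (fun _ _ => I) sc.
apply: smooth_local => z [Uz _]; have [z0|z0] := eqVneq (rsubmx z) 0; last first.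
  exists (punctured U); split; first by split.
  exact: (smoothM oP (sub_smooth (@punctured_full R n d U) scr) sA).
(* Near [xi = 0] the cutoff vanishes on an open set, so the product is 0 there whatever [A] is. *)
move: nK; rewrite nbhsE => -[V [oV V0] VK].
exists (prod_set U V); split; first by split; rewrite ?z0.
apply: (@eq_smooth _ _ _ (fun=> 0) _ (open_prod_set oU oV)); last exact: smooth_cst.
by move=> w [_ /VK Kw]; rewrite cK// mul0r.
Qed.

Lemma cutoff_large (R : realType) d M (rho : 'I_d -> nat) (L : set 'rV[R]_d) :
  common_multiple M rho -> compact L ->
  exists B : R, forall xi, B < hnorm M rho xi -> ~ L xi.
Proof.
move=> cM cL; have [M0 _] := cM.
have [Q Q0 QP] := compact_le_bound cL (fun z _ => @continuous_gauge R d M rho z).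
exists (Num.max 1 Q) => xi; rewrite gt_max => /andP[h1 hQ] /QP.
rewrite ger0_norm ?gauge_ge0// leNgt => /negP; apply; apply: lt_le_trans hQ _.
by rewrite -hnormX// -[leLHS]expr1 ler_weXn2l ?(ltW h1)// muln_gt0.
Qed.

(** The definition quantifies over all cutoffs; one must exist for the expansion to carry
    information. *)
Lemma cutoff_exists (R : realType) d M (rho : 'I_d -> nat) : common_multiple M rho ->
  cutoff (fun xi : 'rV[R]_d => (step (gauge M rho xi - 1))%:C%C).
Proof.
move=> cM; have [M0 _] := cM; split.
- split; last exact: smooth_cst.
  apply: (smooth_step openT); apply: (smoothB openT); last exact: smooth_cst.
  exact: smooth_gauge openT.
- exists [set xi | 0 <= hnorm M rho xi <= 1]; split.
  + exact: (compact_hnorm_shell cM (lexx 0) ler01).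
  + have o1 : open [set xi : 'rV[R]_d | gauge M rho xi < 1].
      apply: open_lt_smooth; last exact: smooth_cst.
      exact: smooth_gauge openT.
    have h0 : gauge M rho (0 : 'rV[R]_d) < 1.
      by rewrite (_ : gauge _ _ _ = 0) ?ltr01//; apply/eqP; rewrite gauge_eq0.
    apply: filterS (open_nbhs_nbhs (conj o1 h0)) => xi /= g1.
    by rewrite hnorm_ge0/= hnorm_le// expr1n ltW.
  + move=> xi /andP[_]; rewrite hnorm_le// expr1n => g1.
    by rewrite step_le0// subr_le0.
- exists [set xi | 0 <= hnorm M rho xi <= 2].
    by apply: (compact_hnorm_shell cM (lexx 0)); rewrite ler0n.
  move=> xi /= /negP; rewrite hnorm_ge0/= -ltNge => h2.
  rewrite step_ge1// lerBrDr -hnormX// (le_trans (ltW h2))// -[leLHS]expr1 ler_weXn2l//.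
    by rewrite (le_trans _ (ltW h2))// ler1n.
  by rewrite muln_gt0.
Qed.

Lemma ReIm_sum (R : realType) (F : nat -> R[i]) N :
  complex.Re (\sum_(0 <= j < N) F j) = \sum_(0 <= j < N) complex.Re (F j) /\
  complex.Im (\sum_(0 <= j < N) F j) = \sum_(0 <= j < N) complex.Im (F j).
Proof.
elim: N => [|N [IH1 IH2]]; first by rewrite !big_nil.
by rewrite !big_nat_recr//= -IH1 -IH2; case: (\sum_(0 <= _ < _) _); case: (F N).
Qed.

Lemma Re_sub (R : realType) (x y : R[i]) : complex.Re (x - y) = complex.Re x - complex.Re y.
Proof. by case: x; case: y. Qed.

Lemma Im_sub (R : realType) (x y : R[i]) : complex.Im (x - y) = complex.Im x - complex.Im y.
Proof. by case: x; case: y. Qed.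

Lemma Re_mul (R : realType) (x y : R[i]) : complex.Re (x * y) =
  complex.Re x * complex.Re y - complex.Im x * complex.Im y.
Proof. by case: x; case: y. Qed.

Lemma Im_mul (R : realType) (x y : R[i]) : complex.Im (x * y) =
  complex.Re x * complex.Im y + complex.Im x * complex.Re y.
Proof. by case: x => a b; case: y => a' b' /=; rewrite addrC. Qed.

(** Covers the real and the imaginary part of [chi * aj] together: [c1] is the real part of [chi],
    [c2] plus or minus its imaginary part, which vanishes near infinity because [chi] is 1 there. *)
Lemma cutoff_symb (R : realType) n d M (rho : 'I_d -> nat) (U : set 'rV[R]_n) (e : R)
    (f : 'rV[R]_(n + d) -> R) (a1 a2 : nat -> 'rV[R]_(n + d) -> R)
    (c1 c2 : 'rV[R]_d -> R) (K L : set 'rV[R]_d) N :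
  common_multiple M rho -> open U -> rsmooth_on (prod_set U setT) f ->
  (forall j, rsmooth_on (punctured U) (a1 j)) ->
  (forall j, rsmooth_on (punctured U) (a2 j)) ->
  rsmooth_on setT c1 -> rsmooth_on setT c2 ->
  nbhs (0 : 'rV[R]_d) K -> (forall xi, K xi -> c1 xi = 0) -> (forall xi, K xi -> c2 xi = 0) ->
  compact L -> (forall xi, ~ L xi -> c1 xi = 1) -> (forall xi, ~ L xi -> c2 xi = 0) ->
  symb_out M rho U e (fun z => f z - \sum_(j < N) a1 j z) ->
  rsmooth_on (prod_set U setT) (fun z => f z -
    \sum_(0 <= j < N) (c1 (rsubmx z) * a1 j z + c2 (rsubmx z) * a2 j z)) /\
  symb M rho U e (fun z => f z -
    \sum_(0 <= j < N) (c1 (rsubmx z) * a1 j z + c2 (rsubmx z) * a2 j z)).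
Proof.
move=> cM oU sf sa1 sa2 sc1 sc2 nK K1 K2 cL L1 L2 hf.
have oF := @open_full R n d U oU.
have sD : rsmooth_on (prod_set U setT) (fun z => f z -
    \sum_(0 <= j < N) (c1 (rsubmx z) * a1 j z + c2 (rsubmx z) * a2 j z)).
  apply: (smoothB oF sf).
  apply: (@smooth_sum R _ _ nat (index_iota 0 N)
    (fun j z => c1 (rsubmx z) * a1 j z + c2 (rsubmx z) * a2 j z) oF) => j.
  apply: (smoothD oF); first exact: (cutoff_mul_smooth oU sc1 nK K1 (sa1 j)).
  exact: (cutoff_mul_smooth oU sc2 nK K2 (sa2 j)).
split=> //; apply: (symb_out_symb cM sD).
have [B BL] := cutoff_large cM cL.
apply: (symb_out_eq (B := B) cM oU _ hf) => x xi Ux /BL Lxi /=.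
rewrite big_mkord row_mxKr L1// L2//; congr (_ - _); apply: eq_bigr => j _.
by rewrite mul1r mul0r addr0.
Qed.

Lemma phg_symbol_class_of_expansion (R : realType) n d M (rho : 'I_d -> nat)
    (q : 'rV[R]_d -> R) (U : set 'rV[R]_n) (m : R) (a : 'rV[R]_(n + d) -> R[i])
    (a1 a2 : nat -> 'rV[R]_(n + d) -> R) :
  common_multiple M rho -> homogeneous_quasinorm (dil rho) q -> open U ->
  smooth_on (prod_set U setT) a ->
  (forall j, rsmooth_on (punctured U) (a1 j)) -> (forall j, hom_dil rho U (m - j%:R) (a1 j)) ->
  (forall j, rsmooth_on (punctured U) (a2 j)) -> (forall j, hom_dil rho U (m - j%:R) (a2 j)) ->
  (forall N, symb_out M rho U (m - N%:R)
    (fun z => complex.Re (a z) - \sum_(j < N) a1 j z)) ->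
  (forall N, symb_out M rho U (m - N%:R)
    (fun z => complex.Im (a z) - \sum_(j < N) a2 j z)) ->
  phg_symbol_class rho q U m a.
Proof.
move=> cM hq oU sa s1 h1 s2 h2 o1 o2; have [sR sI] := sa.
split.
  apply/(symbol_classP _ _ cM hq oU); split=> //.
  have E (f : 'rV[R]_(n + d) -> R) (b : nat -> 'rV[R]_(n + d) -> R) :
      (forall N, symb_out M rho U (m - N%:R) (fun z => f z - \sum_(j < N) b j z)) ->
      symb_out M rho U m f.
    move=> /(_ 0%N); rewrite subr0; apply: (symb_out_eq (B := 0) cM oU) => x xi _ _.
    by rewrite big_ord0 subr0.
  by split; apply: symb_out_symb cM _ _ => //; [exact: E o1|exact: E o2].
exists (fun j z => Complex (a1 j z) (a2 j z)) => [j|N chi [[c1 c2] [K [cK nK K0]] [L cL L1]]].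
  split=> [|s x xi s0 Ux xi0]; first by split; [exact: s1|exact: s2].
  by rewrite h1// h2//; simpc.
have sc := smoothZ (-1) openT c2.
have KR xi : K xi -> complex.Re (chi xi) = 0 by move=> /K0 ->.
have KI xi : K xi -> complex.Im (chi xi) = 0 by move=> /K0 ->.
have KI' xi : K xi -> -1 * complex.Im (chi xi) = 0 by move=> /K0 ->; rewrite mulr0.
have LR xi : ~ L xi -> complex.Re (chi xi) = 1 by move=> /L1 ->.
have LI xi : ~ L xi -> complex.Im (chi xi) = 0 by move=> /L1 ->.
have LI' xi : ~ L xi -> -1 * complex.Im (chi xi) = 0 by move=> /L1 ->; rewrite mulr0.
have [sRe bRe] := cutoff_symb cM oU sR s1 s2 c1 sc nK KR KI' cL LR LI' (o1 N.+1).
have [sIm bIm] := cutoff_symb cM oU sI s2 s1 c1 c2 nK KR KI cL LR LI (o2 N.+1).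
have eE : m - N%:R - 1 = m - N.+1%:R by rewrite -addrA -opprD natr1.
rewrite eE; apply/(symbol_classP _ _ cM hq oU).
have RE : (fun z => complex.Re (a z - \sum_(0 <= j < N.+1)
      chi (rsubmx z) * Complex (a1 j z) (a2 j z))) =
    (fun z => complex.Re (a z) - \sum_(0 <= j < N.+1)
      (complex.Re (chi (rsubmx z)) * a1 j z + -1 * complex.Im (chi (rsubmx z)) * a2 j z)).
  apply/funext => z; rewrite Re_sub (ReIm_sum _ _).1; congr (_ - _).
  by apply: eq_bigr => j _; rewrite Re_mul/= mulN1r mulNr.
have IE : (fun z => complex.Im (a z - \sum_(0 <= j < N.+1)
      chi (rsubmx z) * Complex (a1 j z) (a2 j z))) =
    (fun z => complex.Im (a z) - \sum_(0 <= j < N.+1)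
      (complex.Re (chi (rsubmx z)) * a2 j z + complex.Im (chi (rsubmx z)) * a1 j z)).
  apply/funext => z; rewrite Im_sub (ReIm_sum _ _).2; congr (_ - _).
  by apply: eq_bigr => j _; rewrite Im_mul.
rewrite -RE in sRe bRe; rewrite -IE in sIm bIm.
split; first by split; [exact: sRe|exact: sIm].
by split; [exact: bRe|exact: bIm].
Qed.

Lemma expansion_of_phg_symbol_class (R : realType) n d M (rho : 'I_d -> nat)
    (q : 'rV[R]_d -> R) (U : set 'rV[R]_n) (m : R) (a : 'rV[R]_(n + d) -> R[i]) :
  common_multiple M rho -> homogeneous_quasinorm (dil rho) q -> open U ->
  phg_symbol_class rho q U m a ->
  exists aj : nat -> 'rV[R]_(n + d) -> R[i],
    [/\ forall j, homog_class rho U (m - j%:R) (aj j),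
      forall N, symb_out M rho U (m - N%:R)
        (fun z => complex.Re (a z) - \sum_(j < N) complex.Re (aj j z)) &
      forall N, symb_out M rho U (m - N%:R)
        (fun z => complex.Im (a z) - \sum_(j < N) complex.Im (aj j z))].
Proof.
move=> cM hq oU [sya [aj haj hexp]]; exists aj.
have cut := @cutoff_exists R d M rho cM; have [_ _ [L cL L1]] := cut.
have [B BL] := cutoff_large cM cL.
have main N : symb_out M rho U (m - N%:R)
      (fun z => complex.Re (a z) - \sum_(j < N) complex.Re (aj j z)) /\
    symb_out M rho U (m - N%:R)
      (fun z => complex.Im (a z) - \sum_(j < N) complex.Im (aj j z)).
  (* The expansion in the definition starts with a remainder of order [m - 1]; the empty sum, of
     order [m], is covered by membership in the symbol class. *)
  case: N => [|N].
    have [_ [bR bI]] := (symbol_classP m a cM hq oU).1 sya.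
    rewrite subr0; split.
      apply: (symb_out_eq (B := 0) cM oU _ (symb_symb_out bR)) => x xi _ _.
      by rewrite big_ord0 subr0.
    apply: (symb_out_eq (B := 0) cM oU _ (symb_symb_out bI)) => x xi _ _.
    by rewrite big_ord0 subr0.
  have [_ [bR bI]] := (symbol_classP _ _ cM hq oU).1 (hexp N _ cut).
  have eE : m - N%:R - 1 = m - N.+1%:R by rewrite -addrA -opprD natr1.
  rewrite eE in bR bI; split.
    apply: (symb_out_eq (B := B) cM oU _ (symb_symb_out bR)) => x xi Ux /BL/L1 chi1.
    rewrite Re_sub (ReIm_sum _ _).1 big_mkord; congr (_ - _); apply: eq_bigr => j _.
    by rewrite row_mxKr chi1 mul1r.
  apply: (symb_out_eq (B := B) cM oU _ (symb_symb_out bI)) => x xi Ux /BL/L1 chi1.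
  rewrite Im_sub (ReIm_sum _ _).2 big_mkord; congr (_ - _); apply: eq_bigr => j _.
  by rewrite row_mxKr chi1 mul1r.
by split=> // N; case: (main N).
Qed.

(** The factor [s^m] is real, so the homogeneity condition separates into real and imaginary
    parts. *)
Lemma hs_classP (R : realType) n d M (rho : 'I_d -> nat) (qt : 'rV[R]_(d + 1) -> R)
    (U : set 'rV[R]_n) (m : R) (u : 'rV[R]_(n + (d + 1)) -> R[i]) :
  common_multiple M rho -> homogeneous_quasinorm (dilt rho) qt -> open U ->
  hs_class rho qt U m u <->
  hs_real M (rhot rho) U m (fun z => complex.Re (u z)) /\
  hs_real M (rhot rho) U m (fun z => complex.Im (u z)).
Proof.
move=> cM hq oU; have oF := @open_full R n (d + 1) U oU.
have RE s : (fun z => complex.Re (u (row_mx (lsubmx z) (dilt rho s (rsubmx z)))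
      - (s `^ m)%:C%C * u z)) =
    (fun z => complex.Re (u (xdil (rhot rho) s z)) - s `^ m * complex.Re (u z)).
  by apply/funext => z; rewrite Re_sub Re_mul/= mul0r subr0 dilt_dil.
have IE s : (fun z => complex.Im (u (row_mx (lsubmx z) (dilt rho s (rsubmx z)))
      - (s `^ m)%:C%C * u z)) =
    (fun z => complex.Im (u (xdil (rhot rho) s z)) - s `^ m * complex.Im (u z)).
  by apply/funext => z; rewrite Im_sub Im_mul/= mul0r addr0 dilt_dil.
split=> [[[sR sI] hu]|[[sR hR] [sI hI]]].
  have H s s0 := (schwartz_classP _ cM hq oU).1 (hu s s0).
  split; split=> // s s0 e; have [_ /(_ e)] := H s s0; rewrite RE IE => -[hR hI].
    exact: hR.
  exact: hI.
split=> [|s s0]; first by split; [exact: sR|exact: sI].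
apply: (schwartz_classP _ cM hq oU).2; split; last first.
  by move=> e; rewrite RE IE; split; [exact: hR|exact: hI].
have Fx z := @full_xdil R n (d + 1) (rhot rho) U s z.
have sd f : rsmooth_on (prod_set U setT) f ->
    rsmooth_on (prod_set U setT) (fun z => f (xdil (rhot rho) s z) - s `^ m * f z).
  move=> sf; apply: (smoothB oF _ (smoothZ _ oF sf)).
  exact: smooth_affine oF (@coord_affine_xdil R n (d + 1) (rhot rho) s) Fx sf.
have sR' := sd _ sR; have sI' := sd _ sI; rewrite -RE in sR'; rewrite -IE in sI'.
by split; [exact: sR'|exact: sI'].
Qed.

Unset Implicit Arguments.

Theorem theorem1p12 (R : realType) (n d : nat) (rho : 'I_d -> nat)
    (rho_gt0 : forall i, (0 < rho i)%N)
    (q : 'rV[R]_d -> R) (hq : homogeneous_quasinorm (dil rho) q)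
    (qt : 'rV[R]_(d + 1) -> R) (hqt : homogeneous_quasinorm (dilt rho) qt)
    (U : set 'rV[R]_n) (hU : open U) (m : R)
    (a : 'rV[R]_(n + d) -> R[i]) (ha : smooth_on (prod_set U setT) a) :
  phg_symbol_class rho q U m a <->
  exists2 u : 'rV[R]_(n + (d + 1)) -> R[i],
    hs_class rho qt U m u &
    forall (x : 'rV[R]_n) (xi : 'rV[R]_d), U x ->
      u (row_mx x (row_mx xi (const_mx 1))) = a (row_mx x xi).
Proof.
have cM := common_multiple_prod rho_gt0; have [sR sI] := ha.
split=> [pa|[u hu ua]].
  have [aj [haj oR oI]] := expansion_of_phg_symbol_class cM hq hU pa.
  have hom j s x xi (s0 : 0 < s) (Ux : U x) (xi0 : xi != 0) := (haj j).2 s x xi s0 Ux xi0.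
  have h1 j : hom_dil rho U (m - j%:R) (fun z => complex.Re (aj j z)).
    by move=> s x xi s0 Ux xi0; rewrite hom// Re_mul/= mul0r subr0.
  have h2 j : hom_dil rho U (m - j%:R) (fun z => complex.Im (aj j z)).
    by move=> s x xi s0 Ux xi0; rewrite hom// Im_mul/= mul0r addr0.
  have [u1 hu1 u1E] := hs_real_exists cM hU sR (fun j => (haj j).1.1) h1 oR.
  have [u2 hu2 u2E] := hs_real_exists cM hU sI (fun j => (haj j).1.2) h2 oI.
  exists (fun z => Complex (u1 z) (u2 z)); first exact/(hs_classP _ _ cM hqt hU).
  move=> x xi Ux; have Fz : prod_set U [set: 'rV[R]_d] (row_mx x xi) by exact: prod_set_row.
  by rewrite -emb_row u1E// u2E//; case: (a _).
have [hR hI] := (hs_classP _ _ cM hqt hU).1 hu.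
have uE z : prod_set U [set: 'rV[R]_d] z -> u (emb 1 z) = a z.
  by move=> [Uz _]; rewrite -[in RHS](hsubmxK z) -ua.
have [a1 [s1 h1 o1]] := hs_real_expansion cM hU sR hR (fun z Fz => congr1 _ (uE z Fz)).
have [a2 [s2 h2 o2]] := hs_real_expansion cM hU sI hI (fun z Fz => congr1 _ (uE z Fz)).
exact: phg_symbol_class_of_expansion cM hq hU ha s1 h1 s2 h2 o1 o2.
Qed.
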